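(* Let $s\in(\{0\}\cup\mathbb{N})^d$ be given, let $P$ be a probability distribution on $\mathbb{R}^d$ with volume dimension $d_{\mathrm{vol}}=d_{\mathrm{vol}}(P)$ (relative to the fixed set $\mathbb{X}\subset\mathbb{R}^d$), let $X_1,\dots,X_n$ be i.i.d. from $P$, and let $l_n>0$ and $\delta\in(0,1)$. Let $K:\mathbb{R}^d\to\mathbb{R}$ be a kernel function such that: (i) the partial derivative $D^sK:\mathbb{R}^d\to\mathbb{R}$ exists and $\|D^sK\|_\infty<\infty$; (ii) $\int_0^\infty t^{d_{\mathrm{vol}}-1}\sup_{\|x\|\ge t}(D^sK)^2(x)\,dt<\infty$; (iii) $\|D^sK\|_\infty,\|D^sK\|_2<\infty$ and $\mathcal{F}^s_{K,[l_n,\infty)}=\{D^sK_{x,h}:x\in\mathbb{X},\,h\ge l_n\}$ is a uniformly bounded VC-class with dimension $\nu$, i.e. there exist positive numbers $A$ and $\nu$ such that, for every probability measure $Q$ on $\mathbb{R}^d$ and every $\eta\in(0,\|D^sK\|_\infty)$, $\mathcal{N}(\mathcal{F}^s_{K,[l_n,\infty)},L_2(Q),\eta)\le\left(\frac{A\|D^sK\|_\infty}{\eta}\right)^{\nu}$. Then, with probability at least $1-\delta$, $$\sup_{h\ge l_n,\,x\in\mathbb{X}}|D^s\hat p_h(x)-D^sp_h(x)|\le C\left(\frac{(\log(1/l_n))_+}{n l_n^{d+|s|}}+\sqrt{\frac{(\log(1/l_n))_+}{n l_n^{2d+2|s|-d_{\mathrm{vol}}+\epsilon}}}+\sqrt{\frac{\log(2/\delta)}{n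 l_n^{2d+2|s|-d_{\mathrm{vol}}+\epsilon}}}+\frac{\log(2/\delta)}{n l_n^{d+|s|}}\right)$$ for any $\epsilon\in(0,d_{\mathrm{vol}})$, where $C$ is a constant depending only on $A$, $\|D^sK\|_\infty$, $d$, $\nu$, $d_{\mathrm{vol}}$, $C_{s,P,K,\epsilon}$, $\epsilon$. Further, if $d_{\mathrm{vol}}=0$, or if $\limsup_{r\to0}\sup_{x\in\mathbb{X}}\frac{P(\mathbb{B}_{\mathbb{R}^d}(x,r))}{r^{d_{\mathrm{vol}}}}<\infty$, then $\epsilon$ can be $0$ in this bound.
   Context: A subset $\mathbb{X}\subset\mathbb{R}^d$ is fixed. $\|\cdot\|$ is the Euclidean norm and $\mathbb{B}_{\mathbb{R}^d}(x,r)=\{y\in\mathbb{R}^d:\|y-x\|<r\}$. The volume dimension of $P$ is $$d_{\mathrm{vol}}(P)=\sup\left\{\nu\ge0:\ \limsup_{r\to0}\sup_{x\in\mathbb{X}}\frac{P(\mathbb{B}_{\mathbb{R}^d}(x,r))}{r^\nu}<\infty\right\}.$$ For $s=(s_1,\dots,s_d)$, $|s|=s_1+\dots+s_d$ and $D^s=\frac{\partial^{|s|}}{\partial x_1^{s_1}\cdots\partial x_d^{s_d}}$. Kernel density estimator: $\hat p_h(x)=\frac{1}{nh^d}\sum_{i=1}^nK\left(\frac{x-X_i}{h}\right)$, and $p_h(x)=\mathbb{E}[\hat p_h(x)]$. $D^sK_{x,h}(\cdot)$ denotes $(D^sK)\left(\frac{x-\cdot}{h}\right)$. $(a)_+=\max(a,0)$.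 $\|\cdot\|_\infty$ and $\|\cdot\|_2$ of a function are the sup norm and the $L_2$ norm. The covering number $\mathcal{N}(\mathcal{F},L_2(Q),\eta)$ is the minimal number of open $L_2(Q)$-balls of radius $\eta$ with centers in $\mathcal{F}$ needed to cover $\mathcal{F}$. $C_{s,P,K,\epsilon}$ denotes a constant, depending only on $s$, $P$, $K$ and $\epsilon$, such that $\mathbb{E}_P\left[\left(D^sK\left(\frac{x-X}{h}\right)\right)^2\right]\le C_{s,P,K,\epsilon}\,h^{d_{\mathrm{vol}}-\epsilon}$ for $x\in\mathbb{X}$, $h>0$, $X\sim P$; such a constant exists under the stated hypotheses.
   Formalization: Proved assuming that 𝕏 and K are Borel, K((x−·)/h) is P-integrable and D^s p_h exists for h ≥ l_n (so that both sides have a meaning), and d_vol ≤ 2d+2|s|, without which the bound fails (e.g. 𝕏={0}, d=1, s=0, density ~|x|^4 near 0). *)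

(* Defs.v *)
From HB Require Import structures.
From mathcomp Require Import all_boot all_order all_algebra.
From mathcomp Require Import all_classical all_reals all_analysis.
From mathcomp Require Import measurable_realfun.

Set Implicit Arguments.
Unset Strict Implicit.
Unset Printing Implicit Defensive.

Import Order.TTheory GRing.Theory Num.Def Num.Theory.
Import numFieldNormedType.Exports.

Local Open Scope classical_set_scope.
Local Open Scope ring_scope.

(* Matrices over R (in particular R^d, represented by 'rV[R]_d) carry the Borel
   sigma-algebra of their topology. *)
Section borel_matrix.
Context {R : realType} {m n : nat}.

Let G : set_system 'M[R]_(m, n) := open.

HB.instance Definition _ := @isMeasurable.Build (sigma_display G) 'M[R]_(m, n)
  <<s G >> (@sigma_algebra0 _ setT G) (@sigma_algebraC _ G)
  (@sigma_algebra_bigcup _ setT G).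

End borel_matrix.

Section borel_row_vectors.
Context {R : realType} {d : nat}.

Lemma measurable_open_rV (U : set 'rV[R]_d) : open U -> measurable U.
Proof. by move=> oU; exact: sub_sigma_algebra. Qed.

Lemma measurable_fun_rV dT (T : measurableType dT) (f : T -> 'rV[R]_d) :
  (forall i, measurable_fun [set: T] (fun t => f t ord0 i)) ->
  measurable_fun [set: T] f.
Proof.
move=> mf.
pose box (q : 'rV[rat]_d * nat) : set 'rV[R]_d :=
  [set v | forall i, `|ratr (q.1 ord0 i) - v ord0 i| < q.2.+1%:R^-1].
have mbox q : measurable (f @^-1` box q).
  have -> : f @^-1` box q = \bigcap_(i in [set: 'I_d])
      ((fun t => f t ord0 i) @^-1` ball (ratr (q.1 ord0 i) : R) q.2.+1%:R^-1).
    by apply/seteqP; split=> [t qt i _|t qt i]; [exact: qt|exact: (qt i I)].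
  apply: fin_bigcap_measurable; first exact: finite_finset.
  move=> i _; rewrite -[X in measurable X]setTI; apply: mf => //.
  exact: measurable_ball.
have mfo : preimage_set_system [set: T] f (@open 'rV[R]_d) `<=` measurable;
  last exact: measurability mfo.
move=> _ [U oU <-]; rewrite setTI.
have -> : f @^-1` U = \bigcup_(q in [set q | box q `<=` U]) (f @^-1` box q).
  apply/seteqP; split=> [t /= Uft|t [q /= qU qt]]; last exact: qU.
  have /nbhs_ballP[e /= e0 eU] : nbhs (f t) U by exact: open_nbhs_nbhs.
  have [k ke] : exists k : nat, k.+1%:R^-1 *+ 2 < e.
    have e20 : 0 < e / 2 by rewrite divr_gt0.
    have [k _ kP] := near_infty_natSinv_lt (PosNum e20).
    have ke : k.+1%:R^-1 < e / 2 by exact: (kP k (leqnn k)).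
    by exists k; rewrite (splitr e) mulr2n ltrD.
  have qex i : exists q : rat, `|ratr q - f t ord0 i| < k.+1%:R^-1.
    have /rat_in_itvoo[q] : f t ord0 i - k.+1%:R^-1 < f t ord0 i + k.+1%:R^-1.
      by rewrite ltrBlDr -addrA ltrDl addr_gt0.
    rewrite inE /= => /itvP qi; exists q.
    by rewrite ltr_distl !qi.
  pose q := \row_i xchoose (qex i).
  have qP i : `|ratr (q ord0 i) - f t ord0 i| < k.+1%:R^-1.
    by rewrite mxE; exact: (xchooseP (qex i)).
  exists (q, k) => //= v qv; apply: eU.
  split=> // i j; rewrite !(ord1 i)/= /ball/=.
  apply: lt_trans ke; rewrite mulr2n -(subrKA (ratr (q ord0 j))).
  by rewrite (le_lt_trans (ler_normD _ _))// ltrD// distrC.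
rewrite bigcup_mkcond; apply: countable_bigcupT_measurable => [|q].
  exact: countableP.
by case: ifPn.
Qed.


Lemma measurable_coord_rV (i : 'I_d) :
  measurable_fun [set: 'rV[R]_d] (fun v => v ord0 i).
Proof.
apply: (measurability _ (RGenOpens.measurableE R)) => _ [_ [a [b ->] <-]].
rewrite setTI; apply: measurable_open_rV.
move/continuousP: (@coord_continuous R 1 d ord0 i); apply.
exact: interval_open.
Qed.

End borel_row_vectors.

Section lebesgue_rV.
Context {R : realType}.

Definition rcons_rV d (x : 'rV[R]_d * R) : 'rV[R]_d.+1 :=
  \row_i oapp (fun j => x.1 ord0 j) x.2 (unlift ord_max i).

Lemma measurable_rcons_rV d : measurable_fun setT (@rcons_rV d).
Proof.
apply: measurable_fun_rV => i; under eq_fun do rewrite mxE.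
case: (unlift ord_max i) => [j|] /=; last exact: measurable_snd.
exact: measurableT_comp (measurable_coord_rV j) measurable_fst.
Qed.

Section step.
Context {d : nat} (m : {measure set 'rV[R]_d -> \bar R}).

Definition lebesgue_step : set 'rV[R]_d.+1 -> \bar R :=
  pushforward (m \x (@lebesgue_measure R))%E (@rcons_rV d).

Let lebesgue_step0 : lebesgue_step set0 = 0%E.
Proof. by rewrite /lebesgue_step measure0//; exact: measurable_rcons_rV. Qed.

Let lebesgue_step_ge0 A : (0 <= lebesgue_step A)%E.
Proof. by rewrite /lebesgue_step measure_ge0//; exact: measurable_rcons_rV. Qed.

Let lebesgue_step_sigma_additive : semi_sigma_additive lebesgue_step.
Proof.
by apply: measure_semi_sigma_additive => //; exact: measurable_rcons_rV.
Qed.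

HB.instance Definition _ := isMeasure.Build _ _ _ lebesgue_step
  lebesgue_step0 lebesgue_step_ge0 lebesgue_step_sigma_additive.

End step.

Fixpoint lebesgue_rV d : {measure set 'rV[R]_d -> \bar R} :=
  if d is d'.+1 then lebesgue_step (lebesgue_rV d') else \d_(0 : 'rV[R]_0).

Lemma measurable_box_rV d (B : 'I_d -> set R) :
  (forall i, measurable (B i)) ->
  measurable [set v : 'rV[R]_d | forall i, B i (v ord0 i)].
Proof.
move=> mB.
have -> : [set v : 'rV[R]_d | forall i, B i (v ord0 i)] =
    \bigcap_(i in [set: 'I_d]) ((fun v : 'rV[R]_d => v ord0 i) @^-1` B i).
  by apply/seteqP; split=> [v Bv i _|v Bv i]; [exact: Bv|exact: (Bv i I)].
apply: fin_bigcap_measurable; first exact: finite_finset.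
by move=> i _; rewrite -[X in measurable X]setTI; exact: measurable_coord_rV.
Qed.

Lemma lebesgue_rV_box d (B : 'I_d -> set R) :
  (forall i, measurable (B i)) ->
  (lebesgue_rV d [set v : 'rV[R]_d | forall i, B i (v ord0 i)] =
   \prod_(i < d) lebesgue_measure (B i))%E.
Proof.
elim: d B => [|d IH] B mB.
  by rewrite big_ord0 /= diracE mem_set//= => -[].
rewrite big_ord_recr/=.
pose B' i := B (widen_ord (leqnSn d) i).
have mB' : measurable [set v : 'rV[R]_d | forall i, B' i (v ord0 i)].
  by apply: measurable_box_rV => i; exact: mB.
rewrite /lebesgue_step /pushforward.
have -> : rcons_rV (d:=d) @^-1` [set v : 'rV[R]_d.+1 | forall i, B i (v ord0 i)] =
    [set v : 'rV[R]_d | forall i, B' i (v ord0 i)] `*` B ord_max.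
  apply/seteqP; split=> [[v t] /= Bv|[v t] /= [Bv Bt] i].
    split=> [i|]; last by have := Bv ord_max; rewrite mxE unlift_none.
    have := Bv (lift ord_max i); rewrite mxE liftK/=.
    rewrite /B'; congr (B _ _); apply/val_inj => /=.
    by rewrite /bump leqNgt ltn_ord.
  rewrite mxE; case: unliftP => [j ->|->] //=.
  have := Bv j; rewrite /B'; congr (B _ _); apply/val_inj => /=.
  by rewrite /bump leqNgt ltn_ord.
rewrite product_measure1E//=; last exact: mB.
by rewrite IH// => i; exact: mB.
Qed.

End lebesgue_rV.

Section geometry.
Context {R : realType} {d : nat}.
Implicit Types (x y : 'rV[R]_d) (X : set 'rV[R]_d) (P : probability 'rV[R]_d R).

(* The library norm on 'rV[R]_d is the sup norm, hence this definition. *)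
Definition enorm x : R := Num.sqrt (\sum_(i < d) x ord0 i ^+ 2).

Definition eball x (r : R) : set 'rV[R]_d := [set y | enorm (y - x) < r].

Definition vol_limsup X P (nu : R) : \bar R :=
  limf_esup (fun r : R => ereal_sup
    [set (P (eball x r) * ((r `^ nu)^-1)%:E)%E | x in X]) 0^'+.

Definition volume_dim X P : \bar R :=
  ereal_sup [set nu%:E | nu in [set nu : R |
    0 <= nu /\ (vol_limsup X P nu < +oo)%E]].

End geometry.

Section partial_derivatives.
Context {R : realType} {d : nat}.
Implicit Types (s : 'I_d -> nat) (f : 'rV[R]_d -> R).

Definition partial (i : 'I_d) f : 'rV[R]_d -> R := 'D_(delta_mx ord0 i) f.

Definition multi_order s : nat := (\sum_(i < d) s i)%N.

(* The first coordinate repeated s_1 times, then the second one s_2 times, etc.: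
   the successive differentiations of D^s, the outermost one first. *)
Definition diff_seq s : seq 'I_d :=
  flatten [seq nseq (s i) i | i <- enum 'I_d].

Definition mderiv s f : 'rV[R]_d -> R := foldr partial f (diff_seq s).

(* 'D_v has a junk value where the derivative does not exist; [mderivable s f]
   states that all the successive derivatives in D^s f exist everywhere. *)
Fixpoint seq_derivable (l : seq 'I_d) f : Prop :=
  if l is i :: l' then
    seq_derivable l' f /\
    forall x, derivable (foldr partial f l') x (delta_mx ord0 i)
  else True.

Definition mderivable s f : Prop := seq_derivable (diff_seq s) f.

End partial_derivatives.

Section function_classes.
Context {R : realType} {d : nat}.
Implicit Types (f g : 'rV[R]_d -> R) (F : set ('rV[R]_d -> R)).

Definition sup_norm f : \bar R := ereal_sup (range (fun x => `|f x|%:E)).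

Definition tail_sup f (t : R) : \bar R :=
  ereal_sup [set (f x)%:E | x in [set x | t <= enorm x]].

Definition L2norm (mu : {measure set 'rV[R]_d -> \bar R}) f : \bar R :=
  Lnorm mu 2%:E (EFin \o f).

(* +oo when there is no finite cover *)
Definition covering_number F (Q : probability 'rV[R]_d R) (eta : R) : \bar R :=
  ereal_inf [set k%:R%:E | k in [set k : nat |
    exists2 c : 'I_k -> 'rV[R]_d -> R, (forall i, F (c i)) &
      forall f, F f -> exists i, (L2norm Q (f \- c i)%R < eta%:E)%E]].

Definition uniform_VC F (M A nu : R) : Prop :=
  forall (Q : probability 'rV[R]_d R) (eta : R), 0 < eta < M ->
    (covering_number F Q eta <= ((A * M / eta) `^ nu)%:E)%E.

Definition rescaled f (x : 'rV[R]_d) (h : R) : 'rV[R]_d -> R :=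
  fun y => f (h^-1 *: (x - y)).

Definition rescaled_class f (X : set 'rV[R]_d) (l : R) : set ('rV[R]_d -> R) :=
  [set rescaled f x h | x in X & h in [set h | l <= h]].

End function_classes.

Section probability.
Context {R : realType} {dO : measure_display} {Omega : measurableType dO}.
Variable Pr : probability Omega R.

(* S itself need not be measurable. *)
Definition prob_ge (S : set Omega) (p : R) : Prop :=
  exists E, [/\ measurable E, E `<=` S & (p%:E <= Pr E)%E].

Definition identically_distributed dT (T : measurableType dT) n
    (X : 'I_n -> {RV Pr >-> T}) (P : probability T R) : Prop :=
  forall i B, measurable B -> distribution Pr (X i) B = P B.

(* Taking some B i to be the whole space gives the product rule for all the
   subfamilies. *)
Definition independent dT (T : measurableType dT) n
    (X : 'I_n -> {RV Pr >-> T}) : Prop :=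
  forall B : 'I_n -> set T, (forall i, measurable (B i)) ->
    (Pr (\bigcap_(i in [set: 'I_n]) (X i @^-1` B i)) =
     \prod_(i < n) Pr (X i @^-1` B i))%E.

End probability.

Section kernel_density_estimation.
Context {R : realType} {d : nat}.
Implicit Types (K : 'rV[R]_d -> R) (h : R) (x : 'rV[R]_d).

Definition kde K n (xs : 'I_n -> 'rV[R]_d) h x : R :=
  (n%:R * h ^+ d)^-1 * \sum_(i < n) K (h^-1 *: (x - xs i)).

Definition mean_kde dO (Omega : measurableType dO) (Pr : probability Omega R)
    K n (Y : 'I_n -> {RV Pr >-> 'rV[R]_d}) h x : R :=
  fine ('E_Pr[fun w => kde K (Y ^~ w) h x])%E.

Definition kde_deviation (s : 'I_d -> nat) K (X : set 'rV[R]_d) (l : R)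
    dO (Omega : measurableType dO) (Pr : probability Omega R)
    n (Y : 'I_n -> {RV Pr >-> 'rV[R]_d}) (w : Omega) : \bar R :=
  ereal_sup [set `|mderiv s (kde K (Y ^~ w) h) x
                   - mderiv s (mean_kde K Y h) x|%:E
            | h in [set h | l <= h] & x in X].

(* [c] is an admissible value of C_{s,P,K,eps}: here f is D^s K and
   e is d_vol - eps. *)
Definition second_moment_bound f (X : set 'rV[R]_d)
    (P : probability 'rV[R]_d R) (e c : R) : Prop :=
  forall x h, X x -> 0 < h ->
    ('E_P[fun y => (rescaled f x h y ^+ 2)%R] <= (c * h `^ e)%:E)%E.

(* m stands for |s| *)
Definition kde_rate n m (l dvol eps delta : R) : R :=
  let log_l := Num.max (ln l^-1) 0 in
  let v := n%:R * l `^ (2 * d%:R + 2 * m%:R - dvol + eps) in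
  let b := n%:R * l ^+ (d + m) in
  log_l / b + Num.sqrt (log_l / v)
  + Num.sqrt (ln (2 / delta) / v) + ln (2 / delta) / b.

End kernel_density_estimation.
Arguments kde_rate {R} d n m l dvol eps delta.

(* Main.v *)
From HB Require Import structures.
Require Import Defs.
From mathcomp Require Import all_boot all_order all_algebra.
From mathcomp Require Import all_classical all_reals all_analysis.
From mathcomp Require Import measurable_realfun ring lra.

Set Implicit Arguments.
Unset Strict Implicit.
Unset Printing Implicit Defensive.

Import Order.TTheory GRing.Theory Num.Def Num.Theory.
Import numFieldNormedType.Exports.

Local Open Scope classical_set_scope.
Local Open Scope ring_scope.

(* Symmetrization followed by chaining. The functions D^s K((x - .)/h) are
   normalized by (l/h)^(d+|s|) <= 1, which makes their second moments at most
   sigma^2 = C l^(d_vol - eps). The sample is compared with an independent ghost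
   copy; swapping each point with its ghost at random does not change the joint
   law, so it is enough to bound, for any fixed 2n points, the proportion of
   the swaps for which some function of the class has a large difference of
   empirical means while its ghost empirical second moment is at most
   4 sigma^2. Functions whose second moment over the 2n points is small are
   handled by chaining in L2 of these points, with Hoeffding's inequality at
   each link; the other ones would have very different second moments on the
   two halves, which a union bound over a single cover excludes. Both steps
   together give the Bernstein-type bound without Talagrand's inequality.
   The class is uncountable and not separable, so the events above need not be
   measurable: they are projections of measurable sets, which Choquet's
   capacitability argument approximates from inside and outside by measurable
   sets.
   The derivative of the mean is computed through iterated difference quotients,
   all of them bounded by the sup norm of D^s K, so that dominated convergence
   applies although the lower order derivatives may fail to be integrable. *)

(** * Measurability of projections *)

(** Write p = d + |s|. The deviation at bandwidth h carries the factor h^-p, which the normalization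
    by (l/h)^p turns into l^-p for every h >= l: one empirical process covers all bandwidths and no
    peeling over scales is needed. The price is twofold. The normalized second moments are bounded
    by (l/h)^(2p) C h^(d_vol - eps), which is largest at h = l only if d_vol - eps <= 2p; and the
    factor (l/h)^p has to be discretized together with the functions when the class is covered. A
    single number L = (log(1/l))_+ + log(2/delta) measures both entropy and confidence. Since L >=
    log 2, it absorbs constants and the powers of 2 of the chain. The chain starts at a radius tau
    of order sigma + max(M,1) sqrt(L/n), where M is the sup norm, and C is replaced by max(C,1) in
    sigma so that tau >= l^((d_vol - eps)/2); hence log(1/tau) is at most a multiple of L too. The
    resulting bound tau sqrt(L/n) is the Bernstein sum of sigma sqrt(L/n) and max(M,1) L/n, up to
    constants. *)

Section souslin.
Context {Z : topologicalType} {dW : measure_display} {W : measurableType dW}.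
Implicit Types A : set (Z * W).

(** Souslin's operation over a scheme of rectangles. Closedness of the first factor is what lets
    compactness act on the witnesses when the set is projected. *)
Definition souslin A := exists (C : seq nat -> set Z) (F : seq nat -> set W),
  [/\ forall s, closed (C s), forall s, measurable (F s) &
    A = [set p | exists u : nat -> nat, forall k,
      C (mkseq u k) p.1 /\ F (mkseq u k) p.2]].

Lemma souslin_rect (C : set Z) (F : set W) : closed C -> measurable F ->
  souslin (C `*` F).
Proof.
move=> cC mF; exists (fun=> C), (fun=> F); split=> //.
by apply/seteqP; split=> [p Cp|p [u /(_ 0%N)]] //; exists id.
Qed.

(** The first entry of the witness selects the index, the remaining ones are a witness for the
    selected set; the empty prefix imposes nothing. *)
Lemma souslin_bigcup (A : (set (Z * W))^nat) : (forall i, souslin (A i)) ->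
  souslin (\bigcup_i A i).
Proof.
move=> /(_ _)/cid => sA.
pose C i := projT1 (sA i).
have /(_ _)/cid sA' i := projT2 (sA i).
pose F i := projT1 (sA' i).
have CF i : [/\ forall s, closed (C i s), forall s, measurable (F i s) &
    A i = [set p | exists u : nat -> nat, forall k,
      C i (mkseq u k) p.1 /\ F i (mkseq u k) p.2]] := projT2 (sA' i).
exists (fun s => if s is i :: s' then C i s' else setT),
  (fun s => if s is i :: s' then F i s' else setT); split.
- by case=> [|i s]; [exact: closedT|have [+ _ _] := CF i; apply].
- by case=> [|i s] //; have [_ + _] := CF i; apply.
apply/seteqP; split=> [p [i _]|p [u uP]].
  have [_ _ ->] := CF i => -[u uP].
  exists (fun k => if k is k'.+1 then u k' else i) => -[|k] //.
  rewrite /mkseq/= -[1%N]addn0 iotaDl -map_comp; exact: uP.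
exists (u 0%N) => //; have [_ _ ->] := CF (u 0%N).
exists (u \o S) => k; have := uP k.+1.
by rewrite /mkseq/= -[1%N]addn0 iotaDl -map_comp.
Qed.

(* A sequence of witnesses [u i] is packed into one through a pairing of nat;
   the i-th condition at depth k is imposed as soon as it can be read off. *)
Lemma souslin_bigcap (A : (set (Z * W))^nat) : (forall i, souslin (A i)) ->
  souslin (\bigcap_i A i).
Proof.
move=> /(_ _)/cid => sA.
pose C i := projT1 (sA i).
have /(_ _)/cid sA' i := projT2 (sA i).
pose F i := projT1 (sA' i).
have CF i : [/\ forall s, closed (C i s), forall s, measurable (F i s) &
    A i = [set p | exists u : nat -> nat, forall k,
      C i (mkseq u k) p.1 /\ F i (mkseq u k) p.2]] := projT2 (sA' i).
pose ok (s : seq nat) : set (nat * nat) :=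
  [set q | forall j, (j < q.2)%N -> (pickle (q.1, j) < size s)%N].
pose sub s (q : nat * nat) := mkseq (fun j => nth 0%N s (pickle (q.1, j))) q.2.
exists (fun s => \bigcap_(q in ok s) C q.1 (sub s q)),
  (fun s => \bigcap_(q in ok s) F q.1 (sub s q)); split.
- by move=> s; apply: closed_bigI => q _; have [+ _ _] := CF q.1; apply.
- move=> s; rewrite -[X in measurable X]setCK setC_bigcap; apply: measurableC.
  rewrite bigcup_mkcond; apply: countable_bigcupT_measurable => [|q].
    exact: countableP.
  by case: ifP => // _; apply: measurableC; have [_ + _] := CF q.1; apply.
apply/seteqP; split=> [p Ap|p [u uP] i _].
  have /(_ _)/cid Au i : exists u : nat -> nat, forall k,
      C i (mkseq u k) p.1 /\ F i (mkseq u k) p.2.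
    by have := Ap i I; have [_ _ ->] := CF i.
  pose v k := if unpickle k is Some (i, j) then projT1 (Au i) j else 0%N.
  have subE k q : ok (mkseq v k) q ->
      sub (mkseq v k) q = mkseq (projT1 (Au q.1)) q.2.
    move=> okq; apply/eq_in_map => j; rewrite mem_iota/= add0n => /okq.
    by rewrite size_mkseq => jk; rewrite nth_mkseq// /v pickleK.
  by exists v => k; split=> q /[dup] /subE -> _; exact: (projT2 (Au q.1) q.2).1
    || exact: (projT2 (Au q.1) q.2).2.
have [_ _ ->] := CF i; exists (fun j => u (pickle (i, j))) => k.
pose m := (\sum_(j < k) (pickle (i, j : nat)).+1)%N.
have jm j : (j < k)%N -> (pickle (i, j) < m)%N.
  move=> jk; rewrite /m (bigD1 (Ordinal jk))//=; exact: leq_addr.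
have okm : ok (mkseq u m) (i, k) by move=> j /jm; rewrite size_mkseq.
have subE : sub (mkseq u m) (i, k) = mkseq (fun j => u (pickle (i, j))) k.
  apply/eq_in_map => j; rewrite mem_iota/= add0n => /jm jm'.
  by rewrite nth_mkseq.
by have [/(_ _ okm) + /(_ _ okm)] := uP m; rewrite subE.
Qed.

End souslin.

Lemma open_bigcup_closed {R : realType} d (O : set 'rV[R]_d) : open O ->
  exists2 C : (set 'rV[R]_d)^nat, (forall n, closed (C n)) & O = \bigcup_n C n.
Proof.
move=> oO; exists (fun n => [set z | ball z n.+1%:R^-1 `<=` O]) => [n|].
  rewrite -openC.
  suff -> : ~` [set z | ball z n.+1%:R^-1 `<=` O] =
      \bigcup_(y in ~` O) ball y n.+1%:R^-1.
    by apply: bigcup_open => y _; exact: ball_open.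
  apply/seteqP; split=> [z /= /existsNP[y /not_implyP[zy Oy]]|z [y Oy yz] zO].
    by exists y => //; exact: ball_sym.
  by apply: Oy; apply: zO; exact: ball_sym.
apply/seteqP; split=> [z Oz|z [n _ zO]]; last exact/zO/ballxx.
have /nbhs_ballP[e /= e0 eO] : nbhs z O by exact: open_nbhs_nbhs.
have [n _ /(_ n (leqnn n)) ne] := near_infty_natSinv_lt (PosNum e0).
exists n => //= y zy; apply: eO.
by apply: le_ball zy; exact: ltW.
Qed.

Section souslin_measurable.
Context {R : realType} {d : nat} {dW : measure_display} {W : measurableType dW}.

(** Souslin sets are not stable under complement. Requiring the property of a set and of its
    complement gives a sigma-algebra, so that it is enough to look at the generators. *)
Let bisouslin (A : set ('rV[R]_d * W)) := souslin A /\ souslin (~` A).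

Let bisouslin_sigma : sigma_algebra setT bisouslin.
Proof.
split.
- split; last first.
    rewrite setC0 -(_ : setT `*` setT = setT).
      by apply: souslin_rect => //; exact: closedT.
    by apply/seteqP; split.
  rewrite -(set0X (@setT W)).
  by apply: souslin_rect => //; exact: closed0.
- by move=> A [sA sCA]; rewrite setTD /bisouslin setCK.
- move=> A sA; split; first by apply: souslin_bigcup => i; exact: (sA i).1.
  by rewrite setC_bigcup; apply: souslin_bigcap => i; exact: (sA i).2.
Qed.

Lemma measurable_souslin (A : set ('rV[R]_d * W)) : measurable A -> souslin A.
Proof.
move=> mA; suff /(_ _ mA)[//] : @measurable _ ('rV[R]_d * W)%type `<=` bisouslin.
rewrite measurable_prod_measurableType; apply: smallest_sub => //.
have bigcup_setXT (F : (set 'rV[R]_d)^nat) :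
    (\bigcup_i F i) `*` (@setT W) = \bigcup_i (F i `*` setT).
  apply/seteqP; split=> -[z w] /=; first by move=> [[i _ Fz] _]; exists i.
  by move=> [i _ [Fz _]]; split=> //; exists i.
have bisouslinC (B : set 'rV[R]_d) : measurable B -> bisouslin (B `*` setT).
  suff : measurable `<=` [set C : set 'rV[R]_d | bisouslin (C `*` setT)].
    by apply.
  apply: smallest_sub => [|O oO].
    have [b0 bC bU] := bisouslin_sigma; split=> /=.
    - by rewrite set0X.
    - move=> C /= /bC; rewrite !setTD; congr bisouslin.
      by apply/seteqP; split=> -[z w] /=; tauto.
    - by move=> F /bU; rewrite /= bigcup_setXT.
  split.
    have [C cC ->] := open_bigcup_closed oO; rewrite bigcup_setXT.
    by apply: souslin_bigcup => i; exact: souslin_rect.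
  rewrite (_ : ~` _ = (~` O) `*` setT).
    by apply: souslin_rect => //; exact: open_closedC.
  by apply/seteqP; split=> -[z w] /=; tauto.
have bisouslinF (F : set W) : measurable F ->
    bisouslin ((@setT 'rV[R]_d) `*` F).
  move=> mF; split; first by apply: souslin_rect => //; exact: closedT.
  rewrite (_ : ~` _ = setT `*` ~` F).
    by apply: souslin_rect; [exact: closedT|exact: measurableC].
  by apply/seteqP; split=> -[z w] /=; tauto.
move=> _ [C mC [F mF <-]].
rewrite (_ : C `*` F = (C `*` setT) `&` (setT `*` F)).
  have [[b1 b2] [b3 b4]] := (bisouslinC C mC, bisouslinF F mF).
  have [_ _ bU] := bisouslin_sigma.
  split; last first.
    rewrite setCI -bigcup2E; apply: souslin_bigcup => -[|[|i]] //=.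
    by rewrite -(set0X (@setT W)); apply: souslin_rect => //; exact: closed0.
  rewrite -bigcap2E; apply: souslin_bigcap => -[|[|i]] //=.
  rewrite -(_ : setT `*` setT = setT).
    by apply: souslin_rect => //; exact: closedT.
  by apply/seteqP; split.
by apply/seteqP; split=> -[z w] /=; tauto.
Qed.

End souslin_measurable.

(** * Outer measure and capacitability *)

Section outer.
Context {R : realType} {dW : measure_display} {W : measurableType dW}.
Variable mu : probability W R.
Implicit Types U : set W.

Definition outer U : \bar R :=
  ereal_inf [set mu E | E in [set E | measurable E /\ U `<=` E]].

Lemma outer_le U E : measurable E -> U `<=` E -> (outer U <= mu E)%E.
Proof. by move=> mE UE; apply: ereal_inf_lbound; exists E. Qed.

Lemma outer_fin_num U : outer U \is a fin_num.
Proof.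
rewrite fin_numElt; apply/andP; split.
  apply: (@lt_le_trans _ _ 0%E) => //.
  by apply: le_ereal_inf_tmp => _ [E [mE _] <-].
apply: (@le_lt_trans _ _ 1%E); last exact: ltry.
by rewrite -(probability_setT mu); exact: outer_le.
Qed.

Lemma measurable_hull U :
  exists2 H, measurable H /\ U `<=` H & mu H = outer U.
Proof.
have /(_ _)/cid En n : exists E, [/\ measurable E, U `<=` E &
    (mu E < outer U + (n.+1%:R^-1)%:E)%E].
  have n0 : 0 < n.+1%:R^-1 :> R by rewrite invr_gt0.
  have [_ [E [mE UE] <-] Elt] := lb_ereal_inf_adherent n0 (outer_fin_num U).
  by exists E.
have mH : measurable (\bigcap_n projT1 (En n)).
  by apply: bigcapT_measurable => n; have [] := projT2 (En n).
have UH : U `<=` \bigcap_n projT1 (En n).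
  by move=> w Uw n _; have [_ + _] := projT2 (En n); exact.
exists (\bigcap_n projT1 (En n)) => //; apply/eqP; rewrite eq_le outer_le// andbT.
apply/lee_addgt0Pr => e e0.
have [n _ /(_ n (leqnn n)) ne] := near_infty_natSinv_lt (PosNum e0).
have [mE _ Elt] := projT2 (En n).
apply: (@le_trans _ _ (mu (projT1 (En n)))).
  by apply: le_measure; rewrite ?inE// => w; apply.
by apply/ltW/(lt_trans Elt); rewrite lteD2lE ?lte_fin ?outer_fin_num.
Qed.

(** Continuity from below holds for the outer measure of arbitrary sets: intersecting each hull with
    all the later ones makes the hulls nondecreasing, and they still contain the sets since these
    increase. *)
Lemma outer_bigcup_le (B : (set W)^nat) (a : \bar R) : nondecreasing_seq B ->
  (forall n, outer (B n) <= a)%E -> (outer (\bigcup_n B n) <= a)%E.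
Proof.
move=> ndB Ba; have /(_ _)/cid2 Hn n := measurable_hull (B n).
pose H n := s2val (Hn n).
have mH n : measurable (H n) by have [] := s2valP (Hn n).
pose G n := \bigcap_(m in [set m | (n <= m)%N]) H m.
have mG n : measurable (G n).
  by rewrite /G bigcap_mkcond; apply: bigcapT_measurable => m; case: ifP.
have ndG : nondecreasing_seq G.
  move=> n m nm; apply/subsetPset => w Gw k /= mk.
  by apply: Gw => /=; exact: leq_trans mk.
have BG n : B n `<=` G n.
  move=> w Bw m /= nm; have [_ + ] := s2valP (Hn m).
  by apply; move/subsetPset: (ndB _ _ nm); exact.
have mUG : measurable (\bigcup_n G n) by exact: bigcupT_measurable.
apply: (@le_trans _ _ (mu (\bigcup_n G n))).
  apply: outer_le => // w [n _ /BG Gw]; by exists n.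
have cG := nondecreasing_cvg_mu (mu := mu) mG mUG ndG.
rewrite -(cvg_lim _ cG)//; apply: lime_le; first exact: (cvgP _ cG).
apply: nearW => n /=; apply: le_trans (Ba n).
rewrite -(s2valP' (Hn n)).
apply: le_measure; rewrite ?inE//; first exact: mH.
by move=> w /(_ n) /=; exact.
Qed.

End outer.

Lemma compact_bigcap_closed (Z : topologicalType) (K : set Z) (C : (set Z)^nat) :
  compact K -> (forall n, closed (C n)) ->
  (forall n, exists2 z, K z & forall j, (j <= n)%N -> C j z) ->
  exists z, forall j, C j z.
Proof.
move=> cK cC /(_ _)/cid2 zn; pose z n := s2val (zn n).
have [|x [Kx clx]] := cK (z @ \oo) _.
  by exists 0%N => // n _ /=; rewrite /z; exact: s2valP.
exists x => j; apply: (cC j) => B Bx.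
have [|y [Cy By]] := clx (C j) B _ Bx; last by exists y.
by exists j => // n /= jn; exact: s2valP' (zn n) _ jn.
Qed.

(** König's lemma for the finitely branching tree of the sequences bounded by [b]: a prefix shared
    by arbitrarily late [s k] has one of finitely many extensions with the same property ([ext]). *)
Lemma konig (b : nat -> nat) (s : nat -> seq nat) :
  (forall k, size (s k) = k) ->
  (forall k i, (i < k)%N -> (nth 0 (s k) i <= b i)%N) ->
  exists u : nat -> nat, forall j n, exists k, [/\ (n <= k)%N, (j <= k)%N &
    take j (s k) = mkseq u j].
Proof.
move=> sk sb.
pose ext t := forall n, exists k, [/\ (n <= k)%N, (size t <= k)%N &
  take (size t) (s k) = t].
have extS t : exists i, ext t -> ext (rcons t i).
  apply/not_existsP => H.
  have extt : ext t by apply: contrapT => nt; apply: (H 0%N).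
  have /(_ _)/cid M i : exists n, forall k, (n <= k)%N -> (size t < k)%N ->
      take (size t).+1 (s k) <> rcons t i.
    apply: contrapT => /forallNP Hn; apply: (H i) => _ n.
    have /existsNP[k /not_implyP[nk /not_implyP[tk /contrapT skE]]] := Hn n.
    by exists k; rewrite size_rcons.
  pose m := (\sum_(i < (b (size t)).+1) projT1 (M i) + (size t).+1)%N.
  have [k [mk tk skt]] := extt m.
  have tk' : (size t < k)%N by apply: leq_trans mk; exact: leq_addl.
  have ib : (nth 0 (s k) (size t) < (b (size t)).+1)%N by rewrite ltnS sb.
  apply: (projT2 (M (nth 0%N (s k) (size t))) k) => //.
    apply: leq_trans mk; rewrite /m (bigD1 (Ordinal ib))//=.
    by rewrite -addnA leq_addr.
  by rewrite (take_nth 0%N) ?sk// skt.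
have [nxt nxtP] := choice extS.
pose f k := iter k (fun t => rcons t (nxt t)) [::].
have fE k : f k = mkseq (fun i => nxt (f i)) k.
  elim: k => // k IH; rewrite [LHS]/= -/(f k) {1}IH -[in RHS]addn1 /mkseq.
  by rewrite iotaD map_cat cats1.
have fext k : ext (f k).
  by elim: k => [n|k IH]; [exists n; rewrite take0|exact: nxtP].
exists (fun i => nxt (f i)) => j n; have [k [nk jk kE]] := fext j n.
have sfj : size (f j) = j by rewrite fE size_mkseq.
by exists k; rewrite -fE; move: jk kE; rewrite sfj.
Qed.

Section capacity.
Context {R : realType} {dW : measure_display} {W : measurableType dW}.
Context {Z : topologicalType}.
Variable mu : probability W R.

(* Choquet's capacitability argument: along the approximation of the projection
   by sets with bounded witnesses the outer measure stays above [a], and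
   compactness turns the approximations into measurable sets. *)
Lemma souslin_proj_inner (A : set (Z * W)) (K : set Z) (a : \bar R) :
  souslin A -> compact K -> A `<=` K `*` setT ->
  (a < outer mu [set w | exists z, A (z, w)])%E ->
  exists E, [/\ measurable E, E `<=` [set w | exists z, A (z, w)] &
    (a <= mu E)%E].
Proof.
move=> [C [F [cC mF AE]]] cK AK aA.
set U := [set w | _] in aA *.
(* [B b] bounds the first entries of the witness by those of [b]. Continuity of the outer measure
   allows these bounds to be chosen one after the other while the outer measure stays above [a]. *)
pose B (b : seq nat) := [set w | exists z u,
  (forall i, (i < size b)%N -> (u i <= nth 0 b i)%N) /\
  forall k, C (mkseq u k) z /\ F (mkseq u k) w].
have B0 : B [::] = U.
  apply/seteqP; split=> w /=.
    by move=> [z [u [_ uP]]]; exists z; rewrite AE; exists u.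
  by move=> [z]; rewrite AE => -[u uP]; exists z, u.
have BS b : exists n, (a < outer mu (B b))%E -> (a < outer mu (B (rcons b n)))%E.
  apply/not_existsP => H.
  have aB : (a < outer mu (B b))%E by apply: contrapT => nt; apply: (H 0%N).
  have /existsNP[] : ~ forall n, (outer mu (B (rcons b n)) <= a)%E; last first.
    by move=> n /negP; rewrite -ltNge => an; exact: (H n).
  move=> /(outer_bigcup_le _) H'; move: aB; apply/negP; rewrite -leNgt.
  have -> : B b = \bigcup_n B (rcons b n).
    apply/seteqP; split=> w /=.
      move=> [z [u [ub uP]]]; exists (u (size b)) => //; exists z, u; split=> //.
      move=> i; rewrite size_rcons ltnS nth_rcons => ib.
      by case: ltnP => [/ub//|bi]; rewrite (@anti_leq i (size b)) ?ib// eqxx.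
    move=> [n _ [z [u [ub uP]]]]; exists z, u; split=> // i ib.
    have := ub i; rewrite size_rcons nth_rcons ib; apply; exact: ltnW.
  apply: H' => n m nm; apply/subsetPset => w [z [u [ub uP]]].
  exists z, u; split=> // i; move: (ub i); rewrite !size_rcons !nth_rcons.
  move=> /[apply]; case: ifP => // _; case: ifP => // _ /leq_trans; exact.
have [nxt nxtP] := choice BS.
pose f k := iter k (fun t => rcons t (nxt t)) [::].
pose b i := nxt (f i).
have fE k : f k = mkseq b k.
  elim: k => // k IH; rewrite [LHS]/= -/(f k) {1}IH -[in RHS]addn1 /mkseq.
  by rewrite iotaD map_cat cats1.
have fa k : (a < outer mu (B (f k)))%E.
  by elim: k => [|k IH]; [rewrite B0|exact: nxtP].
pose ok k := [set s : seq nat | [/\ size s = k,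
  forall i, (i < k)%N -> (nth 0 s i <= b i)%N &
  exists2 z, K z & forall j, (j <= k)%N -> C (take j s) z]].
(* Only the first k entries of a witness are tested here, so countably many sequences matter and
   [E k] is measurable. A point of all the [E k] has a full witness: [konig] supplies u and
   compactness of [K] supplies z. *)
pose E k := \bigcup_(s in ok k) \bigcap_(j in [set j | (j <= k)%N]) F (take j s).
have mE k : measurable (E k).
  rewrite /E bigcup_mkcond; apply: countable_bigcupT_measurable => [|s].
    exact: countableP.
  case: ifP => // _; rewrite bigcap_mkcond; apply: bigcapT_measurable => j.
  by case: ifP.
have BE k : B (f k) `<=` E k.
  move=> w [z [u [ub uP]]].
  have tk j : (j <= k)%N -> take j (mkseq u k) = mkseq u j.
    by move=> jk; rewrite -map_take take_iota (minn_idPl jk).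
  exists (mkseq u k) => [|j /= jk]; last by rewrite tk//; exact: (uP j).2.
  split; first by rewrite size_mkseq.
    move=> i ik; rewrite nth_mkseq//; apply: leq_trans (ub i _) _.
      by rewrite fE size_mkseq.
    by rewrite fE nth_mkseq.
  exists z => [|j jk]; last by rewrite tk//; exact: (uP j).1.
  by have [] : (K `*` setT) (z, w) by apply: AK; rewrite AE; exists u.
have niE : nonincreasing_seq E.
  apply/nonincreasing_seqP => k; apply/subsetPset => w [s [sk sb [z Kz sC]] sF].
  exists (take k s) => [|j /= jk]; last first.
    by rewrite take_takel//; apply: sF; exact: ltnW.
  split; first by rewrite size_takel// sk.
    by move=> i ik; rewrite nth_take//; exact/sb/ltnW.
  by exists z => // j jk; rewrite take_takel//; exact/sC/ltnW.
have mcE : measurable (\bigcap_k E k) by exact: bigcapT_measurable.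
exists (\bigcap_k E k); split=> //.
  move=> w Ew; have /(_ _)/cid2 sP k := Ew k I.
  pose s k := s2val (sP k).
  have sk k : size (s k) = k by have [] := s2valP (sP k).
  have sb k i : (i < k)%N -> (nth 0 (s k) i <= b i)%N.
    by have [_ + _] := s2valP (sP k); apply.
  have [u uP] := konig sk sb.
  have [|k|z zC] := @compact_bigcap_closed _ K (fun j => C (mkseq u j)) cK.
  - by move=> n; exact: cC.
  - have [m [_ km mE']] := uP k 0%N; have [_ _ [z Kz zC]] := s2valP (sP m).
    exists z => // j jk.
    have <- : take j (s m) = mkseq u j.
      rewrite -(@take_takel _ j k)// mE' -map_take take_iota.
      by rewrite (minn_idPl jk).
    exact/zC/(leq_trans jk).
  exists z; rewrite AE; exists u => j; split; first exact: zC.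
  have [m [_ jm <-]] := uP j 0%N.
  exact: (s2valP' (sP m)).
have cE : mu \o E @ \oo --> mu (\bigcap_k E k).
  apply: nonincreasing_cvg_mu => //.
  by rewrite (le_lt_trans (probability_le1 _ _)) ?ltry.
rewrite -(cvg_lim _ cE)//; apply: lime_ge; first exact: (cvgP _ cE).
apply: nearW => k /=; apply: (le_trans (ltW (fa k))).
exact: outer_le.
Qed.

End capacity.

(** Cutting the witnesses z to large compact cubes costs less than [e] in outer measure; the inner
    set comes from such a cut, the outer one is a measurable hull. *)
Lemma measurable_proj_approx {R : realType} d dW (W : measurableType dW)
    (mu : probability W R) (A : set ('rV[R]_d * W)) (e : R) :
  measurable A -> 0 < e ->
  exists E H, [/\ measurable E, measurable H,
    E `<=` [set w | exists z, A (z, w)], [set w | exists z, A (z, w)] `<=` H &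
    (mu H <= mu E + e%:E)%E].
Proof.
move=> mA e0; set U := [set w | _].
have [H [mH UH] HE] := measurable_hull mu U.
pose K (n : nat) : set 'rV[R]_d := [set z | forall i, z ord0 i \in `[- n%:R, n%:R]].
have cK n : compact (K n).
  have := @rV_compact R d (fun=> [set` `[- n%:R, n%:R]]).
  by apply=> _; exact: segment_compact.
have ndK : nondecreasing_seq K.
  move=> n m nm; apply/subsetPset => z zK i; move: (zK i) => /=.
  rewrite !in_itv/= => /andP[z1 z2]; rewrite (le_trans _ z1) ?(le_trans z2)//.
    by rewrite ler_nat.
  by rewrite lerN2 ler_nat.
have UK : U = \bigcup_n [set w | exists z, (A `&` (K n `*` setT)) (z, w)].
  apply/seteqP; split=> [w [z Azw]|w [n _ [z [Azw _]]]]; last by exists z.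
  exists (\sum_i truncn `|z ord0 i|).+1 => //; exists z; split=> //.
  split=> //= i; rewrite in_itv/= -ler_norml ltW//.
  apply: lt_le_trans (truncnS_gt _) _; rewrite ler_nat ltnS (bigD1 i)//=.
  exact: leq_addr.
have cKW n : souslin (K n `*` (@setT W)).
  by apply: souslin_rect => //; apply: compact_closed.
have [n nP] : exists n, (outer mu U - e%:E <
    outer mu [set w | exists z, (A `&` (K n `*` setT)) (z, w)])%E.
  apply/not_existsP => Hn.
  have : (outer mu U <= outer mu U - e%:E)%E.
    rewrite {1}UK; apply: outer_bigcup_le => [n m nm|n]; last first.
      by rewrite leNgt; apply/negP => /Hn.
    apply/subsetPset => w [z [Azw [Kz _]]]; exists z; split=> //; split=> //.
    by move/subsetPset: (ndK _ _ nm); exact.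
  by rewrite leNgt lteBlDr// lteDl ?outer_fin_num// lte_fin e0.
have sAK : souslin (A `&` (K n `*` setT)).
  rewrite -bigcap2E; apply: souslin_bigcap => -[|[|i]] //=.
    exact: measurable_souslin.
  rewrite -(_ : setT `*` setT = setT).
    by apply: souslin_rect => //; exact: closedT.
  by apply/seteqP; split.
have [|E [mE EU Ee]] := souslin_proj_inner sAK (cK n) _ nP.
  by move=> [z w] [].
exists E, H; split=> //; first by move=> w /EU[z [Azw _]]; exists z.
by rewrite HE -leeBlDr.
Qed.

(** * Random swaps and chaining *)

Section swaps.
Context {R : realType} {n : nat}.
Implicit Types (A B : set {ffun 'I_n -> bool}) (v w : 'I_n -> bool -> R).

(** Random swaps are handled by counting: for independent fair swaps the probability of [A] is
    [weight A / 2 ^+ n]. *)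
Definition weight A : R := \sum_(e : {ffun 'I_n -> bool}) \1_A e.

Lemma weight_le A B : A `<=` B -> weight A <= weight B.
Proof.
move=> AB; apply: ler_sum => e _; rewrite !indicE.
by have [/set_mem/AB/mem_set ->|] := boolP (e \in A).
Qed.

Lemma weight_bigcup (I : finType) A (B : I -> set {ffun 'I_n -> bool}) :
  (forall e, A e -> exists i, B i e) -> weight A <= \sum_i weight (B i).
Proof.
move=> AB; rewrite exchange_big/=; apply: ler_sum => e _.
have Bi0 i : 0 <= \1_(B i) e :> R by rewrite indicE.
rewrite indicE; have [/set_mem/AB[i Bi]|_] := boolP (e \in A); last first.
  exact: sumr_ge0.
by rewrite (bigD1 i)//= indicE mem_set//= ler_wpDr// sumr_ge0.
Qed.

Lemma weightU A B C : A `<=` B `|` C -> weight A <= weight B + weight C.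
Proof.
move=> ABC; rewrite (_ : weight B + _ = \sum_(b : bool) weight (if b then B else C)).
  by apply: weight_bigcup => e /ABC[Be|Ce]; [exists true|exists false].
by rewrite big_bool.
Qed.

Lemma weight_chernoff A (X : {ffun 'I_n -> bool} -> R) (a : R) :
  (forall e, A e -> a <= X e) ->
  weight A <= expR (- a) * \sum_e expR (X e).
Proof.
move=> AX; rewrite mulr_sumr; apply: ler_sum => e _.
rewrite indicE; have [/set_mem/AX aX|_] := boolP (e \in A).
  by rewrite -expRD -[leLHS]expR0 ler_expR addrC subr_ge0.
by rewrite mulr_ge0 ?expR_ge0.
Qed.

Lemma sum_expR_ffun v :
  \sum_(e : {ffun 'I_n -> bool}) expR (\sum_i v i (e i)) =
  \prod_i (expR (v i true) + expR (v i false)).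
Proof.
transitivity (\prod_i \sum_(b : bool) expR (v i b)); last first.
  by apply: eq_bigr => i _; rewrite big_bool.
rewrite bigA_distr_bigA/=; apply: eq_bigr => e _.
by rewrite expR_sum.
Qed.

(** A Rademacher sum: [e i] decides the sign of [v i true - v i false]. *)
Definition swap_diff (e : {ffun 'I_n -> bool}) v : R :=
  \sum_i (v i (e i) - v i (~~ e i)).

(** This is 2n times the squared L2 norm under the empirical measure of the 2n points. *)
Definition sqn v : R := \sum_i (v i true ^+ 2 + v i false ^+ 2).

Lemma sqnD v w : sqn (fun i b => v i b + w i b) <= 2 * sqn v + 2 * sqn w.
Proof.
rewrite /sqn !mulr_sumr -big_split/=; apply: ler_sum => i _.
have := sqr_ge0 (v i true - w i true); have := sqr_ge0 (v i false - w i false).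
by nra.
Qed.

Lemma sqnN v : sqn (fun i b => - v i b) = sqn v.
Proof. by apply: eq_bigr => i _; rewrite !sqrrN. Qed.

Lemma sqnB v w : sqn (fun i b => v i b - w i b) <= 2 * sqn v + 2 * sqn w.
Proof. by rewrite -(sqnN w); exact: (sqnD v (fun i b => - w i b)). Qed.

(** The sharp exponent is x^2/2; the weaker one suffices and follows from monotonicity and
    [1 + x <= expR x] alone. *)
Lemma cosh_le (x : R) : expR x + expR (- x) <= 2 * expR (2 * x ^+ 2).
Proof.
wlog x0 : x / 0 <= x => [H|].
  have [/H//|x0] := leP 0 x.
  by have := H (- x); rewrite sqrrN opprK addrC; apply; rewrite oppr_ge0 ltW.
have [xs|xs] := leP (2^-1) (x ^+ 2).
  have x2 : x <= 2 * x ^+ 2 by nra.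
  rewrite mulr2n mulrDl !mul1r lerD ?ler_expR//; nra.
have x1 : x < 1 by nra.
have e1 : expR x <= (1 - x)^-1.
  rewrite -[expR x]invrK -expRN lef_pV2 ?posrE ?expR_gt0//; last by lra.
  by have := expR_ge1Dx (- x).
have e2 : expR (- x) <= (1 + x)^-1.
  by rewrite expRN lef_pV2 ?posrE ?expR_gt0 ?expR_ge1Dx//; lra.
apply: (@le_trans _ _ (2 * (1 + 2 * x ^+ 2))); last first.
  by rewrite ler_pM2l// expR_ge1Dx.
apply: (le_trans (lerD e1 e2)).
rewrite (_ : _ + _ = 2 / (1 - x ^+ 2)); last first.
  by field; rewrite !lt0r_neq0; nra.
by rewrite ler_pdivrMr; nra.
Qed.

Lemma swap_diff_tail v (q u : R) : sqn v <= q -> 0 < q -> 0 <= u ->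
  weight [set e | u < `|swap_diff e v|] <=
  2 ^+ n * (2 * expR (- (u ^+ 2 / (16 * q)))).
Proof.
move=> vq q0 u0.
suff tail w : sqn w <= q -> weight [set e | u < swap_diff e w] <=
    2 ^+ n * expR (- (u ^+ 2 / (16 * q))).
  have wq : sqn (fun i b => - v i b) <= q by rewrite sqnN.
  rewrite mulrCA mulr2n mulrDl mul1r.
  apply: le_trans (lerD (tail _ vq) (tail _ wq)); apply: weightU => e /=.
  rewrite ltr_normr => /orP[|]; [by left|right].
  rewrite /= (_ : swap_diff _ _ = - swap_diff e v)// /swap_diff -sumrN.
  by apply: eq_bigr => i _; rewrite opprB opprK addrC.
(* [lam] minimizes 4 lam^2 q - lam u, where 4 comes from [cosh_le] and (a - b)^2 <= 2 (a^2 +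
   b^2). *)
move=> wq; pose lam := u / (8 * q).
have lam0 : 0 <= lam by rewrite divr_ge0//; lra.
apply: le_trans (@weight_chernoff _ (fun e => lam * swap_diff e w) (lam * u) _) _.
  by move=> e /ltW; exact: ler_wpM2l.
under eq_bigr do rewrite mulr_sumr.
have -> : \sum_(e : {ffun 'I_n -> bool})
      expR (\sum_i lam * (w i (e i) - w i (~~ e i))) =
    \prod_i (expR (lam * (w i true - w i false))
             + expR (- (lam * (w i true - w i false)))).
  rewrite (sum_expR_ffun (fun i b => lam * (w i b - w i (~~ b)))).
  by apply: eq_bigr => i _ /=; rewrite -mulrN opprB.
apply: (@le_trans _ _ (expR (- (lam * u)) * (2 ^+ n * expR (4 * lam ^+ 2 * q)))).
  rewrite ler_pM2l ?expR_gt0//.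
  apply: (@le_trans _ _ (\prod_(i < n) (2 * expR (4 * lam ^+ 2 *
      (w i true ^+ 2 + w i false ^+ 2))))).
    apply: ler_prod => i _; rewrite addr_ge0 ?expR_ge0//=.
    apply: (le_trans (cosh_le _)); rewrite ler_pM2l// ler_expR.
    rewrite exprMn; have := sqr_ge0 (w i true + w i false).
    by have := sqr_ge0 lam; nra.
  rewrite big_split/= prodr_const card_ord ler_pM2l ?exprn_gt0//.
  rewrite -expR_sum -mulr_sumr ler_expR; apply: ler_wpM2l wq.
  by rewrite mulr_ge0// sqr_ge0.
rewrite mulrCA ler_pM2l ?exprn_gt0// -expRD ler_expR /lam.
rewrite le_eqVlt; apply/orP; left; apply/eqP; field; exact: lt0r_neq0.
Qed.

(** The average of the half sums over all swaps is at least q/2, so q/8 is far in the lower tail.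
    For bounded nonnegative terms an exponential moment at -1/b suffices, with
    [expR (- x) <= 1 - x / 2] on [0, 1]. *)
Lemma half_sum_tail v (b q : R) : 0 < b -> (forall i c, 0 <= v i c <= b) ->
  q <= \sum_i (v i true + v i false) ->
  weight [set e : {ffun 'I_n -> bool} | \sum_i v i (~~ e i) <= q / 8] <=
  2 ^+ n * expR (- (q / (8 * b))).
Proof.
move=> b0 vb qv.
apply: le_trans (@weight_chernoff _
  (fun e => \sum_i - (b^-1 * v i (~~ e i))) (- (b^-1 * (q / 8))) _) _.
  move=> e /= ve; rewrite sumrN lerN2 -mulr_sumr.
  by rewrite ler_pM2l// invr_gt0.
rewrite (sum_expR_ffun (fun i c => - (b^-1 * v i (~~ c)))) opprK.
apply: (@le_trans _ _ (expR (b^-1 * (q / 8)) * (2 ^+ n * expR (- (q / (4 * b)))))).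
  rewrite ler_pM2l ?expR_gt0//.
  apply: (@le_trans _ _ (\prod_(i < n) (2 * expR (- ((4 * b)^-1 *
      (v i true + v i false)))))).
    apply: ler_prod => i _; rewrite addr_ge0 ?expR_ge0//=.
    have half x : 0 <= x <= 1 -> expR (- x) <= 1 - x / 2 :> R.
      move=> /andP[x0 x1]; rewrite expRN.
      apply: (@le_trans _ _ (1 + x)^-1).
        by rewrite lef_pV2 ?posrE ?expR_gt0 ?expR_ge1Dx//; lra.
      by rewrite -div1r ler_pdivrMr; nra.
    have vi c : 0 <= b^-1 * v i c <= 1.
      have /andP[v0 v1] := vb i c.
      by rewrite mulr_ge0 ?invr_ge0 ?(ltW b0)//= mulrC ler_pdivrMr// mul1r.
    apply: (le_trans (lerD (half _ (vi _)) (half _ (vi _)))).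
    apply: le_trans (_ : 2 * (1 + - ((4 * b)^-1 * (v i true + v i false))) <= _).
      rewrite invfM/=; lra.
    by rewrite ler_pM2l// expR_ge1Dx.
  rewrite big_split/= prodr_const card_ord ler_pM2l ?exprn_gt0//.
  rewrite -expR_sum sumrN -mulr_sumr ler_expR lerN2 mulrC.
  by rewrite ler_wpM2l// invr_ge0; lra.
rewrite mulrCA ler_pM2l ?exprn_gt0// -expRD ler_expR.
rewrite le_eqVlt; apply/orP; left; apply/eqP; field; exact: lt0r_neq0.
Qed.

End swaps.

(** * Chaining at fixed 2n points *)

Section chaining.
Context {R : realType} {n : nat}.
Implicit Types v w : 'I_n -> bool -> R.

Lemma swap_diffD e v w :
  swap_diff e (fun i b => v i b + w i b) = swap_diff e v + swap_diff e w.
Proof. by rewrite /swap_diff -big_split; apply: eq_bigr => i _ /=; ring. Qed.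

(** Cauchy-Schwarz, obtained term by term from the arithmetic-geometric inequality at scale [h]. It
    bounds the remainder after the last link for all swaps at once. *)
Lemma swap_diff_le e v (h : R) : 0 < h -> sqn v <= 2 * n%:R * h ^+ 2 ->
  `|swap_diff e v| <= 2 * n%:R * h.
Proof.
move=> h0 vh.
apply: (@le_trans _ _ (h / 2 * (2 * n%:R) + (2 * h)^-1 * sqn v)); last first.
  apply: (@le_trans _ _ (h / 2 * (2 * n%:R) + (2 * h)^-1 * (2 * n%:R * h ^+ 2))).
    by rewrite lerD2l ler_pM2l// invr_gt0 mulr_gt0.
  by rewrite le_eqVlt; apply/orP; left; apply/eqP; field; exact: lt0r_neq0.
rewrite /sqn mulr_sumr (_ : h / 2 * _ = \sum_(i < n) h); last first.
  by rewrite sumr_const card_ord -mulr_natr; field.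
rewrite -big_split/=; apply: le_trans (ler_norm_sum _ _ _) _.
apply: ler_sum => i _; apply: le_trans (ler_normB _ _) _.
have amgm x : `|x| <= h / 2 + (2 * h)^-1 * x ^+ 2.
  rewrite -(real_normK (num_real x)) -subr_ge0.
  rewrite (_ : _ - _ = (2 * h)^-1 * (h - `|x|) ^+ 2).
    by rewrite mulr_ge0 ?sqr_ge0// invr_ge0; lra.
  by field; exact: lt0r_neq0.
rewrite mulrDr.
have := amgm (v i true); have := amgm (v i false).
by case: (e i) => /=; lra.
Qed.

Lemma sum_dyadic_weights K :
  \sum_(k < K) (k.+1%:R / 2 ^+ k) = 4 - (2 * K%:R + 4) / 2 ^+ K :> R.
Proof.
elim: K => [|K IH]; first by rewrite big_ord0; field.
rewrite big_ord_recr/= IH exprS; field.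
by rewrite expf_neq0.
Qed.

Lemma sum_half_le K : \sum_(k < K) 2^-1 ^+ k <= 2 :> R.
Proof.
suff -> : \sum_(k < K) 2^-1 ^+ k = 2 - 2 * 2^-1 ^+ K :> R.
  by rewrite gerBl mulr_ge0// exprn_ge0.
elim: K => [|K IH]; first by rewrite big_ord0; ring.
by rewrite big_ord_recr/= IH exprS; field.
Qed.

(** [L] stands for entropy and confidence together: the radius halves at each level, so the
    logarithm of the cover size grows linearly in the level, and [Ldelta] converts multiples of [L]
    into powers of [delta / 2]. *)
Variables (I : Type) (v : I -> 'I_n -> bool -> R).
Variables (tau b sigma L H delta : R).
Hypotheses (n0 : (0 < n)%N) (tau0 : 0 < tau) (b0 : 0 < b) (H0 : 0 <= H).
Hypotheses (L0 : 0 < L) (delta0 : 0 < delta) (delta1 : delta < 1).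
Hypothesis Ldelta : expR (- L) <= delta / 2.
Variables (N : nat -> nat) (g : forall k, 'I_(N k) -> 'I_n -> bool -> R).
Hypothesis N_le : forall k, (N k)%:R <= expR (k.+1%:R * (H * L)).
Hypothesis g_le : forall k (j : 'I_(N k)) i c, g j i c ^+ 2 <= b ^+ 2.
Hypothesis g_cover : forall k z, exists j : 'I_(N k),
  sqn (fun i c => v z i c - g j i c) <= 2 * n%:R * (tau / 2 ^+ k) ^+ 2.
Hypothesis tau_sigma : 150 * sigma ^+ 2 <= tau ^+ 2.
Hypothesis tau_b : 16 * (4 * H + 4) * b ^+ 2 * L / n%:R <= tau ^+ 2.

(** 320 = 16 * 20, with 16 from [swap_diff_tail] and 20 from the norm of a link. In the resulting
    exponent, 2H pays for the pairs of elements of two consecutive covers and 6 leaves a summable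
    power of [delta / 2]. *)
Let D := 320 * (2 * H + 6).
Let s := Num.sqrt (D * L / n%:R).

Let nR0 : 0 < n%:R :> R. Proof. by rewrite ltr0n. Qed.

Let D0 : 0 < D. Proof. by rewrite /D; have := H0; lra. Qed.

Let s0 : 0 < s.
Proof. by rewrite /s sqrtr_gt0 divr_gt0// mulr_gt0. Qed.

Let s2 : n%:R * s ^+ 2 = D * L.
Proof.
rewrite /s sqr_sqrtr ?(ltW (divr_gt0 (mulr_gt0 D0 L0) nR0))//.
by rewrite mulrCA divff ?mulr1 ?lt0r_neq0.
Qed.

Let expRL k : expR (- (k%:R * L)) <= (delta / 2) ^+ k.
Proof. by rewrite -mulrN expRM_natl lerXn2r ?nnegrE ?expR_ge0// divr_ge0// ltW. Qed.

Let half_delta k l : (k < l)%N -> (delta / 2) ^+ l <= delta * 2^-1 ^+ k.+1.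
Proof.
move=> kl; have kl' : (k.+1 <= l)%N by [].
apply: (@le_trans _ _ ((delta / 2) ^+ k.+1)).
  by apply: ler_wiXn2l => //; have := delta0; have := delta1; lra.
rewrite exprMn exprS -mulrA; rewrite ler_pM2l//.
rewrite -[leRHS]mul1r ler_wpM2r// ?exprn_ge0//.
by apply: exprn_ile1; exact: ltW.
Qed.

(* Level [k.+1] of the chain uses the [k]-th cover, level [0] is the zero
   function. *)
Let N' k := if k is k'.+1 then N k' else 1%N.
Let g' k : 'I_(N' k) -> 'I_n -> bool -> R :=
  if k is k'.+1 then @g k' else fun _ _ _ => 0.
Let eta k := tau / 2 ^+ k.
Let eta' k := if k is k'.+1 then eta k' else tau.

Let eta0 k : 0 < eta k. Proof. by rewrite divr_gt0 ?exprn_gt0. Qed.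

Let eta'_le k : 0 < eta' k <= 2 * eta k.
Proof.
case: k => [|k] /=; first by rewrite tau0/= /eta expr0 divr1; have := tau0; lra.
rewrite eta0/= le_eqVlt /eta exprS; apply/orP; left; apply/eqP; field.
by rewrite expf_neq0.
Qed.

Let N'_le k : (N' k)%:R <= expR (k%:R * (H * L)).
Proof. by case: k => [|k]; [rewrite mul0r expR0|exact: N_le]. Qed.

Let link k (jj : 'I_(N' k.+1) * 'I_(N' k)) i c : R := g' jj.1 i c - g' jj.2 i c.

(** Only pairs close to a common function matter, and the first condition keeps just these in the
    union bound: 20 = 2 * 2 * 2^2 + 2 * 2 when the two elements are within 2 [eta k] and [eta k] of
    that function. The threshold has weight k+1 because the entropy at level k grows like k+1. *)
Let bad_link k (jj : 'I_(N' k.+1) * 'I_(N' k)) : set {ffun 'I_n -> bool} :=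
  [set e | sqn (link jj) <= 20 * n%:R * eta k ^+ 2 /\
    n%:R * (k.+1%:R * eta k * s) < `|swap_diff e (link jj)|].

Let bad_chain k : set {ffun 'I_n -> bool} := [set e | exists jj, @bad_link k jj e].

Let weight_bad_link k jj : weight (@bad_link k jj) <=
  2 ^+ n * (2 * expR (- (k.+1%:R ^+ 2 * (2 * H + 6) * L))).
Proof.
have q0 : 0 < 20 * n%:R * eta k ^+ 2 by rewrite !mulr_gt0 ?exprn_gt0.
have u0 : 0 <= n%:R * (k.+1%:R * eta k * s) by rewrite !mulr_ge0 ?ltW.
have [sq|sq] := boolP (sqn (link jj) <= 20 * n%:R * eta k ^+ 2); last first.
  rewrite /weight big1 ?mulr_ge0 ?exprn_ge0 ?expR_ge0// => e _.
  by rewrite indicE memNset// => -[]; rewrite (negbTE sq).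
apply: le_trans (_ : weight [set e | n%:R * (k.+1%:R * eta k * s) <
    `|swap_diff e (link jj)|] <= _).
  by apply: weight_le => e [].
apply: le_trans (swap_diff_tail sq q0 u0) _.
rewrite ler_pM2l ?exprn_gt0// ler_pM2l// ler_expR lerN2.
rewrite le_eqVlt; apply/orP; left; apply/eqP.
rewrite (_ : (n%:R * _) ^+ 2 = n%:R * (n%:R * s ^+ 2) * k.+1%:R ^+ 2 * eta k ^+ 2).
  by rewrite s2 /D; field; rewrite !lt0r_neq0.
by ring.
Qed.

Let weight_bad_chain k : weight (bad_chain k) <=
  2 ^+ n * (delta / 32 * 2^-1 ^+ k).
Proof.
apply: (@le_trans _ _ (\sum_jj weight (@bad_link k jj))).
  exact: weight_bigcup.
apply: le_trans (ler_sum _ (fun jj _ => weight_bad_link jj)) _.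
rewrite sumr_const card_prod !card_ord -[leLHS]mulr_natl mulrCA ler_pM2l ?exprn_gt0//.
rewrite natrM; set x := k.+1%:R : R.
have x1 : 1 <= x by rewrite /x ler1n.
have NN : (N k)%:R * (N' k)%:R <= expR (x * (2 * H * L)).
  apply: (@le_trans _ _ (expR (x * (H * L)) * expR (k%:R * (H * L)))).
    by rewrite ler_pM.
  rewrite -expRD ler_expR.
  rewrite (_ : x * (2 * H * L) = x * (H * L) + x * (H * L)); last by ring.
  by rewrite lerD2l ler_wpM2r ?mulr_ge0 ?ler_nat// ltW.
apply: (@le_trans _ _ (expR (x * (2 * H * L)) *
    (2 * expR (- (x ^+ 2 * (2 * H + 6) * L))))).
  by rewrite ler_wpM2r// mulr_ge0 ?expR_ge0.
rewrite mulrCA -expRD.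
apply: (@le_trans _ _ (2 * expR (- ((6 * k.+1)%:R * L)))).
  rewrite ler_pM2l// ler_expR natrM -/x.
  have HL : 0 <= H * L by rewrite mulr_ge0// ltW.
  have xx : 0 <= x ^+ 2 - x by nra.
  have := mulr_ge0 xx HL; have := mulr_ge0 xx (ltW L0); lra.
apply: (@le_trans _ _ (2 * (delta / 2) ^+ (6 * k.+1))).
  by rewrite ler_pM2l.
(* Six powers per level leave a geometric series over k, of sum at most delta/16. *)
have kk : (k + 5 < 6 * k.+1)%N by rewrite mulnS addnC -addSn leq_add2l leq_pmull.
have := half_delta kk; rewrite -addSn addSnnS exprD => h.
rewrite -ler_pdivlMl//; apply: (le_trans h).
rewrite le_eqVlt; apply/orP; left; by apply/eqP; field.
Qed.

(** Elements of one cover with large norm whose mass is split very unevenly between the two halves.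
    [tau_b] is calibrated for the union bound: of the exponent (4H + 4) L, the part 4HL pays for the
    cover at level 3 and 4L leaves (delta/2)^4. *)
Let big_block : set {ffun 'I_n -> bool} := [set e | exists j : 'I_(N 3),
  n%:R * tau ^+ 2 / 2 <= sqn (g j) /\
  \sum_i g j i (~~ e i) ^+ 2 <= sqn (g j) / 8].

Let weight_big_block : weight big_block <= 2 ^+ n * (delta / 16).
Proof.
pose B (j : 'I_(N 3)) : set {ffun 'I_n -> bool} :=
  [set e | n%:R * tau ^+ 2 / 2 <= sqn (g j) /\
  \sum_i g j i (~~ e i) ^+ 2 <= sqn (g j) / 8].
apply: le_trans (@weight_bigcup _ _ _ _ B (fun e h => h)) _.
have L16 : 4 * H * L + 4 * L <= n%:R * tau ^+ 2 / (16 * b ^+ 2).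
  move: tau_b; rewrite ler_pdivrMr// ler_pdivlMr; last first.
    by rewrite mulr_gt0 ?exprn_gt0.
  by lra.
have B_le j : weight (B j) <= 2 ^+ n * expR (- (4 * H * L + 4 * L)).
  have [sq|sq] := boolP (n%:R * tau ^+ 2 / 2 <= sqn (g j)); last first.
    rewrite /weight big1 ?mulr_ge0 ?exprn_ge0 ?expR_ge0// => e _.
    by rewrite indicE memNset// => -[]; rewrite (negbTE sq).
  have b20 : 0 < b ^+ 2 by rewrite exprn_gt0.
  have gb i c : 0 <= g j i c ^+ 2 <= b ^+ 2 by rewrite sqr_ge0 g_le.
  apply: (@le_trans _ _ (2 ^+ n * expR (- (sqn (g j) / (8 * b ^+ 2))))).
    apply: le_trans (half_sum_tail b20 gb (lexx _)).
    by apply: weight_le => e [].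
  rewrite ler_pM2l ?exprn_gt0// ler_expR lerN2; apply: (le_trans L16).
  rewrite (_ : _ / _ = n%:R * tau ^+ 2 / 2 / (8 * b ^+ 2)); last first.
    by field; exact: lt0r_neq0.
  by rewrite ler_wpM2r// invr_ge0 mulr_ge0// ltW.
apply: le_trans (ler_sum _ (fun j _ => B_le j)) _.
rewrite sumr_const card_ord -[leLHS]mulr_natl mulrCA ler_pM2l ?exprn_gt0//.
apply: (@le_trans _ _ (expR (4%:R * (H * L)) * expR (- (4 * H * L + 4 * L)))).
  by rewrite ler_wpM2r ?expR_ge0.
rewrite -expRD (_ : _ + _ = - (4%:R * L)); last by ring.
apply: (le_trans (expRL _)); apply: le_trans (half_delta (isT : (3 < 4)%N)) _.
by rewrite le_eqVlt; apply/orP; left; by apply/eqP; field.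
Qed.

(** The threshold 5 splits into 4 for the links, the limit of [sum_dyadic_weights], and 1 for the
    remainder. The second condition, on the ghost half, serves only to exclude functions of large
    norm on the 2n points. *)
Lemma weight_swap_sup :
  weight [set e | exists z, 5 * n%:R * (tau * s) < `|swap_diff e (v z)| /\
    \sum_i v z i (~~ e i) ^+ 2 <= 4 * n%:R * sigma ^+ 2] <=
  2 ^+ n * (delta / 4).
Proof.
(* The depth depends on [s] alone and not on the function; the weights of the bad levels are
   summable, so it does not affect the bound. *)
have [K sK] : exists K, 4 <= s * 2 ^+ K.
  exists (truncn (4 / s)).+1; rewrite mulrC -ler_pdivrMr//.
  apply: le_trans (ltW (truncnS_gt _)) _; rewrite -natrX ler_nat.
  exact/ltnW/ltn_expl.
apply: (@le_trans _ _ (weight [set e | exists k : 'I_K.+1, bad_chain k e] +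
    weight big_block)).
  apply: weightU => e [z [ze zs]].
  (* Within norm [tau] the zero function is a valid level 0 of the chain. Otherwise the nearby
     element g of the cover at radius tau/8 has [sqn g] at least (31/32) n tau^2, while its ghost
     half is at most 8 n sigma^2 + n tau^2 / 16. With 150 sigma^2 <= tau^2 the latter is below an
     eighth of the former, since 8/150 + 1/16 < 31/256: this is the origin of 150 and of level 3. *)
  have sq_cases : sqn (v z) <= 2 * n%:R * tau ^+ 2 \/
      2 * n%:R * tau ^+ 2 < sqn (v z) by case: leP => _; [left|right].
  case: sq_cases => sq; last first.
    right; have [j jP] := g_cover 3 z; exists j.
    have tau8 : (tau / 2 ^+ 3) ^+ 2 = tau ^+ 2 / 64 by field.
    rewrite tau8 in jP.
    have gsq : n%:R * tau ^+ 2 * (31 / 32) <= sqn (g j).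
      have := sqnD (g j) (fun i c => v z i c - g j i c).
      rewrite (_ : sqn _ = sqn (v z)); last first.
        by apply: eq_bigr => i _; rewrite !(addrC (g _ _ _)) !subrK.
      by lra.
    have nt : 0 <= n%:R * tau ^+ 2 by rewrite mulr_ge0 ?sqr_ge0.
    split; first by lra.
    have gle : \sum_i g j i (~~ e i) ^+ 2 <= 2 * \sum_i v z i (~~ e i) ^+ 2
        + 2 * sqn (fun i c => v z i c - g j i c).
      rewrite /sqn !mulr_sumr -big_split/=; apply: ler_sum => i _.
      by case: (e i) => /=;
        have := sqr_ge0 (2 * v z i true - g j i true);
        have := sqr_ge0 (2 * v z i false - g j i false);
        have := sqr_ge0 (v z i true - g j i true);
        have := sqr_ge0 (v z i false - g j i false); nra.
    have : 150 * (n%:R * sigma ^+ 2) <= n%:R * tau ^+ 2.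
      by rewrite mulrCA ler_pM2l.
    by lra.
  left; have cov k : exists j : 'I_(N' k),
      sqn (fun i c => v z i c - g' j i c) <= 2 * n%:R * eta' k ^+ 2.
    case: k => [|k]; last exact: g_cover.
    exists ord0 => /=; rewrite (_ : sqn _ = sqn (v z))//.
    by apply: eq_bigr => i _; rewrite !subr0.
  have /(_ _)/cid J := cov; pose j k := projT1 (J k).
  have jP k : sqn (fun i c => v z i c - g' (j k) i c) <= 2 * n%:R * eta' k ^+ 2
    := projT2 (J k).
  apply: contrapT => /forallNP nobad.
  have link_le k : (k < K.+1)%N ->
      `|swap_diff e (link (j k.+1, j k))| <= n%:R * (k.+1%:R * eta k * s).
    move=> kK; rewrite leNgt; apply/negP => hl; apply: (nobad (Ordinal kK)).
    exists (j k.+1, j k); split=> //.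
    have -> : sqn (link (j k.+1, j k)) = sqn (fun i c =>
        (v z i c - g' (j k) i c) - (v z i c - g' (j k.+1) i c)).
      by apply: eq_bigr => i _; congr (_ ^+ 2 + _ ^+ 2); rewrite /link/=; ring.
    apply: le_trans (sqnB _ _) _; apply: le_trans (lerD (_ : _ <=
      2 * (2 * n%:R * (2 * eta k) ^+ 2)) (_ : _ <= 2 * (2 * n%:R * eta k ^+ 2))) _.
    - rewrite ler_pM2l//; apply: (le_trans (jP k)); have /andP[e1 e2] := eta'_le k.
      by rewrite ler_pM2l ?mulr_gt0// lerXn2r ?nnegrE// ?ltW// mulr_gt0.
    - by rewrite ler_pM2l//; exact: (jP k.+1).
    - by rewrite le_eqVlt; apply/orP; left; apply/eqP; ring.
  have telescope k : swap_diff e (v z) =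
      swap_diff e (fun i c => v z i c - g' (j k) i c) +
      \sum_(m < k) swap_diff e (link (j m.+1, j m)).
    elim: k => [|k IH].
      rewrite big_ord0 addr0; apply: eq_bigr => i _ /=; by rewrite !subr0.
    rewrite big_ord_recr/= addrCA -swap_diffD addrC IH; congr (_ + _).
    by apply: eq_bigr => i _; rewrite /link/=; ring.
  have : `|swap_diff e (v z)| <= 5 * n%:R * (tau * s).
    rewrite (telescope K.+1); apply: le_trans (ler_normD _ _) _.
    have r1 : `|swap_diff e (fun i c => v z i c - g' (j K.+1) i c)| <=
        n%:R * (tau * s).
      apply: le_trans (swap_diff_le e (eta0 K) (jP K.+1)) _.
      rewrite -mulrA mulrCA ler_pM2l// /eta mulrCA ler_pM2l//.
      rewrite -ler_pdivlMr ?invr_gt0 ?exprn_gt0// invrK.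
      by apply: le_trans sK; rewrite ler_nat.
    have r2 : `|\sum_(m < K.+1) swap_diff e (link (j m.+1, j m))| <=
        4 * (n%:R * (tau * s)).
      apply: le_trans (ler_norm_sum _ _ _) _.
      apply: le_trans (ler_sum _ (fun m _ => link_le _ (ltn_ord m))) _.
      rewrite (_ : \sum_(m < _) _ = n%:R * (tau * s) *
          \sum_(m < K.+1) (m.+1%:R / 2 ^+ m)); last first.
        by rewrite mulr_sumr; apply: eq_bigr => m _; rewrite /eta; ring.
      rewrite mulrC ler_pM2r ?mulr_gt0// sum_dyadic_weights.
      by rewrite gerBl divr_ge0 ?exprn_ge0// addr_ge0 ?mulr_ge0.
    by apply: le_trans (lerD r1 r2) _; lra.
  by rewrite leNgt ze.
have chain_le : weight [set e | exists k : 'I_K.+1, bad_chain k e] <=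
    2 ^+ n * (delta / 16).
  apply: le_trans (@weight_bigcup _ _ _ _ (fun k : 'I_K.+1 => bad_chain k) _) _.
    by [].
  apply: le_trans (ler_sum _ (fun (k : 'I_K.+1) _ => weight_bad_chain k)) _.
  rewrite -!mulr_sumr ler_pM2l ?exprn_gt0//.
  rewrite -ler_pdivlMl ?divr_gt0//; apply: (le_trans (sum_half_le _)).
  rewrite le_eqVlt; apply/orP; left; apply/eqP; field; exact: lt0r_neq0.
apply: le_trans (lerD chain_le weight_big_block) _.
rewrite -mulrDr ler_pM2l ?exprn_gt0//; have := delta0; lra.
Qed.

End chaining.

(** * Covers of the kernel class *)

Section empirical.
Context {R : realType} {dT : measure_display} {T : measurableType dT}.
Variables (J : finType) (y : J -> T) (j0 : J).

Let z (k : nat) : T := nth (y j0) [seq y j | j <- enum J] k.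
Let card0 : 0 < #|J|%:R :> R. Proof. by rewrite ltr0n; apply/card_gt0P; exists j0. Qed.
Let c : {nonneg R} := NngNum (ltW (etrans (invr_gt0 #|J|%:R) card0)).

(** Equal points are counted with multiplicity; the passage through [nth] is due to [msum], which
    takes a family indexed by nat. *)
Definition empirical : set T -> \bar R :=
  mscale c (msum (fun k => \d_(z k)) #|J|).

HB.instance Definition _ := Measure.on empirical.

Let empirical_setT : empirical setT = 1%E.
Proof.
rewrite /empirical/= /mscale/= /msum/=.
under eq_bigr do rewrite diracT.
by rewrite sumEFin sumr_const card_ord -EFinM mulVf ?lt0r_neq0.
Qed.

HB.instance Definition _ :=
  Measure_isProbability.Build _ _ _ empirical empirical_setT.

Lemma ge0_integral_empirical (f : T -> \bar R) : (forall x, 0 <= f x)%E ->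
  measurable_fun setT f ->
  (\int[empirical]_x f x = (#|J|%:R^-1)%:E * \sum_j f (y j))%E.
Proof.
move=> f0 mf; rewrite /empirical ge0_integral_mscale//; congr (_ * _)%E.
rewrite ge0_integral_measure_sum//.
under eq_bigr do rewrite integral_dirac// diracT mul1e.
rewrite -(big_mkord xpredT (fun k => f (z k))) /z.
have -> : #|J| = size [seq y j | j <- enum J] by rewrite size_map -cardE.
by rewrite -(big_nth (y j0) xpredT f) big_map big_enum.
Qed.

End empirical.

Section covers.
Context {R : realType} {d : nat}.
Local Notation T := 'rV[R]_d.

(** The slack 1 turns the infimum into an actual cover. *)
Lemma covering_number_le (F : set (T -> R)) (Q : probability T R) (eta B : R) :
  (covering_number F Q eta <= B%:E)%E ->
  exists k (c : 'I_k -> T -> R), [/\ k%:R <= B + 1, forall i, F (c i) &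
    forall f, F f -> exists i, (L2norm Q (f \- c i)%R < eta%:E)%E].
Proof.
move=> cB; have : (covering_number F Q eta < (B + 1)%:E)%E.
  by apply: (le_lt_trans cB); rewrite lte_fin ltrDl.
move=> /ereal_inf_lt[_ [k [c cF cov] <-]]; rewrite lte_fin => /ltW kB.
by exists k, c.
Qed.

Lemma measurable_rescaled (D : T -> R) x h : measurable_fun setT D ->
  measurable_fun setT (rescaled D x h).
Proof.
move=> mD; apply: (measurableT_comp mD); apply: measurable_fun_rV => i.
under eq_fun do rewrite !mxE; apply: measurable_funM => //.
apply: measurable_funB => //; exact: measurable_coord_rV.
Qed.

Lemma L2norm_empirical_lt (J : finType) (y : J -> T) (j0 : J) (g : T -> R)
    (eta : R) : measurable_fun setT g -> 0 < eta ->
  (L2norm (empirical y j0) g < eta%:E)%E ->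
  \sum_j g (y j) ^+ 2 <= #|J|%:R * eta ^+ 2.
Proof.
move=> mg eta0 gl.
have E : (\int[empirical y j0]_x (g x ^+ 2)%:E)%E =
    (L2norm (empirical y j0) g `^ 2%:R)%E.
  rewrite /L2norm powR_Lnorm//; apply: eq_integral => x _.
  by rewrite abse_EFin poweR_EFin powR_mulrn// real_normK// num_real.
have : (L2norm (empirical y j0) g `^ 2%:R <= (eta ^+ 2)%:E)%E.
  rewrite -(powR_mulrn _ (ltW eta0)) -poweR_EFin.
  apply: (gt0_ler_poweR (ler0n R 2)); last exact: ltW.
    by rewrite in_itv/= leey Lnorm_ge0.
  by rewrite in_itv/= leey lee_fin ltW.
rewrite -E ge0_integral_empirical//; last 2 first.
- by move=> x; rewrite lee_fin sqr_ge0.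
- by apply/measurable_EFinP; exact: measurable_funX.
have J0 : 0 < #|J|%:R :> R by rewrite ltr0n; apply/card_gt0P; exists j0.
by rewrite sumEFin -EFinM lee_fin mulrC ler_pdivrMr// mulrC.
Qed.

Lemma grid_approx (a : R) (m : nat) : 0 <= a <= 1 -> (0 < m)%N ->
  exists j : 'I_m.+1, `|a - j%:R / m%:R| <= m%:R^-1.
Proof.
move=> /andP[a0 a1] m0; have mR0 : 0 < m%:R :> R by rewrite ltr0n.
have am0 : 0 <= a * m%:R by rewrite mulr_ge0.
have /andP[t1 t2] := truncn_itv am0.
have jm : (truncn (a * m%:R) < m.+1)%N.
  rewrite ltnS -(ler_nat R); apply: (le_trans t1).
  by rewrite ler_piMl// ltW.
exists (Ordinal jm) => /=.
rewrite -[X in `|X - _|](mulfK (lt0r_neq0 mR0)) -mulrBl normrM.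
have mi : 0 <= m%:R^-1 :> R by rewrite invr_ge0.
rewrite (ger0_norm mi); apply: ler_piMl => //.
by rewrite ger0_norm ?subr_ge0// lerBlDl natr1 ltW.
Qed.

Variables (X : set T) (D : T -> R) (l M A nu : R) (p n : nat).
Hypotheses (mD : measurable_fun setT D) (DM : forall x, `|D x| <= M).
Hypotheses (l0 : 0 < l) (A0 : 0 < A) (nu0 : 0 < nu) (n0 : (0 < n)%N).
Hypothesis VC : uniform_VC (rescaled_class D X l) M A nu.

(** A cover of the functions without their scalar factor, applied to the empirical measure of the 2n
    points, is multiplied by a grid of [0, 1] for the factor (l/h)^p. Each of the two approximations
    has error at most eta/2. *)
Lemma rescaled_cover (y : 'I_n -> bool -> T) (eta : R) : 0 < eta ->
  exists N (g : 'I_N -> 'I_n -> bool -> R),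
  [/\ N%:R <= Num.max 1 (6 * (A + 1) * M / eta) `^ (nu + 2),
    forall j i c, `|g j i c| <= M &
    forall x h, X x -> l <= h -> exists j : 'I_N,
      sqn (fun i c => (l / h) ^+ p * rescaled D x h (y i c) - g j i c)
        <= 2 * n%:R * eta ^+ 2].
Proof.
move=> eta0; have M0 : 0 <= M := le_trans (normr_ge0 _) (DM 0).
have lh h : l <= h -> 0 <= l / h <= 1.
  move=> lh; have h0 := lt_le_trans l0 lh.
  by rewrite divr_ge0 ?(ltW l0) ?(ltW h0)//= ler_pdivrMr// mul1r.
have lhp h : l <= h -> 0 <= (l / h) ^+ p <= 1.
  by move=> /lh/andP[h0 h1]; rewrite exprn_ge0//= exprn_ile1.
have sqM (u : R) : `|u| <= M -> u ^+ 2 <= M ^+ 2.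
  by move=> uM; rewrite -(real_normK (num_real u)) lerXn2r ?nnegrE.
have nu2 : 0 <= nu + 2 by rewrite addr_ge0// ltW.
(* The VC bound is available only for radii below [M]; from 2M on, the zero function alone is a
   cover. *)
have [etaM|etaM] := leP (2 * M) eta.
  exists 1%N, (fun _ _ _ => 0); split.
  - rewrite [leLHS](_ : _ = 1 `^ (nu + 2)); last by rewrite powR1.
    by apply: ge0_ler_powR; rewrite ?nnegrE ?le_max ?lexx ?ler01.
  - by move=> *; rewrite normr0.
  move=> x h Xx /lhp/andP[h0 h1]; exists ord0.
  apply: (@le_trans _ _ (\sum_(i < n) (M ^+ 2 + M ^+ 2))).
    apply: ler_sum => i _; apply: lerD; apply: sqM;
      by rewrite subr0 normrM (ger0_norm h0) (le_trans (ler_piMl _ h1) (DM _)).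
  have Me : M ^+ 2 <= eta ^+ 2 by rewrite lerXn2r ?nnegrE ?(ltW eta0)//; lra.
  rewrite sumr_const card_ord (_ : 2 * _ * _ = (eta ^+ 2 + eta ^+ 2) *+ n).
    by rewrite lerMn2r lerD ?orbT.
  by rewrite -[RHS]mulr_natr; ring.
pose e2 := eta / 2.
have e20 : 0 < e2 by rewrite divr_gt0.
have e2M : 0 < e2 < M by rewrite e20/= /e2; lra.
have j0 : 'I_n * bool := (Ordinal n0, true).
pose Q : probability T R := empirical (fun j => y j.1 j.2) j0.
have [k [c [kB cF cov]]] := covering_number_le (VC Q e2M).
pose m := (truncn (2 * M / eta)).+1.
have mM : 2 * M / eta <= m%:R by exact/ltW/truncnS_gt.
have mM' : m%:R <= 2 * M / eta + 1.
  by rewrite /m -natr1 lerD2r truncn_le// divr_ge0 ?mulr_ge0// ltW.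
have mR0 : 0 < m%:R :> R by rewrite ltr0n.
pose I := ('I_k * 'I_m.+1)%type.
pose g0 (q : I) i b := q.2%:R / m%:R * c q.1 (y i b).
have cM j z : `|c j z| <= M by have [x _ [h _ <-]] := cF j; exact: DM.
have grid1 (q : 'I_m.+1) : 0 <= (q%:R / m%:R : R) <= 1.
  by rewrite divr_ge0//= ler_pdivrMr// mul1r ler_nat -ltnS.
exists #|{: I}|, (fun q => g0 (enum_val q)); split.
- rewrite card_prod !card_ord natrM.
  have -> : Num.max 1 (6 * (A + 1) * M / eta) = 6 * (A + 1) * M / eta.
    apply/max_idPr; rewrite ler_pdivlMr// mul1r.
    have : 0 <= A * M by rewrite mulr_ge0// ltW.
    by lra.
  set beta := 6 * (A + 1) * M / eta.
  have w : 1 < 2 * M / eta by rewrite ltr_pdivlMr// mul1r.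
  have betaE : beta = 3 * (A + 1) * (2 * M / eta) by rewrite /beta; ring.
  have Aw : 0 <= A * (2 * M / eta) by rewrite mulr_ge0 ?ltW// (lt_trans _ w).
  have beta3 : 3 * (2 * M / eta) <= beta by rewrite betaE; lra.
  have betaA : A * M / e2 <= beta.
    rewrite betaE /e2 (_ : A * M / (eta / 2) = A * (2 * M / eta)).
      by lra.
    by field; exact: lt0r_neq0.
  have beta0 : 0 <= beta by lra.
  (* Of the two extra powers of [beta], one bounds the size of the grid and the other absorbs the
     factor 2 that comes from the slack 1 in the cover size. *)
  apply: (@le_trans _ _ ((beta `^ nu + beta `^ nu) * beta)).
    apply: ler_pM => //; last by rewrite -natr1; lra.
    apply: (le_trans kB); apply: lerD.
      apply: ge0_ler_powR; rewrite ?nnegrE ?(ltW nu0)//.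
      exact: (divr_ge0 (mulr_ge0 (ltW A0) M0) (ltW e20)).
    rewrite [leLHS](_ : _ = 1 `^ nu); last by rewrite powR1.
    by apply: ge0_ler_powR; rewrite ?nnegrE ?(ltW nu0)//; lra.
  rewrite powRD; last by apply/implyP => _; rewrite gt_eqF//; lra.
  rewrite powR_mulrn// -mulr2n -mulr_natl mulrAC mulrC ler_wpM2l ?powR_ge0//.
  by nra.
- move=> q i b; have /andP[q0 q1] := grid1 (enum_val q).2.
  by rewrite /g0 normrM (ger0_norm q0) (le_trans (ler_piMl _ q1) (cM _ _)).
move=> x h Xx lxh; have /andP[h0 h1] := lhp h lxh.
have [j jP] := cov (rescaled D x h) (ex_intro2 _ _ x Xx (ex_intro2 _ _ h lxh erefl)).
have [q qP] := grid_approx (lhp h lxh) (isT : 0 < m)%N.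
exists (enum_rank (j, q)); rewrite /g0 enum_rankK/=.
set a := (l / h) ^+ p in h0 h1 qP *.
set u := q%:R / m%:R in qP *.
have mg : measurable_fun setT (rescaled D x h \- c j)%R.
  apply: measurable_funB; first exact: measurable_rescaled.
  by have [x' _ [h' _ <-]] := cF j; exact: measurable_rescaled.
have := L2norm_empirical_lt mg e20 jP.
rewrite card_prod card_ord card_bool => sumle.
have pt i b : (a * rescaled D x h (y i b) - u * c j (y i b)) ^+ 2 <=
    2 * (rescaled D x h (y i b) - c j (y i b)) ^+ 2 + 2 * (eta / 2) ^+ 2.
  have -> : a * rescaled D x h (y i b) - u * c j (y i b) =
    a * (rescaled D x h (y i b) - c j (y i b)) + (a - u) * c j (y i b) by ring.
  have au : ((a - u) * c j (y i b)) ^+ 2 <= (eta / 2) ^+ 2.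
    rewrite -(real_normK (num_real ((a - u) * _))) lerXn2r ?nnegrE ?(ltW e20)//.
    rewrite normrM; apply: (@le_trans _ _ (m%:R^-1 * M)); first exact: ler_pM.
    rewrite mulrC ler_pdivrMr//; move: mM; rewrite ler_pdivrMr//; lra.
  have aa : (a * (rescaled D x h (y i b) - c j (y i b))) ^+ 2 <=
      (rescaled D x h (y i b) - c j (y i b)) ^+ 2.
    by rewrite exprMn ler_piMl ?sqr_ge0// exprn_ile1.
  move: au aa; set s := a * _; set t := _ * c _ _ => au aa.
  by have := sqr_ge0 (s - t); lra.
apply: (@le_trans _ _ (\sum_(i < n) \sum_b
    (2 * (rescaled D x h (y i b) - c j (y i b)) ^+ 2 + 2 * (eta / 2) ^+ 2))).
  by apply: ler_sum => i _; rewrite big_bool lerD.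
rewrite pair_big/= big_split/= -mulr_sumr sumr_const card_prod card_ord card_bool.
apply: (@le_trans _ _ (2 * ((n * 2)%:R * e2 ^+ 2) +
    2 * ((n * 2)%:R * (eta / 2) ^+ 2))).
  by apply: lerD; rewrite ?ler_pM2l// -[leLHS]mulr_natl mulrCA.
by rewrite natrM /e2 le_eqVlt; apply/orP; left; apply/eqP; field.
Qed.

End covers.

(** * Symmetrization *)

Section iid_sums.
Context {R : realType} {dT : measure_display} {T : measurableType dT}.
Context {dO : measure_display} {Omega : measurableType dO}.

Lemma bounded_integrable d' (S : measurableType d') (mu : probability S R)
    (f : S -> R) (B : R) : measurable_fun setT f -> (forall x, `|f x| <= B) ->
  mu.-integrable setT (EFin \o f).
Proof.
move=> mf fB; apply: measurable_bounded_integrable => //.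
  by rewrite (le_lt_trans (probability_le1 _ _)) ?ltry.
exists B; split; first exact: num_real.
by move=> M BM x _; exact/(le_trans (fB x))/ltW.
Qed.

Lemma markov_ineq d' (S : measurableType d') (mu : probability S R)
    (f : S -> R) (a : R) (E : \bar R) : measurable_fun setT f ->
  (forall x, 0 <= f x) -> 0 < a -> (\int[mu]_x (f x)%:E <= E)%E ->
  (a%:E * mu [set x | (a <= f x)%R] <= E)%E.
Proof.
move=> mf f0 a0; apply: le_trans.
have mE : measurable_fun setT (EFin \o f) by exact/measurable_EFinP.
have := le_integral_abse mu measurableT mE a0; rewrite setTI.
rewrite (_ : [set x | _] = [set x | (a <= f x)%R]).
  move/le_trans; apply; rewrite le_eqVlt; apply/orP; left; apply/eqP.
  by apply: eq_integral => x _ /=; rewrite ger0_norm.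
by apply/seteqP; split=> x /=; rewrite lee_fin ger0_norm.
Qed.

Variables (Pr : probability Omega R) (P : probability T R) (n : nat).
Variable Y : 'I_n -> {RV Pr >-> T}.
Hypotheses (indepY : independent Y) (distY : identically_distributed Y P).

Lemma integral_identically_distributed i (f : T -> R) :
  measurable_fun setT f -> P.-integrable setT (EFin \o f) ->
  Pr.-integrable setT (fun w => (f (Y i w))%:E) /\
  (\int[Pr]_w (f (Y i w))%:E = \int[P]_x (f x)%:E)%E.
Proof.
move=> mf fi; have mE : measurable_fun setT (EFin \o f) by exact/measurable_EFinP.
have PE (g : T -> \bar R) :
    (\int[distribution Pr (Y i)]_x g x = \int[P]_x g x)%E.
  by apply: eq_measure_integral => B mB _; exact: distY.
have iY : Pr.-integrable setT (fun w => (f (Y i w))%:E).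
  apply/integrableP; split.
    by apply/measurable_EFinP; exact: (measurableT_comp mf).
  have mA : measurable_fun setT (abse \o (EFin \o f)).
    exact: measurableT_comp.
  have A0 x : (0 <= (abse \o (EFin \o f)) x)%E by exact: abse_ge0.
  rewrite -(ge0_integral_distribution (Y i) mA A0) PE.
  by have /integrableP[] := fi.
split=> //.
by rewrite -PE (@integral_distribution _ _ _ _ _ Pr (Y i) (EFin \o f)).
Qed.

Lemma pair_distribution i j (A B : set T) : i != j ->
  measurable A -> measurable B ->
  Pr (Y i @^-1` A `&` Y j @^-1` B) = (P A * P B)%E.
Proof.
move=> ij mA mB.
pose C k := if k == i then A else if k == j then B else setT.
have mC k : measurable (C k) by rewrite /C; case: ifP => // _; case: ifP.
have := indepY mC; rewrite (_ : \bigcap_(_ in _) _ = Y i @^-1` A `&` Y j @^-1` B).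
  move=> ->; rewrite (bigD1 i)//= (bigD1 j) 1?eq_sym//= big1 => [|k /andP[ki kj]].
    rewrite mule1 /C eqxx eq_sym (negbTE ij) eqxx.
    by congr (_ * _)%E; exact: distY.
  by rewrite /C (negbTE ki) (negbTE kj) preimage_setT probability_setT.
apply/seteqP; split=> w.
  move=> wC; have := wC i I; have := wC j I; rewrite /C /= eqxx.
  by rewrite eq_sym (negbTE ij) eqxx.
move=> [Aw Bw] k _; rewrite /C/=; case: ifPn => [/eqP ->//|_].
by case: ifPn => [/eqP ->|].
Qed.

Lemma integral_pair i j (f : T -> R) (B : R) : i != j ->
  measurable_fun setT f -> (forall x, `|f x| <= B) ->
  (\int[Pr]_w (f (Y i w) * f (Y j w))%:E =
   \int[P]_x \int[P]_y (f x * f y)%:E)%E.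
Proof.
move=> ij mf fB.
have mYY : measurable_fun setT (fun w => (Y i w, Y j w)).
  exact: measurable_fun_pair.
pose YY : {mfun Omega >-> (T * T)%type} :=
  MeasurableFun.Pack (MeasurableFun.Class (isMeasurableFun.Build _ _ _ _ _ mYY)).
pose F (z : T * T) := (f z.1 * f z.2).
have mF : measurable_fun setT F.
  by apply: measurable_funM; apply: measurableT_comp.
have FB z : `|F z| <= B * B by rewrite normrM ler_pM.
have mFY : measurable_fun setT (F \o YY) by exact: measurableT_comp.
have intF : Pr.-integrable setT (EFin \o (F \o YY)).
  by apply: (bounded_integrable Pr (B := B * B) mFY) => w; exact: FB.
transitivity (\int[distribution Pr YY]_z (F z)%:E)%E.
  rewrite (@integral_distribution _ _ _ _ _ Pr YY (EFin \o F))//.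
  exact/measurable_EFinP.
transitivity (\int[(P \x P)%E]_z (F z)%:E)%E.
  apply: eq_measure_integral => A mA _; apply/esym.
  apply: product_measure_unique => // A1 A2 mA1 mA2.
  by rewrite -(pair_distribution ij mA1 mA2).
rewrite -integral12_prod_meas1//.
exact: (bounded_integrable (P \x P)%E mF FB).
Qed.

(** Chebyshev's inequality: pairwise independence cancels the mixed terms, so the variance is at
    most n sigma^2. It is meant for the ghost sample and a single function. *)
Lemma iid_deviation (f : T -> R) (B sigma u : R) : (0 < n)%N -> 0 < u ->
  4 * sigma ^+ 2 <= n%:R * u ^+ 2 ->
  measurable_fun setT f -> (forall x, `|f x| <= B) ->
  (\int[P]_x (f x ^+ 2)%:E <= (sigma ^+ 2)%:E)%E ->
  (Pr [set w | (n%:R * u <= `|\sum_i (f (Y i w) - fine (\int[P]_x (f x)%:E))|)%R]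
    <= (4^-1)%:E)%E.
Proof.
move=> n0 u0 su mf fB f2.
have nR0 : 0 < n%:R :> R by rewrite ltr0n.
have intf : P.-integrable setT (EFin \o f) by exact: (bounded_integrable P mf fB).
have P1 : P setT = 1%E := probability_setT P.
set m := fine _.
have mE : (\int[P]_x (f x)%:E = m%:E)%E.
  by rewrite /m fineK//; exact: (integrable_fin_num _ intf).
pose g x := f x - m.
have mg : measurable_fun setT g by apply: measurable_funB.
have gB x : `|g x| <= B + `|m| by rewrite (le_trans (ler_normB _ _))// lerD2r.
have intg : P.-integrable setT (EFin \o g) by exact: (bounded_integrable P mg gB).
have g0 : (\int[P]_x (g x)%:E = 0)%E.
  under eq_integral do rewrite EFinB.
  rewrite integralB_EFin//; last first.
    exact: (bounded_integrable P (f := cst m) (B := `|m|)).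
  by rewrite mE integral_cst// [X in (_ * X)%E]P1 mule1 subee.
have mf2 : measurable_fun setT (fun x => f x ^+ 2) by exact: measurable_funX.
have g2 : (\int[P]_x (g x ^+ 2)%:E <= (sigma ^+ 2)%:E)%E.
  have -> : (\int[P]_x (g x ^+ 2)%:E =
      \int[P]_x ((f x ^+ 2)%:E + ((- 2 * m)%:E * (f x)%:E + (m ^+ 2)%:E)))%E.
    by apply: eq_integral => x _; rewrite -EFinM -!EFinD /g; congr EFin; ring.
  have f2B x : `|f x ^+ 2| <= B ^+ 2.
    by rewrite normrX lerXn2r ?nnegrE//; exact: (le_trans (normr_ge0 _) (fB x)).
  have ifm : P.-integrable setT (fun x => (- 2 * m)%:E * (f x)%:E)%E.
    exact: integrableZl.
  have icst : P.-integrable setT (fun _ : T => (m ^+ 2)%:E).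
    exact: (bounded_integrable P (f := cst (m ^+ 2)) (B := `|m ^+ 2|)).
  rewrite integralD//; last 2 first.
  - exact: (bounded_integrable P mf2 f2B).
  - exact: integrableD.
  rewrite integralD// integralZl// mE integral_cst// [X in (_ + _ * X)%E]P1 mule1.
  rewrite -EFinM -EFinD -[leRHS]adde0; apply: leeD => //.
  by rewrite lee_fin; have := sqr_ge0 m; lra.
have gYB i j w : `|g (Y i w) * g (Y j w)| <= (B + `|m|) * (B + `|m|).
  by rewrite normrM ler_pM.
have mgY i : measurable_fun setT (fun w => g (Y i w)).
  exact: (measurableT_comp mg).
pose S w := \sum_i g (Y i w).
have mS : measurable_fun setT S by exact: measurable_sum.
have S2 : (\int[Pr]_w (S w ^+ 2)%:E <= (n%:R * sigma ^+ 2)%:E)%E.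
  have -> : (\int[Pr]_w (S w ^+ 2)%:E =
      \int[Pr]_w \sum_i \sum_j (g (Y i w) * g (Y j w))%:E)%E.
    apply: eq_integral => w _; rewrite expr2 mulr_suml -sumEFin.
    by apply: eq_bigr => i _; rewrite mulr_sumr -sumEFin.
  have intgg i j : Pr.-integrable setT (fun w => (g (Y i w) * g (Y j w))%:E).
    by apply: (bounded_integrable Pr _ (gYB i j)); exact: measurable_funM.
  rewrite integral_sum//; last by move=> i; exact: integrable_sum.
  rewrite (_ : n%:R * _ = \sum_(i < n) sigma ^+ 2); last first.
    by rewrite sumr_const card_ord mulr_natl.
  rewrite -sumEFin.
  apply: lee_sum => i _; rewrite integral_sum// (bigD1 i)//= big1 ?adde0.
    under eq_integral do rewrite -expr2.
    have mg2 : measurable_fun setT (fun x => g x ^+ 2) by exact: measurable_funX.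
    have g2B x : `|g x ^+ 2| <= (B + `|m|) ^+ 2.
      by rewrite normrX lerXn2r ?nnegrE// (le_trans _ (gB x)).
    by have [_ ->] := integral_identically_distributed i mg2
      (bounded_integrable P mg2 g2B).
  move=> j ji; rewrite (integral_pair _ mg gB) 1?eq_sym//.
  rewrite integral0_eq// => x _.
  under eq_integral do rewrite EFinM.
  by rewrite integralZl// g0 mule0.
have nu0 : 0 < (n%:R * u) ^+ 2 by rewrite exprn_gt0// mulr_gt0.
have mS2 : measurable_fun setT (fun w => S w ^+ 2) by exact: measurable_funX.
have := markov_ineq mS2 (fun w => sqr_ge0 (S w)) nu0 S2.
rewrite (_ : [set w | ((n%:R * u) ^+ 2 <= S w ^+ 2)%R] =
    [set w | (n%:R * u <= `|S w|)%R]); last first.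
  apply: eq_set => w; rewrite -(real_normK (num_real (S w))).
  by rewrite ler_pXn2r// nnegrE// mulr_ge0// ltW.
rewrite muleC -lee_pdivlMr// => /le_trans; apply.
rewrite -EFinM lee_fin ler_pdivrMr// exprMn.
have : n%:R * (4 * sigma ^+ 2) <= n%:R * (n%:R * u ^+ 2) by rewrite ler_pM2l.
by lra.
Qed.

(** Markov's inequality. Together with [iid_deviation], a fixed function behaves well on the ghost
    sample with probability at least 1/2. *)
Lemma iid_second_moment (f : T -> R) (B sigma : R) : (0 < n)%N -> 0 < sigma ->
  measurable_fun setT f -> (forall x, `|f x| <= B) ->
  (\int[P]_x (f x ^+ 2)%:E <= (sigma ^+ 2)%:E)%E ->
  (Pr [set w | (4 * n%:R * sigma ^+ 2 <= \sum_i f (Y i w) ^+ 2)%R]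
    <= (4^-1)%:E)%E.
Proof.
move=> n0 s0 mf fB f2.
have nR0 : 0 < n%:R :> R by rewrite ltr0n.
have mf2 : measurable_fun setT (fun x => f x ^+ 2) by exact: measurable_funX.
have mfY i : measurable_fun setT (fun w => f (Y i w) ^+ 2).
  exact: (measurableT_comp mf2).
have mS : measurable_fun setT (fun w => \sum_i f (Y i w) ^+ 2).
  exact: measurable_sum.
have f2B x : `|f x ^+ 2| <= B ^+ 2.
  by rewrite normrX lerXn2r ?nnegrE//; exact: (le_trans (normr_ge0 _) (fB x)).
have S2 : (\int[Pr]_w (\sum_i f (Y i w) ^+ 2)%:E <= (n%:R * sigma ^+ 2)%:E)%E.
  under eq_integral do rewrite -sumEFin.
  rewrite integral_sum//; last first.
    by move=> i; apply: (bounded_integrable Pr (B := B ^+ 2) (mfY i)) => w; exact: f2B.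
  rewrite (_ : n%:R * _ = \sum_(i < n) sigma ^+ 2); last first.
    by rewrite sumr_const card_ord mulr_natl.
  rewrite -sumEFin.
  apply: lee_sum => i _.
  by have [_ ->] := integral_identically_distributed i mf2
    (bounded_integrable P mf2 f2B).
have a0 : 0 < 4 * n%:R * sigma ^+ 2 by rewrite !mulr_gt0// exprn_gt0.
have := markov_ineq mS (fun w => sumr_ge0 _ (fun i _ => sqr_ge0 _)) a0 S2.
rewrite muleC -lee_pdivlMr// => /le_trans; apply.
rewrite -EFinM lee_fin ler_pdivrMr//; lra.
Qed.

End iid_sums.

(** * The product space of doubled samples *)

Section samples.
Context {dT : measure_display} {T : measurableType dT} {J : finType}.

Definition boxes : set_system (J -> T) :=
  [set [set s | forall j, B j (s j)] | B in [set B | forall j, measurable (B j)]].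

(** The finite product sigma-algebra. Boxes are stable under intersection, so the product formula on
    them determines a law, which is how its invariance under swaps is checked. *)
Definition samples := g_sigma_algebraType boxes.

HB.instance Definition _ := Measurable.on samples.

Lemma measurable_sample_coord (j : J) :
  measurable_fun setT (fun s : samples => s j).
Proof.
move=> _ B mB; rewrite setTI; apply: sub_sigma_algebra.
exists (fun k => if k == j then B else setT).
  by move=> k /=; case: ifP.
apply/seteqP; split=> s /=; first by move=> /(_ j); rewrite eqxx.
by move=> Bs k; case: eqP => // ->.
Qed.

Lemma measurable_fun_samples d' (S : measurableType d') (f : S -> samples) :
  (forall j, measurable_fun setT (fun x => f x j)) -> measurable_fun setT f.
Proof.
move=> mf.
suff mfb : preimage_set_system [set: S] f boxes `<=` measurable.
  exact: measurability mfb.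
move=> _ [_ [B mB <-] <-].
rewrite setTI (_ : _ @^-1` _ =
    \bigcap_(j in [set: J]) ((fun x => f x j) @^-1` B j)).
  apply: fin_bigcap_measurable => [|j _]; first exact: finite_finset.
  by rewrite -[X in measurable X]setTI; apply: mf.
by apply/seteqP; split=> [x Bx j _|x Bx j]; [exact: Bx|exact: (Bx j I)].
Qed.

Lemma samples_measure_unique {R : realType} (m1 m2 : probability samples R) :
  (forall B : J -> set T, (forall j, measurable (B j)) ->
    m1 [set s | forall j, B j (s j)] = m2 [set s | forall j, B j (s j)]) ->
  forall A, measurable A -> m1 A = m2 A.
Proof.
move=> m12 A mA.
apply: (@measure_unique _ R samples boxes (fun=> setT) _ _ _ _ m1 m2) => //.
- move=> _ _ [B mB <-] [C mC <-]; exists (fun j => B j `&` C j).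
    by move=> j; exact: measurableI.
  apply/seteqP; split=> s /=; first by move=> BC; split=> j; case: (BC j).
  by move=> [Bs Cs] j.
- by move=> _; exists (fun=> setT) => //; apply/seteqP; split.
- by rewrite bigcup_const//; exists 0%N.
- by move=> _ [B mB <-]; exact: m12.
- by move=> _; rewrite (le_lt_trans (probability_le1 _ _)) ?ltry.
Qed.

End samples.
Arguments samples {dT} T J.

Section symmetrization.
Context {R : realType} {dT : measure_display} {T : measurableType dT}.
Context {dO : measure_display} {Omega : measurableType dO}.
Variables (Pr : probability Omega R) (P : probability T R) (n : nat).
Variable Y : 'I_n -> {RV Pr >-> T}.
Hypotheses (indepY : independent Y) (distY : identically_distributed Y P).

Local Notation J := ('I_n * bool)%type.
Local Notation sample := (samples T J).

(* Each point of Omega * Omega carries the sample (index false) and its ghost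
   copy (index true). *)
Let ghost (w : Omega * Omega) : sample :=
  fun j => if j.2 then Y j.1 w.2 else Y j.1 w.1.

Let measurable_ghost : measurable_fun setT ghost.
Proof.
apply: measurable_fun_samples => -[i [|]]; rewrite /ghost/=.
  exact: (measurableT_comp (measurable_funPT (Y i)) measurable_snd).
exact: (measurableT_comp (measurable_funPT (Y i)) measurable_fst).
Qed.

Let Ghost : {mfun (Omega * Omega)%type >-> sample} :=
  MeasurableFun.Pack (MeasurableFun.Class (isMeasurableFun.Build _ _ _ _ _
    measurable_ghost)).

Let lam : probability sample R := distribution (Pr \x Pr)%E Ghost.

Let lam_box (B : J -> set T) : (forall j, measurable (B j)) ->
  lam [set s | forall j, B j (s j)] =
  (\prod_(i < n) (P (B (i, false)) * P (B (i, true))))%E.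
Proof.
move=> mB; rewrite /lam /distribution/= /pushforward.
pose C b := \bigcap_(i in [set: 'I_n]) (Y i @^-1` B (i, b)).
have CE b : Pr (C b) = (\prod_(i < n) P (B (i, b)))%E.
  rewrite /C indepY//; apply: eq_bigr => i _; exact: distY.
have mC b : measurable (C b).
  apply: fin_bigcap_measurable => [|i _]; first exact: finite_finset.
  by rewrite -[X in measurable X]setTI; apply: measurable_funPT.
rewrite (_ : _ @^-1` _ = C false `*` C true).
  by rewrite product_measure1E// big_split/= !CE.
apply/seteqP; split=> [[w w'] /= gB|[w w'] /= [Cw Cw'] [i [|]]].
- split=> i _; first exact: (gB (i, false)).
  exact: (gB (i, true)).
- exact: (Cw' i I).
- exact: (Cw i I).
Qed.

Let swap (e : {ffun 'I_n -> bool}) (s : sample) : sample :=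
  fun j => s (j.1, e j.1 (+) j.2).

Let measurable_swap e : measurable_fun setT (swap e).
Proof. by apply: measurable_fun_samples => j; exact: measurable_sample_coord. Qed.

Let Swap e : {mfun sample >-> sample} :=
  MeasurableFun.Pack (MeasurableFun.Class (isMeasurableFun.Build _ _ _ _ _
    (measurable_swap e))).

Let lam_swap e A : measurable A -> lam (swap e @^-1` A) = lam A.
Proof.
move=> mA; rewrite -[LHS]/(distribution lam (Swap e) A).
apply: samples_measure_unique => // B mB.
rewrite -[LHS]/(lam (swap e @^-1` [set s | forall j, B j (s j)])).
rewrite (_ : _ @^-1` _ = [set s | forall j, B (j.1, e j.1 (+) j.2) (s j)]).
  rewrite (lam_box mB) (@lam_box (fun j => B (j.1, e j.1 (+) j.2)))//.
  apply: eq_bigr => i _ /=.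
  by rewrite addbF addbT; case: (e i); rewrite //= muleC.
apply/seteqP; split=> s /= sB [i c].
  by have := sB (i, e i (+) c); rewrite /swap/= addKb.
by have := sB (i, e i (+) c); rewrite /swap/= addKb.
Qed.

(** By invariance, [lam E] is the average over [e] of the measures of the swapped preimages, that
    is, the integral over s of the proportion of swaps that send s into [E]. *)
Let lam_average (E : set sample) (delta : R) : measurable E ->
  (forall s, weight [set e | E (swap e s)] <= 2 ^+ n * delta) ->
  (lam E <= delta%:E)%E.
Proof.
move=> mE Ed.
have mEs e : measurable (swap e @^-1` E).
  by rewrite -[X in measurable X]setTI; apply: measurable_swap.
have : ((2 ^+ n)%:E * lam E <= (2 ^+ n * delta)%:E)%E.
  have -> : ((2 ^+ n)%:E * lam E =
      \sum_(e : {ffun 'I_n -> bool}) lam (swap e @^-1` E))%E.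
    under eq_bigr do rewrite lam_swap//.
    rewrite -[lam E]fineK ?fin_num_measure// -EFinM sumEFin sumr_const.
    by rewrite card_ffun card_bool card_ord -[in RHS]mulr_natl natrX.
  under eq_bigr do rewrite -[X in lam X]setIT -integral_indic//.
  rewrite -ge0_integral_sum//; last first.
    by move=> e; exact/measurable_EFinP/measurable_indic.
  rewrite -[leRHS]mule1 -(probability_setT lam) -integral_cst//.
  apply: ge0_le_integral => //.
  - by move=> s _; apply: sume_ge0.
  - by apply: emeasurable_sum => e; exact/measurable_EFinP/measurable_indic.
  - by move=> s _; rewrite sumEFin lee_fin; exact: Ed.
rewrite EFinM lee_pmul2l//.
Qed.

(** A parameter z that is bad for the sample [w] is fixed before the ghost is drawn, so the bounds
    for one function apply to it: at least half of the ghosts make the pair bad as well. Bad samples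
    therefore have probability at most twice that of bad pairs. *)
Lemma symmetrization m (psi : 'rV[R]_m -> T -> R) (Z : set 'rV[R]_m)
    (B sigma u delta : R) : (0 < n)%N -> measurable Z ->
  measurable_fun setT (fun p : 'rV[R]_m * T => psi p.1 p.2) ->
  (forall z y, Z z -> `|psi z y| <= B) ->
  (forall z, Z z -> (\int[P]_y (psi z y ^+ 2)%:E <= (sigma ^+ 2)%:E)%E) ->
  0 < sigma -> 0 < u -> 4 * sigma ^+ 2 <= n%:R * u ^+ 2 -> 0 < delta ->
  (forall y : 'I_n -> bool -> T, weight [set e | exists z, [/\ Z z,
      n%:R * u < `|swap_diff e (fun i c => psi z (y i c))| &
      \sum_i psi z (y i (~~ e i)) ^+ 2 <= 4 * n%:R * sigma ^+ 2]]
    <= 2 ^+ n * (delta / 4)) ->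
  exists E, [/\ measurable E, ((1 - delta)%:E <= Pr E)%E &
    forall w, E w -> forall z, Z z ->
      `|\sum_i (psi z (Y i w) - fine (\int[P]_y (psi z y)%:E))| <= 2 * n%:R * u].
Proof.
move=> n0 mZ mpsi psiB psi2 sigma0 u0 su delta0 wt.
pose F (p : 'rV[R]_m * sample) :=
  `|\sum_i (psi p.1 (p.2 (i, false)) - psi p.1 (p.2 (i, true)))|.
pose G (p : 'rV[R]_m * sample) := \sum_i psi p.1 (p.2 (i, true)) ^+ 2.
have mcoord j : measurable_fun setT
    (fun p : 'rV[R]_m * sample => psi p.1 (p.2 j)).
  have mj : measurable_fun setT (fun p : 'rV[R]_m * sample => (p.1, p.2 j)).
    apply: measurable_fun_pair => //.
    exact: (measurableT_comp (measurable_sample_coord j) measurable_snd).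
  exact: (measurableT_comp mpsi mj).
have mF : measurable_fun setT F.
  apply: (measurableT_comp (@normr_measurable R setT)).
  by apply: measurable_sum => i; exact: measurable_funB.
have mG : measurable_fun setT G.
  by apply: measurable_sum => i; exact: measurable_funX.
pose A := (Z `*` setT) `&` (F @^-1` `]n%:R * u, +oo[) `&`
  (G @^-1` `]-oo, 4 * n%:R * sigma ^+ 2]).
have mA : measurable A.
  apply: measurableI; first apply: measurableI.
  - exact: measurableX.
  - by rewrite -[X in measurable X]setTI; apply: mF.
  - by rewrite -[X in measurable X]setTI; apply: mG.
have AP z s : A (z, s) <-> [/\ Z z, n%:R * u < F (z, s) &
    G (z, s) <= 4 * n%:R * sigma ^+ 2].
  rewrite /A /= !in_itv/= andbT; split=> [[[[]]]|[]] //.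
have d4 : 0 < delta / 4 by rewrite divr_gt0.
(* The count of swaps passes to subsets, so the averaging is done on the inner set [E1]; the
   argument on ghosts needs a measurable set containing all bad pairs, which is [H]. *)
have [E1 [H [mE1 mH E1U UH HE1]]] := measurable_proj_approx lam mA d4.
have lamE1 : (lam E1 <= (delta / 4)%:E)%E.
  apply: lam_average => // s; apply: le_trans (wt (fun i c => s (i, c))).
  apply: weight_le => e /E1U [z /AP [Zz Fz Gz]]; exists z; split=> //.
  - move: Fz; rewrite /F /swap_diff; congr (_ < `|_|).
    by apply: eq_bigr => i _; rewrite /swap/= addbF addbT.
  - move: Gz; rewrite /G; congr (_ <= _).
    by apply: eq_bigr => i _; rewrite /swap/= addbT.
have lamH : (lam H <= (delta / 2)%:E)%E.
  apply: (le_trans HE1); rewrite (splitr (delta / 2)) EFinD.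
  rewrite (_ : delta / 2 / 2 = delta / 4); last by field.
  exact: leeD.
pose V := ghost @^-1` H.
have mV : measurable V.
  by rewrite -[X in measurable X]setTI; apply: measurable_ghost.
pose g w := Pr (xsection V w).
have mg : measurable_fun setT g by exact: measurable_fun_xsection.
have g0 w : (0 <= g w)%E by exact: measure_ge0.
(* Samples for which at least half of the ghosts lead into [H]. This set is measurable and contains
   the bad samples, whose own set need not be. *)
pose N := [set w | (2^-1%:E <= `|g w|)%E].
have mN : measurable N.
  rewrite -[N]setTI; apply: emeasurable_fun_c_infty => //.
  exact: measurableT_comp.
have PN : (Pr N <= delta%:E)%E.
  have h0 : 0 < 2^-1 :> R by [].
  have := le_integral_abse Pr measurableT mg h0; rewrite setTI -/N => h.
  have : (2^-1%:E * Pr N <= (delta / 2)%:E)%E.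
    apply: (le_trans h); apply: le_trans lamH; rewrite le_eqVlt; apply/orP; left.
    apply/eqP; rewrite [RHS]/(\int[Pr]_w g w)%E; apply: eq_integral => w _.
    by rewrite gee0_abs.
  by rewrite mulrC EFinM lee_pmul2l.
exists (~` N); split; first exact: measurableC.
  by rewrite probability_setC// EFinB leeB.
move=> w Nw z Zz; rewrite leNgt; apply/negP => big; apply: Nw.
rewrite /N /= gee0_abs//.
have mpz : measurable_fun setT (psi z).
  exact: (measurableT_comp mpsi (measurable_pair1 z)).
set mu := fine _ in big.
have sumYm i : measurable_fun setT (fun w' => psi z (Y i w')).
  exact: (measurableT_comp mpz).
pose D1 := [set w' | n%:R * u <= `|\sum_i (psi z (Y i w') - mu)|].
pose D2 := [set w' | 4 * n%:R * sigma ^+ 2 <= \sum_i psi z (Y i w') ^+ 2].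
have P1 : (Pr D1 <= 4^-1%:E)%E.
  exact: (iid_deviation indepY distY n0 u0 su mpz (fun y => psiB z y Zz) (psi2 z Zz)).
have P2 : (Pr D2 <= 4^-1%:E)%E.
  exact: (iid_second_moment distY n0 sigma0 mpz (fun y => psiB z y Zz) (psi2 z Zz)).
have mD1 : measurable D1.
  rewrite -[D1]setTI.
  apply: (@measurable_fun_le _ _ _ setT (cst (n%:R * u)) _) => //.
  apply: (measurableT_comp (@normr_measurable R setT)).
  by apply: measurable_sum => i; exact: measurable_funB.
have mD2 : measurable D2.
  rewrite -[D2]setTI.
  apply: (@measurable_fun_le _ _ _ setT (cst (4 * n%:R * sigma ^+ 2)) _) => //.
  by apply: measurable_sum => i; exact: measurable_funX.
have mD : measurable (D1 `|` D2) by exact: measurableU.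
have PD : (Pr (D1 `|` D2) <= 2^-1%:E)%E.
  apply: (le_trans (measureU2 _ mD1 mD2)).
  by rewrite (_ : 2^-1 = 4^-1 + 4^-1 :> R) ?EFinD ?leeD//; field.
apply: (@le_trans _ _ (Pr (~` (D1 `|` D2)))).
  rewrite probability_setC// (_ : 2^-1 = 1 - 2^-1 :> R); last by field.
  by rewrite EFinB leeB.
apply: le_measure; rewrite ?inE; [exact: measurableC|exact: measurable_xsection|].
move=> w' /not_orP[/= D1w' D2w']; rewrite /xsection/=; apply/mem_set.
suff : H (ghost (w, w')) by [].
apply: UH; exists z; apply/AP; split=> //; last first.
  by rewrite /G /ghost/=; move/negP: D2w'; rewrite -ltNge => /ltW.
move/negP: D1w'; rewrite -ltNge => D1w'.
rewrite /F /ghost/=.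
have -> : \sum_i (psi z (Y i w) - psi z (Y i w')) =
    \sum_i (psi z (Y i w) - mu) - \sum_i (psi z (Y i w') - mu).
  by rewrite -sumrB; apply: eq_bigr => i _; ring.
apply: lt_le_trans (lerB_dist _ _).
by move: big D1w'; rewrite -mulrA; lra.
Qed.

End symmetrization.

(** * Derivatives of means *)

Section directional_derivatives.
Context {R : realType} {V : normedModType R}.
Implicit Types (f g : V -> R) (a v : V).

Lemma is_derive_epsP f a v (D : R) : is_derive a v f D <->
  forall e, 0 < e -> exists2 r, 0 < r & forall t, t != 0 -> `|t| < r ->
    `|t^-1 * (f (t *: v + a) - f a) - D| < e.
Proof.
split=> [[fd fD]|H].
  have : (t^-1 *: ((f \o shift a) (t *: v) - f a)) @[t --> 0^'] --> D.
    by rewrite -fD; exact: fd.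
  move=> /cvgrPdist_lt cf e e0.
  have /nbhs_ballP[r /= r0 rP] : nbhs (0 : R) [set t | t != 0 ->
      `|D - t^-1 *: ((f \o shift a) (t *: v) - f a)| < e] by exact: (cf e e0).
  exists r => // t t0 tr; rewrite distrC; apply: (rP t) => //.
  by rewrite /ball/= sub0r normrN.
have cf : (t^-1 *: ((f \o shift a) (t *: v) - f a)) @[t --> 0^'] --> D.
  apply/cvgrPdist_lt => e e0; have [r r0 rP] := H e e0.
  have : nbhs (0 : R) [set t | t != 0 ->
      `|D - t^-1 *: ((f \o shift a) (t *: v) - f a)| < e]; last by [].
  apply/nbhs_ballP; exists r => // t; rewrite /ball/= sub0r normrN => tr t0.
  by rewrite distrC; exact: rP.
by split; [exact: (cvgP _ cf)|exact: cvg_lim cf].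
Qed.

End directional_derivatives.

Section directional_derivatives_theory.
Context {R : realType} {V : normedModType R}.
Implicit Types (f g : V -> R) (a v : V).

Lemma is_derive_affine f (c h : R) (y x v : V) (D : R) : h != 0 ->
  is_derive (h^-1 *: (x - y)) v f D ->
  is_derive x v (fun x => c * f (h^-1 *: (x - y))) (c * (h^-1 * D)).
Proof.
move=> h0 /is_derive_epsP fD; apply/is_derive_epsP => e e0.
have e1 : 0 < e / (`|c| * `|h^-1| + 1).
  by rewrite divr_gt0// ltr_wpDl// mulr_ge0.
have [r r0 rP] := fD _ e1; exists (r * `|h|) => [|t t0 tr].
  by rewrite mulr_gt0// normr_gt0.
have th0 : h^-1 * t != 0 by rewrite mulf_neq0// invr_neq0.
have thr : `|h^-1 * t| < r by rewrite normrM normfV mulrC ltr_pdivrMr ?normr_gt0.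
have := rP _ th0 thr.
have -> : (h^-1 * t) *: v + h^-1 *: (x - y) = h^-1 *: (t *: v + x - y).
  by rewrite -scalerA -scalerDr addrA.
set q := f _ - f _ => qr.
have -> : t^-1 * (c * f (h^-1 *: (t *: v + x - y)) - c * f (h^-1 *: (x - y)))
    - c * (h^-1 * D) = c * h^-1 * ((h^-1 * t)^-1 * q - D).
  by rewrite /q; field; rewrite h0 t0.
rewrite normrM normrM; apply: (@le_lt_trans _ _ (`|c| * `|h^-1| *
    (e / (`|c| * `|h^-1| + 1)))).
  by rewrite ler_wpM2l ?mulr_ge0// ltW.
rewrite mulrCA -[ltRHS]mulr1 ltr_pM2l// ltr_pdivrMr ?mul1r ?ltrDl//.
Qed.

Lemma is_derive_bounded f (v a : V) (B t : R) (df : V -> R) :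
  (forall x, is_derive x v f (df x)) -> (forall x, `|df x| <= B) ->
  `|f (t *: v + a) - f a| <= B * `|t|.
Proof.
move=> fd dB.
have B0 : 0 <= B := le_trans (normr_ge0 _) (dB 0).
pose g s := f (s *: v + a).
have gd s : is_derive (s : R) (1 : R) g (df (s *: v + a)).
  apply/is_derive_epsP => e e0.
  have /is_derive_epsP/(_ e e0)[r r0 rP] := fd (s *: v + a).
  exists r => // u u0 ur; have := rP u u0 ur; rewrite /g.
  by rewrite addrA -scalerDl /GRing.scale/= mulr1.
have gc : continuous g.
  move=> s; apply: differentiable_continuous; apply/derivable1_diffP.
  by have [] := gd s.
have seg b c : b <= c -> `|g c - g b| <= B * (c - b).
  move=> bc; have [x _ ->] := MVT_segment bc (fun s _ => gd s)
    (continuous_subspaceT gc).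
  by rewrite normrM (ger0_norm (_ : 0 <= c - b)) ?subr_ge0// ler_wpM2r ?subr_ge0.
have := ltrgt0P t; rewrite -[f a](_ : g 0 = _); last by rewrite /g scale0r add0r.
rewrite -/(g t); case=> [t0|t0|->].
- by have := seg _ _ (ltW t0); rewrite subr0.
- by have := seg _ _ (ltW t0); rewrite distrC sub0r.
- by rewrite subrr normr0 mulr0.
Qed.

Lemma is_derive_cvg_harmonic f a v (D : R) : is_derive a v f D ->
  (fun n => n.+1%:R * (f (n.+1%:R^-1 *: v + a) - f a)) @ \oo --> D.
Proof.
move=> /is_derive_epsP fD; apply/cvgrPdist_lt => e e0.
have [r r0 rP] := fD e e0.
have [N _ NP] := near_infty_natSinv_lt (PosNum r0).
exists N => // n /= /NP nr; rewrite distrC.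
have := rP n.+1%:R^-1; rewrite invrK; apply; first by rewrite invr_neq0.
by rewrite gtr0_norm ?invr_gt0.
Qed.

End directional_derivatives_theory.

Section iterated_partials.
Context {R : realType} {d : nat}.
Implicit Types (f : 'rV[R]_d -> R) (l : seq 'I_d).

Local Notation e_ i := (delta_mx (R := R) (@ord0 0) (i : 'I_d)).

Lemma seq_derivable_partial i l f : seq_derivable (i :: l) f ->
  forall x, is_derive x (e_ i) (foldr partial f l) (foldr partial f (i :: l) x).
Proof. by move=> [_ fd] x; split; [exact: fd|]. Qed.

Lemma seq_derivable_cons i l f (g : 'rV[R]_d -> R) : seq_derivable l f ->
  (forall x, is_derive x (e_ i) (foldr partial f l) (g x)) ->
  seq_derivable (i :: l) f /\ foldr partial f (i :: l) = g.
Proof.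
move=> fl fg; split; first by split=> // x; have [] := fg x.
by apply/funext => x; have [_ <-] := fg x.
Qed.

Lemma foldr_partial_affine l f (c h : R) y : h != 0 -> seq_derivable l f ->
  seq_derivable l (fun x => c * f (h^-1 *: (x - y))) /\
  foldr partial (fun x => c * f (h^-1 *: (x - y))) l =
    (fun x => c * h^-1 ^+ size l * foldr partial f l (h^-1 *: (x - y))).
Proof.
move=> h0; elim: l => [_|i l IH /[dup] fil [fl _]].
  by split=> //; apply/funext => x /=; rewrite mulr1.
have [sl E] := IH fl; apply: seq_derivable_cons => // x; rewrite E.
have := is_derive_affine (c * h^-1 ^+ size l) h0
  (seq_derivable_partial fil (h^-1 *: (x - y))).
by rewrite [size _]/= exprSr; congr is_derive; ring.
Qed.

Lemma foldr_partial_sum n l (f : 'I_n -> 'rV[R]_d -> R) (c : R) :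
  (forall i, seq_derivable l (f i)) ->
  seq_derivable l (fun x => c * \sum_i f i x) /\
  foldr partial (fun x => c * \sum_i f i x) l =
    (fun x => c * \sum_i foldr partial (f i) l x).
Proof.
elim: l => [//|k l IH fkl].
have [sl E] := IH (fun i => (fkl i).1); apply: seq_derivable_cons => // x.
rewrite E.
have fd i := seq_derivable_partial (fkl i) x.
have := is_deriveZ c (is_derive_sum fd).
congr is_derive; first by apply/funext => z; rewrite fct_sumE.
Qed.

(** [catrev l1 l2] cuts a list of derivatives at a moving position: [l2] holds the inner ones, [l1]
    the outer ones starting with the innermost. *)
Lemma seq_derivable_catrev l1 l2 f : seq_derivable (catrev l1 l2) f ->
  seq_derivable l2 f.
Proof. by elim: l1 l2 => //= i l1 IH l2 /IH[]. Qed.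

(* Taking differences, along a list of directions and steps, instead of the
   outer derivatives yields functions bounded by the sup norm of the full
   derivative, whereas the intermediate derivatives may not be integrable. *)
Definition diff_op (p : seq ('I_d * R)) f : 'rV[R]_d -> R :=
  foldr (fun q g x => g (q.2 *: e_ q.1 + x) - g x) f p.

Lemma is_derive_diff_op p f g i :
  (forall x, is_derive x (e_ i) f (g x)) ->
  forall x, is_derive x (e_ i) (diff_op p f) (diff_op p g x).
Proof.
elim: p => [//|[j t] p IH fg x] /=.
have /(_ _)/is_derive_epsP h := IH fg.
apply/is_derive_epsP => e e0.
have e20 : 0 < e / 2 by rewrite divr_gt0.
have [r1 r10 r1P] := h (t *: e_ j + x) _ e20.
have [r2 r20 r2P] := h x _ e20.
exists (Num.min r1 r2) => [|u u0]; first by rewrite lt_min r10.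
rewrite lt_min => /andP[ur1 ur2].
have := ltrD (r1P u u0 ur1) (r2P u u0 ur2); rewrite -splitr.
apply: le_lt_trans; rewrite (addrCA (t *: _)).
apply: le_trans (ler_normB _ _); apply/eqP/eqP; rewrite le_eqVlt.
by apply/orP; left; apply/eqP; congr (`|_|); ring.
Qed.

(** The mean value theorem trades the outermost difference for a derivative; as differences commute
    with derivatives, this one moves inside and becomes the next after [l2]. *)
Lemma diff_op_bound l1 l2 f (M : R) p : [seq q.1 | q <- p] = l1 ->
  seq_derivable (catrev l1 l2) f ->
  (forall x, `|foldr partial f (catrev l1 l2) x| <= M) ->
  forall x, `|diff_op p (foldr partial f l2) x| <= M * \prod_(q <- p) `|q.2|.
Proof.
elim: p l1 l2 => [|[i t] p IH] l1 l2 /= <- fl fM x.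
  by rewrite big_nil mulr1; exact: fM.
rewrite big_cons mulrCA mulrC.
have := @is_derive_bounded _ _ (diff_op p (foldr partial f l2)) (e_ i) x
  (M * \prod_(q <- p) `|q.2|) t (diff_op p (foldr partial f (i :: l2))).
apply.
  apply: is_derive_diff_op; apply: seq_derivable_partial.
  exact: (@seq_derivable_catrev [seq q.1 | q <- p]).
by move=> z; apply: IH.
Qed.

End iterated_partials.

Section partial_integral.
Context {R : realType} {d : nat} {dT : measure_display} {T : measurableType dT}.
Variables (P : probability T R) (phi : T -> 'rV[R]_d -> R).
Variables (F : 'rV[R]_d -> R) (l : seq 'I_d) (M : R).
Hypothesis phi_derivable : forall y, seq_derivable l (phi y).
Hypothesis phi_bound : forall y x, `|foldr partial (phi y) l x| <= M.
Hypothesis phi_integrable : forall x, P.-integrable setT (fun y => (phi y x)%:E).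
Hypothesis FE : forall x, (F x)%:E = (\int[P]_y (phi y x)%:E)%E.
Hypothesis F_derivable : seq_derivable l F.

(** With no derivative left the claim is linearity. Otherwise the outermost derivative of [l2] is
    the limit of n+1 times a difference of step 1/(n+1), which lengthens [p]; these quotients stay
    below [M] times the product of the remaining steps, so dominated convergence applies. [F] is
    derivable by hypothesis, so only the value of its derivative is to be identified. *)
Let diff_op_integral l2 l1 p : catrev l1 l2 = l -> [seq q.1 | q <- p] = l1 ->
  forall x, P.-integrable setT
      (fun y => (diff_op p (foldr partial (phi y) l2) x)%:E) /\
    (diff_op p (foldr partial F l2) x)%:E =
      (\int[P]_y (diff_op p (foldr partial (phi y) l2) x)%:E)%E.
Proof.
elim: l2 l1 p => [l1 p _ _|i l2 IH l1 p l12 p1 x].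
  elim: p => [x|[i t] p IH x] /=; first by split.
  have [[i1 e1] [i2 e2]] := (IH (t *: delta_mx ord0 i + x), IH x).
  under eq_fun do rewrite EFinB; split; first exact: integrableB.
  by rewrite integralB_EFin// EFinB e1 e2.
pose t (n : nat) : R := n.+1%:R^-1.
pose p_ n := (i, t n) :: p.
have p_1 n : [seq q.1 | q <- p_ n] = i :: l1 by rewrite /= p1.
have bound n y z : `|n.+1%:R * diff_op (p_ n) (foldr partial (phi y) l2) z| <=
    M * \prod_(q <- p) `|q.2|.
  have := @diff_op_bound _ _ (i :: l1) l2 (phi y) M (p_ n) (p_1 n).
  rewrite [catrev _ _]l12 => /(_ (phi_derivable y) (phi_bound y) z).
  rewrite big_cons/= normrM [`|_.+1%:R|]ger0_norm//.
  rewrite [`|t n|]ger0_norm ?invr_ge0// mulrCA ler_pdivlMl//.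
have cvgE f z : seq_derivable (i :: l2) f ->
    (fun n => n.+1%:R * diff_op (p_ n) (foldr partial f l2) z) @ \oo -->
    diff_op p (foldr partial f (i :: l2)) z.
  move=> fl; have fd := is_derive_diff_op p (seq_derivable_partial fl) z.
  exact: (is_derive_cvg_harmonic fd).
have dF : seq_derivable (i :: l2) F.
  by apply: (@seq_derivable_catrev _ _ l1); rewrite l12.
have dphi y : seq_derivable (i :: l2) (phi y).
  by apply: (@seq_derivable_catrev _ _ l1); rewrite l12.
have IHn n z := IH (i :: l1) (p_ n) l12 (p_1 n) z.
pose f_ n y := (n.+1%:R * diff_op (p_ n) (foldr partial (phi y) l2) x)%:E.
have if_ n : P.-integrable setT (f_ n).
  rewrite /f_; under eq_fun do rewrite EFinM.
  by apply: integrableZl => //; exact: (IHn n x).1.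
have mf_ n : measurable_fun setT (f_ n) by have /integrableP[] := if_ n.
have mf : measurable_fun setT
    (fun y => (diff_op p (foldr partial (phi y) (i :: l2)) x)%:E).
  apply/measurable_EFinP; apply: (@measurable_fun_cvg _ _ _ _
    (fun n y => n.+1%:R * diff_op (p_ n) (foldr partial (phi y) l2) x)).
    by move=> n; apply/measurable_EFinP; exact: mf_.
  by move=> y _; exact: cvgE.
have ibound : P.-integrable setT (fun _ : T => (M * \prod_(q <- p) `|q.2|)%:E).
  exact: (bounded_integrable P (f := cst (M * \prod_(q <- p) `|q.2|))
    (B := `|M * \prod_(q <- p) `|q.2| |)).
have [ilim _ cint] : [/\ P.-integrable setT
      (fun y => (diff_op p (foldr partial (phi y) (i :: l2)) x)%:E),
    [sequence (\int[P]_y `|f_ n y -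
      (diff_op p (foldr partial (phi y) (i :: l2)) x)%:E|)%E]_n @ \oo --> 0%E &
    [sequence (\int[P]_y f_ n y)%E]_n @ \oo -->
      (\int[P]_y (diff_op p (foldr partial (phi y) (i :: l2)) x)%:E)%E].
  apply: (dominated_convergence _ mf_ mf _ ibound) => //.
    apply: aeW => y _; apply: cvg_EFin; first exact: nearW.
    exact: cvgE.
  by apply: aeW => y n _; rewrite lee_fin; exact: bound.
split=> //; apply/esym.
have cF : [sequence (\int[P]_y f_ n y)%E]_n @ \oo -->
    (diff_op p (foldr partial F (i :: l2)) x)%:E.
  rewrite (_ : [sequence _]_n = (fun n =>
      (n.+1%:R * diff_op (p_ n) (foldr partial F l2) x)%:E)).
    by apply: cvg_EFin; [exact: nearW|exact: cvgE].
  apply/funext => n /=; rewrite /f_; under eq_integral do rewrite EFinM.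
  rewrite integralZl//; last exact: (IHn n x).1.
  by rewrite EFinM (IHn n x).2.
exact: (cvg_unique _ cint cF).
Qed.

Lemma foldr_partial_integral x :
  (foldr partial F l x)%:E = (\int[P]_y (foldr partial (phi y) l x)%:E)%E.
Proof. by have [] := @diff_op_integral l [::] [::] erefl erefl x. Qed.

End partial_integral.

(** * Second moments and the volume dimension *)

Section enorm.
Context {R : realType} {d : nat}.
Local Notation T := 'rV[R]_d.

Lemma measurable_enorm (x : T) : measurable_fun setT (fun y : T => enorm (y - x)).
Proof.
have msqrt : measurable_fun setT (@Num.sqrt R).
  by apply: nondecreasing_measurable => // a b; exact: ler_wsqrtr.
apply: (measurableT_comp msqrt).
apply: measurable_sum => i; apply: measurable_funX.
under eq_fun do rewrite !mxE; apply: measurable_funB => //.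
exact: measurable_coord_rV.
Qed.

Lemma measurable_eball (x : T) (r : R) : measurable (eball x r).
Proof.
have -> : eball x r = (fun y => enorm (y - x)) @^-1` `]-oo, r[.
  by apply/seteqP; split=> y /=; rewrite in_itv.
by rewrite -[X in measurable X]setTI; apply: measurable_enorm.
Qed.

Lemma enormZ (c : R) (x : T) : enorm (c *: x) = `|c| * enorm x.
Proof.
rewrite /enorm -sqrtr_sqr -sqrtrM ?sqr_ge0//; congr Num.sqrt.
by rewrite mulr_sumr; apply: eq_bigr => i _; rewrite mxE exprMn.
Qed.

Lemma enormB (x y : T) : enorm (x - y) = enorm (y - x).
Proof. by rewrite -opprB -scaleN1r enormZ normrN normr1 mul1r. Qed.

Lemma enorm_surj (t : R) : (0 < d)%N -> exists x : T, t <= enorm x.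
Proof.
move=> d0; exists (t *: delta_mx ord0 (Ordinal d0)).
rewrite enormZ (_ : enorm _ = 1) ?mulr1 ?ler_norm//.
rewrite /enorm (bigD1 (Ordinal d0))//= big1 => [|i id0].
  by rewrite mxE !eqxx addr0 expr1n sqrtr1.
by rewrite mxE (negbTE id0) andbF expr0n.
Qed.

End enorm.

Section second_moment.
Context {R : realType} {d : nat}.
Local Notation T := 'rV[R]_d.
Variables (X : set T) (P : probability T R).

(** For r < 1 the exponent may be lowered from [nu] to [e]; for the other radii [P] is at most 1,
    which the factor rho^-e compensates. *)
Lemma ball_measure_le (nu e : R) : (vol_limsup X P nu < +oo)%E ->
  0 <= e <= nu -> exists2 c, 0 <= c &
    forall x r, X x -> 0 < r -> (P (eball x r) <= (c * r `^ e)%:E)%E.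
Proof.
move=> /ereal_inf_lt[_ [A A0 <-] supA] /andP[e0 enu].
have /nbhs_ballP[r0 /= r00 r0A] : nbhs (0 : R) [set r | 0 < r -> A r] by exact: A0.
pose rho := Num.min r0 1 / 2.
have m0 : 0 < Num.min r0 1 by rewrite lt_min r00 ltr01.
have rho0 : 0 < rho by rewrite divr_gt0.
set S := ereal_sup _ in supA.
(* [S] is -oo when [X] is empty; the truncation makes it a nonnegative real. *)
pose b := fine (maxe S 0).
have bS : (S <= b%:E)%E.
  rewrite /b fineK ?le_max ?lexx//.
  rewrite ge0_fin_numE ?le_max ?lexx ?orbT// gt_max supA/=.
  exact: ltry.
have b0 : 0 <= b by rewrite fine_ge0// le_max lexx orbT.
exists (Num.max b (rho `^ (- e))) => [|x r Xx r1]; first by rewrite le_max b0.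
have re0 : 0 <= r `^ e by exact: powR_ge0.
have [rr|rr] := ltP r (Num.min r0 1); last first.
  apply: (@le_trans _ _ 1%E); first by apply: probability_le1; exact: measurable_eball.
  rewrite lee_fin; apply: (@le_trans _ _ (rho `^ (- e) * r `^ e)).
    rewrite powRN mulrC ler_pdivlMr ?powR_gt0// mul1r.
    apply: ge0_ler_powR => //; rewrite ?nnegrE ?(ltW rho0) ?(ltW r1)//.
    by apply: le_trans rr; rewrite /rho; lra.
  by rewrite ler_wpM2r// le_max lexx orbT.
move: rr; rewrite lt_min => /andP[rr0 rr1].
have Ar : A r by apply: r0A => //=; rewrite /ball/= sub0r normrN gtr0_norm.
have h : (P (eball x r) * ((r `^ nu)^-1)%:E <= b%:E)%E.
  apply: le_trans bS; apply: (@le_trans _ _ (ereal_sup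
    [set (P (eball x r) * ((r `^ nu)^-1)%:E)%E | x in X])).
    by apply: ereal_sup_ubound; exists x.
  by apply: ereal_sup_ubound; exists r.
have mb := measurable_eball x r.
rewrite -[P _]fineK ?fin_num_measure// in h *.
move: h; rewrite -EFinM !lee_fin ler_pdivrMr ?powR_gt0// => h.
apply: (le_trans h); apply: (@le_trans _ _ (b * r `^ e)).
  by rewrite ler_wpM2l//; apply: ger_powR => //; rewrite r1 ltW.
by rewrite ler_wpM2r// le_max lexx.
Qed.

Lemma volume_dim_ge0 (dvol : R) : volume_dim X P = dvol%:E -> 0 <= dvol.
Proof.
move=> dv; rewrite -lee_fin -dv leNgt; apply/negP => vneg.
have : volume_dim X P != -oo%E by rewrite dv.
apply/negP; rewrite negbK -leeNy_eq; apply: ge_ereal_sup => _ [nu [nu0 nuP] <-].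
exfalso; move: vneg; apply/negP; rewrite -leNgt.
apply: (@le_trans _ _ nu%:E); first by rewrite lee_fin.
by apply: ereal_sup_ubound; exists nu.
Qed.

Lemma volume_dim_ball_measure_le (dvol eps : R) : volume_dim X P = dvol%:E ->
  0 < eps < dvol \/ (eps = 0 /\ (dvol = 0 \/ (vol_limsup X P dvol < +oo)%E)) ->
  0 <= dvol - eps /\ (0 < dvol - eps -> exists2 c, 0 <= c &
    forall x r, X x -> 0 < r -> (P (eball x r) <= (c * r `^ (dvol - eps))%:E)%E).
Proof.
move=> dv H; have dvol0 := volume_dim_ge0 dv.
case: H => [/andP[eps0 epsd]|[-> H]].
  split=> [|e0]; first by rewrite subr_ge0 ltW.
  have : ((dvol - eps)%:E < volume_dim X P)%E by rewrite dv lte_fin; lra.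
  move=> /ereal_sup_gt[_ [nu [nu0 nuP] <-]]; rewrite lte_fin => enu.
  by apply: (ball_measure_le nuP); rewrite !ltW.
rewrite subr0; split=> // d0; case: H => [d00|dP]; first by rewrite d00 ltxx in d0.
by apply: (ball_measure_le dP); rewrite dvol0 lexx.
Qed.

Variables (D : T -> R) (M : R).
Hypotheses (d0 : (0 < d)%N) (mD : measurable_fun setT D).
Hypothesis DM : forall x, `|D x| <= M.

Let M0 : 0 <= M := le_trans (normr_ge0 _) (DM 0).

Let D2M x : D x ^+ 2 <= M ^+ 2.
Proof. by rewrite -(real_normK (num_real (D x))) lerXn2r ?nnegrE. Qed.

Let D2 x := D x ^+ 2.
Let tau t := fine (tail_sup D2 t).

(** Since d > 0 the norm is unbounded, so no tail is empty and the supremum is never -oo. *)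
Let tauE t : tail_sup D2 t = (tau t)%:E.
Proof.
rewrite /tau fineK// fin_numElt; apply/andP; split.
  have [x tx] := @enorm_surj R d t d0.
  apply: (@lt_le_trans _ _ (D2 x)%:E); first exact: ltNyr.
  by apply: ereal_sup_ubound; exists x.
apply: (@le_lt_trans _ _ (M ^+ 2)%:E); last exact: ltry.
by apply: ge_ereal_sup => _ [x _ <-]; rewrite lee_fin; exact: D2M.
Qed.

Let D2_tau t x : t <= enorm x -> D2 x <= tau t.
Proof. by move=> tx; rewrite -lee_fin -tauE; apply: ereal_sup_ubound; exists x. Qed.

Let tau_ge0 t : 0 <= tau t.
Proof.
have [x tx] := @enorm_surj R d t d0.
by apply: le_trans (D2_tau tx); exact: sqr_ge0.
Qed.

Let tau_nincr : nonincreasing_fun tau.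
Proof.
move=> s t st; rewrite -lee_fin -!tauE; apply: ereal_sup_le => _ [x tx <-].
by exists x => //=; exact: le_trans tx.
Qed.

(** Cauchy condensation: on the dyadic interval ending at 2^k, [tau] is at least its value at 2^k
    and t^(q-1) is comparable to (2^k)^(q-1), with a constant [kap] that depends on the sign of q -
    1. *)
Lemma tail_dyadic_sum (q : R) :
  (\int[@lebesgue_measure R]_(t in `]0%R, +oo[)
     ((t `^ (q - 1))%:E * tail_sup D2 t) < +oo)%E ->
  exists S, forall N, \sum_(k < N) tau (2 ^+ k) * (2 ^+ k) `^ q <= S.
Proof.
set f := fun t => (t `^ (q - 1) * tau t).
under eq_integral do rewrite tauE -EFinM -/(f _).
have mf (A : set R) : measurable_fun A (fun t => (f t)%:E).
  apply/measurable_EFinP; apply: measurable_funTS; apply: measurable_funM.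
    exact: measurable_powR.
  exact: nonincreasing_measurable.
have f0 t : 0 <= f t by rewrite mulr_ge0 ?powR_ge0.
set I := (\int[_]_(t in _) _)%E => Ioo.
have [kap kap0 kapP] : exists2 kap, 0 < kap & forall k (t : R),
    2 ^+ k / 2 < t <= 2 ^+ k -> kap * (2 ^+ k) `^ (q - 1) <= t `^ (q - 1).
  have [q1|q1] := leP 1 q.
    exists (2^-1 `^ (q - 1)) => [|k t /andP[t1 t2]]; first exact: powR_gt0.
    have k20 : 0 <= 2 ^+ k / 2 :> R by rewrite divr_ge0.
    rewrite mulrC -powRM//; apply: ge0_ler_powR; rewrite ?nnegrE ?subr_ge0//.
      by apply: ltW; apply: le_lt_trans t1.
    exact: ltW.
  exists 1 => // k t /andP[t1 t2]; rewrite mul1r.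
  have t0 : 0 < t by apply: lt_trans t1; rewrite divr_gt0.
  rewrite -(opprK (q - 1)) !(powRN _ (- (q - 1))).
  rewrite lef_pV2 ?posrE ?powR_gt0//; apply: ge0_ler_powR => //.
  - by rewrite opprB subr_ge0 ltW.
  - by rewrite nnegrE ltW.
  - by rewrite nnegrE exprn_ge0.
pose J N := (\int[@lebesgue_measure R]_(t in `](2^-1)%R, (2 ^+ N / 2)%R]) (f t)%:E)%E.
have JI N : (J N <= I)%E.
  apply: ge0_subset_integral => //; [exact: mf|..].
  - by move=> t _; rewrite lee_fin.
  - move=> t /=; rewrite !in_itv/= andbT => /andP[t1 _].
    by apply: lt_trans t1; rewrite invr_gt0.
have JS N : (J N + (kap / 2 * (tau (2 ^+ N) * (2 ^+ N) `^ q))%:E <= J N.+1)%E.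
  have p1 : 1 <= 2 ^+ N :> R by rewrite exprn_ege1// ler1n.
  have hN : 2^-1 <= 2 ^+ N / 2 :> R by rewrite ler_pdivlMr// mulVf.
  have hN2 : 2 ^+ N / 2 <= 2 ^+ N.+1 / 2 :> R.
    by rewrite ler_pM2r// exprS ler_peMl ?ler1n.
  rewrite /J [in leRHS](@itv_bndbnd_setU _ _ _ (BRight (2 ^+ N / 2))) ?bnd_simp//.
  rewrite [leRHS]ge0_integral_setU//; last 3 first.
  - exact: mf.
  - by move=> t _; rewrite lee_fin.
  - apply/disj_setPS => t []/=; rewrite !in_itv/= => /andP[_ h1] /andP[h2 _].
    by move: (lt_le_trans h2 h1); rewrite ltxx.
  apply: leeD => //.
  have E : 2 ^+ N.+1 / 2 = 2 ^+ N :> R by rewrite exprS mulrC mulrA mulVf// mul1r.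
  rewrite E; pose c := kap * (2 ^+ N) `^ (q - 1) * tau (2 ^+ N).
  have c0 : 0 <= c by rewrite !mulr_ge0 ?powR_ge0// ltW.
  apply: (@le_trans _ _ (\int[@lebesgue_measure R]_(t in `](2 ^+ N / 2)%R, (2 ^+ N)%R])
      (cst c%:E t))%E); last first.
    apply: ge0_le_integral => //; first exact: mf.
    - by move=> t /=; rewrite in_itv/= => tN; rewrite lee_fin /c /f ler_pM//
        ?mulr_ge0 ?powR_ge0 ?(ltW kap0)//; [exact: kapP|
        apply: tau_nincr; case/andP: tN].
  have len : lebesgue_measure (`](2 ^+ N / 2), (2 ^+ N)]%classic : set R) =
      (2 ^+ N / 2)%:E.
    rewrite lebesgue_measure_itv/= lte_fin ltr_pdivrMr// ltr_pMr ?exprn_gt0//.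
    by rewrite ltr1n -EFinB; congr EFin; field.
  rewrite integral_cst// [X in (_ * X)%E]len.
  rewrite -EFinM lee_fin /c le_eqVlt; apply/orP; left; apply/eqP.
  have -> : (2 ^+ N) `^ q = (2 ^+ N) `^ (q - 1) * 2 ^+ N :> R.
    rewrite -[X in _ = _ * X]powRr1 ?exprn_ge0// -powRD ?subrK//.
    by apply/implyP => _; rewrite expf_neq0.
  by field.
have sumJ N : ((kap / 2 * \sum_(k < N) tau (2 ^+ k) * (2 ^+ k) `^ q)%:E <= J N)%E.
  elim: N => [|N IH].
    rewrite big_ord0 mulr0; apply: integral_ge0 => t _; by rewrite lee_fin.
  rewrite big_ord_recr/= mulrDr EFinD; apply: le_trans (JS N).
  exact: leeD.
have I0 : (0 <= I)%E by apply: integral_ge0 => t _; rewrite lee_fin.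
have IE : I = (fine I)%:E by rewrite fineK// ge0_fin_numE.
exists ((kap / 2)^-1 * fine I) => N.
rewrite -ler_pdivrMl ?invr_gt0 ?divr_gt0// invrK -lee_fin -IE.
exact: le_trans (sumJ N) (JI N).
Qed.

(** The space is cut into dyadic shells of radii 2^k h around x, on which the squared derivative is
    at most tau(2^k) and whose mass is at most that of a ball of radius 2^(k+1) h. The sum over the
    shells converges by condensation of hypothesis (ii), at the exponent d_vol and hence at the
    smaller exponent e. *)
Lemma second_moment_bound_exists (dvol eps : R) : volume_dim X P = dvol%:E ->
  (\int[@lebesgue_measure R]_(t in `]0%R, +oo[)
     ((t `^ (dvol - 1))%:E * tail_sup D2 t) < +oo)%E ->
  0 < eps < dvol \/ (eps = 0 /\ (dvol = 0 \/ (vol_limsup X P dvol < +oo)%E)) ->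
  exists c, second_moment_bound D X P (dvol - eps) c.
Proof.
move=> dv tail H; have eps0 : 0 <= eps by case: H => [/andP[/ltW]|[->]].
have [e0 ballP] := volume_dim_ball_measure_le dv H.
have mDr x h : measurable_fun setT (fun y => rescaled D x h y ^+ 2).
  by apply: measurable_funX; exact: measurable_rescaled.
have [ez|e1] := leP (dvol - eps) 0.
  have -> : dvol - eps = 0 by apply/eqP; rewrite eq_le ez.
  exists (M ^+ 2) => x h Xx h0; rewrite powRr0 mulr1 unlock.
  rewrite -[leRHS]mule1 -(probability_setT P) -integral_cst//.
  apply: ge0_le_integral => //.
  - by move=> y _; rewrite lee_fin sqr_ge0.
  - exact/measurable_EFinP.
  - by move=> y _; rewrite lee_fin; exact: D2M.
have [c c0 cP] := ballP e1; set e := dvol - eps in e0 e1 cP *.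
have [S SP] := tail_dyadic_sum tail.
have p0 k : 0 < 2 ^+ k :> R by rewrite exprn_gt0.
have p1 k : 1 <= 2 ^+ k :> R by rewrite exprn_ege1// ler1n.
have SPe N : \sum_(k < N) tau (2 ^+ k) * (2 ^+ k) `^ e <= S.
  apply: le_trans (SP N); apply: ler_sum => k _; rewrite ler_wpM2l//.
  by apply: ler_powR; rewrite ?p1// /e; lra.
exists ((M ^+ 2 + 2 `^ e * S) * c) => x h Xx h0; rewrite unlock.
have he0 : 0 < h `^ e by rewrite powR_gt0.
(* Finitely many shells are used, with the constant tau(2^N) beyond them; it tends to 0 because
   tau(2^N) (2^N)^e is at most [S] and e > 0. *)
have bound N : (\int[P]_y (rescaled D x h y ^+ 2)%:E <=
    ((M ^+ 2 + 2 `^ e * S) * c * h `^ e + tau (2 ^+ N))%:E)%E.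
  pose g y : R := M ^+ 2 * \1_(eball x h) y +
    \sum_(k < N) tau (2 ^+ k) * \1_(eball x (2 ^+ k.+1 * h)) y + tau (2 ^+ N).
  have ind0 (A : set T) y : 0 <= \1_A y :> R by rewrite indicE.
  have sum0 n y : 0 <= \sum_(k < n) tau (2 ^+ k) * \1_(eball x (2 ^+ k.+1 * h)) y.
    by apply: sumr_ge0 => k _; rewrite mulr_ge0.
  have M2ind y : 0 <= M ^+ 2 * \1_(eball x h) y by rewrite mulr_ge0// sqr_ge0.
  have gP y : rescaled D x h y ^+ 2 <= g y.
    have rho : enorm (h^-1 *: (x - y)) = enorm (y - x) / h.
      by rewrite enormZ gtr0_norm ?invr_gt0// enormB mulrC.
    have near n : enorm (y - x) / h < 2 ^+ n -> rescaled D x h y ^+ 2 <=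
        M ^+ 2 * \1_(eball x h) y +
        \sum_(k < n) tau (2 ^+ k) * \1_(eball x (2 ^+ k.+1 * h)) y.
      elim: n => [|n IH] yn.
        rewrite big_ord0 addr0 indicE mem_set ?mulr1; first exact: D2M.
        by move: yn; rewrite expr0 ltr_pdivrMr// mul1r.
      have [far|yn'] := leP (2 ^+ n) (enorm (y - x) / h); last first.
        apply: (le_trans (IH yn')); rewrite lerD2l big_ord_recr/= lerDl.
        by rewrite mulr_ge0.
      rewrite big_ord_recr/= addrA -[leLHS]add0r; apply: lerD.
        exact: addr_ge0 (M2ind y) (sum0 n y).
      rewrite indicE mem_set ?mulr1; first by apply: D2_tau; rewrite rho.
      by move: yn; rewrite ltr_pdivrMr.
    have [far|yN] := leP (2 ^+ N) (enorm (y - x) / h).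
      rewrite -[leLHS]add0r; apply: lerD; first exact: addr_ge0 (M2ind y) (sum0 N y).
      by apply: D2_tau; rewrite rho.
    by rewrite /g -[leLHS]addr0; exact: lerD (near N yN) (tau_ge0 _).
  have mi r : measurable_fun setT (\1_(eball x r) : T -> R).
    by apply: measurable_indic; exact: measurable_eball.
  have mcr (a : R) r : measurable_fun setT (fun y : T => a * \1_(eball x r) y).
    exact: measurable_funM.
  have iball (a r : R) : 0 <= a ->
      (\int[P]_y (a * \1_(eball x r) y)%:E = a%:E * P (eball x r))%E.
    move=> a0; under eq_integral do rewrite EFinM.
    rewrite ge0_integralZl//.
    - by rewrite integral_indic ?setIT//; exact: measurable_eball.
    - exact/measurable_EFinP.
  have msum : measurable_fun setT (fun y =>
      \sum_(k < N) tau (2 ^+ k) * \1_(eball x (2 ^+ k.+1 * h)) y).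
    by apply: measurable_sum => k.
  apply: (@le_trans _ _ (\int[P]_y (g y)%:E)%E).
    apply: ge0_le_integral => //.
    - by move=> y _; rewrite lee_fin sqr_ge0.
    - exact/measurable_EFinP.
    - apply/measurable_EFinP; apply: measurable_funD => //.
      exact: measurable_funD.
    - by move=> y _; rewrite lee_fin.
  rewrite /g; under eq_integral do rewrite !EFinD.
  rewrite ge0_integralD//; last 3 first.
  - by move=> y _; rewrite adde_ge0// lee_fin// mulr_ge0// sqr_ge0.
  - by apply/measurable_EFinP; exact: measurable_funD.
  - by move=> y _; rewrite lee_fin.
  rewrite [in leRHS]EFinD; apply: leeD; last first.
    by rewrite integral_cst// [X in (_ * X)%E](probability_setT P) mule1.
  rewrite ge0_integralD//; last 4 first.
  - by move=> y _; rewrite lee_fin mulr_ge0// sqr_ge0.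
  - exact/measurable_EFinP.
  - by move=> y _; rewrite lee_fin.
  - exact/measurable_EFinP.
  rewrite iball ?sqr_ge0//.
  under [X in (_ + X)%E]eq_integral do rewrite -sumEFin.
  rewrite ge0_integral_sum//; last 2 first.
  - by move=> k; exact/measurable_EFinP.
  - by move=> k y _; rewrite lee_fin mulr_ge0.
  apply: (@le_trans _ _ ((M ^+ 2)%:E * (c * h `^ e)%:E +
      \sum_(k < N) (tau (2 ^+ k) * (c * (2 ^+ k.+1 * h) `^ e))%:E)%E).
    apply: leeD; first by rewrite lee_wpmul2l ?cP// lee_fin sqr_ge0.
    apply: lee_sum => k _; rewrite iball// [leRHS]EFinM.
    by rewrite lee_wpmul2l ?lee_fin// cP// mulr_gt0.
  rewrite sumEFin -EFinM -EFinD lee_fin.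
  have -> : \sum_(k < N) tau (2 ^+ k) * (c * (2 ^+ k.+1 * h) `^ e) =
      2 `^ e * c * h `^ e * \sum_(k < N) tau (2 ^+ k) * (2 ^+ k) `^ e.
    rewrite mulr_sumr; apply: eq_bigr => k _.
    by rewrite exprS !powRM ?mulr_ge0 ?exprn_ge0 ?(ltW h0)//; ring.
  have : 2 `^ e * c * h `^ e * \sum_(k < N) tau (2 ^+ k) * (2 ^+ k) `^ e <=
      2 `^ e * c * h `^ e * S.
    by rewrite ler_wpM2l// !mulr_ge0 ?powR_ge0.
  lra.
apply/lee_addgt0Pr => eta eta0.
have S0 : 0 <= S by have := SP 0%N; rewrite big_ord0.
pose L := (S / eta + 1) `^ e^-1.
have [N NL] : exists N, L <= 2 ^+ N.
  exists (truncn L).+1; apply: le_trans (ltW (truncnS_gt _)) _.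
  by rewrite -natrX ler_nat; exact/ltnW/ltn_expl.
apply: (le_trans (bound N)); rewrite EFinD; apply: leeD => //.
rewrite lee_fin.
have Se0 : 0 < S / eta + 1 by rewrite ltr_wpDl// divr_ge0// ltW.
have h1 : S / eta + 1 <= (2 ^+ N) `^ e.
  have -> : S / eta + 1 = L `^ e by rewrite /L -powRrM mulVf ?gt_eqF// powRr1// ltW.
  by apply: ge0_ler_powR; rewrite ?nnegrE ?powR_ge0// ltW.
have h2 : tau (2 ^+ N) * (2 ^+ N) `^ e <= S.
  apply: le_trans (SPe N.+1); rewrite big_ord_recr/= lerDr.
  by apply: sumr_ge0 => k _; rewrite mulr_ge0 ?powR_ge0.
have h3 : tau (2 ^+ N) * (S / eta + 1) <= S.
  by apply: le_trans h2; rewrite ler_wpM2l.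
have h4 : tau (2 ^+ N) * (S + eta) <= S * eta.
  move: h3; rewrite -(ler_pM2r eta0) -mulrA.
  by rewrite mulrDl mulfVK ?gt_eqF// mul1r.
by rewrite -(@ler_pM2r _ (S + eta)) ?ltr_wpDl//; nra.
Qed.

End second_moment.

(** * The deviation bound *)

Section constants.
Context {R : realType}.

Lemma ln2_ge : 2^-1 <= ln 2 :> R.
Proof.
have : ln (1 + - 2^-1) <= - 2^-1 :> R by apply: le_ln1Dx; lra.
rewrite (_ : 1 + - 2^-1 = 2^-1); last by field.
by rewrite lnV ?posrE// lerN2.
Qed.

Lemma sqrtD_le (a b : R) : 0 <= a -> 0 <= b ->
  Num.sqrt (a + b) <= Num.sqrt a + Num.sqrt b.
Proof.
move=> a0 b0; have ab : 0 <= Num.sqrt a + Num.sqrt b by rewrite addr_ge0 ?sqrtr_ge0.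
rewrite -[leRHS](ger0_norm ab) -sqrtr_sqr ler_wsqrtr// sqrrD !sqr_sqrtr//.
have : 0 <= Num.sqrt a * Num.sqrt b by rewrite mulr_ge0 ?sqrtr_ge0.
by lra.
Qed.

(** The three summands bound, in units of [log_scale], the logarithms of 6(A+1)M, of the powers of 2
    of the chain, and of the inverse of the starting radius. The factor [nu + 2] is the exponent in
    [rescaled_cover]. *)
Definition entropy_const (A M nu e : R) : R :=
  (nu + 2) * (ln (Num.max 1 (6 * (A + 1) * M)) / ln 2 + 1 + e / 2).

(** 10 is the chaining threshold 5 doubled by symmetrization. The other factors are those of
    [chain_slope] and of the two summands of [chain_radius], freed from l, n and the logarithms. *)
Definition deviation_const (A M nu e c : R) : R :=
  10 * Num.sqrt (320 * (2 * entropy_const A M nu e + 6)) *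
  (Num.sqrt (150 * Num.max c 1) +
   Num.sqrt (16 * (4 * entropy_const A M nu e + 4)) * Num.max M 1).

Variables (A M nu e c l delta : R) (n : nat).
Hypotheses (nu0 : 0 < nu) (e0 : 0 <= e) (l0 : 0 < l).
Hypotheses (delta0 : 0 < delta) (delta1 : delta < 1) (n0 : (0 < n)%N).

Definition log_scale : R := Num.max (ln l^-1) 0 + ln (2 / delta).

(** The maximum with 1 keeps the starting radius above l^(e/2), so that its logarithm is controlled
    by that of l even when c is tiny. *)
Definition variance_proxy : R := Num.max c 1 * l `^ e.

Let H := entropy_const A M nu e.

(** Its square is the sum of the two lower bounds that [weight_swap_sup] requires of tau^2. *)
Definition chain_radius : R := Num.sqrt (150 * variance_proxy +
  16 * (4 * H + 4) * Num.max M 1 ^+ 2 * log_scale / n%:R).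

Definition chain_slope : R := Num.sqrt (320 * (2 * H + 6) * log_scale / n%:R).

Lemma entropy_const_ge0 : 0 <= H.
Proof.
have ln20 : 0 < ln 2 :> R by apply: lt_le_trans ln2_ge.
rewrite /H /entropy_const mulr_ge0//; first by rewrite addr_ge0// ltW.
have lnB : 0 <= ln (Num.max 1 (6 * (A + 1) * M)) by rewrite ln_ge0// le_max lexx.
by rewrite addr_ge0 ?divr_ge0// addr_ge0// divr_ge0// ltW.
Qed.

Lemma log_confidence_ge : ln 2 <= ln (2 / delta).
Proof.
by rewrite ler_ln ?posrE ?divr_gt0// ler_pdivlMr// ler_piMr// ltW.
Qed.

Lemma log_scale_ge : ln 2 <= log_scale.
Proof.
rewrite /log_scale; have := log_confidence_ge.
have : 0 <= Num.max (ln l^-1) 0 by rewrite le_max lexx orbT.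
lra.
Qed.

Lemma log_scale_gt0 : 0 < log_scale.
Proof. by apply: lt_le_trans log_scale_ge; apply: lt_le_trans ln2_ge. Qed.

Lemma expR_log_scale : expR (- log_scale) <= delta / 2.
Proof.
have d2 : 0 < 2 / delta by rewrite divr_gt0.
rewrite -[leRHS]invrK invf_div -[X in _ <= X^-1](lnK d2)// -expRN ler_expR lerN2.
by rewrite /log_scale lerDr le_max lexx orbT.
Qed.

Lemma variance_proxy_gt0 : 0 < variance_proxy.
Proof. by rewrite mulr_gt0 ?powR_gt0// lt_max ltr01 orbT. Qed.

Let nR0 : 0 < n%:R :> R. Proof. by rewrite ltr0n. Qed.

Let tail_ge0 : 0 <= 16 * (4 * H + 4) * Num.max M 1 ^+ 2 * log_scale / n%:R.
Proof.
have := entropy_const_ge0; have := log_scale_gt0 => L0 h0.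
by rewrite divr_ge0 ?ler0n// mulr_ge0 ?(ltW L0)// mulr_ge0 ?sqr_ge0//; lra.
Qed.

Lemma chain_radius_sqr : chain_radius ^+ 2 = 150 * variance_proxy +
  16 * (4 * H + 4) * Num.max M 1 ^+ 2 * log_scale / n%:R.
Proof.
by rewrite sqr_sqrtr// addr_ge0// mulr_ge0// ltW// variance_proxy_gt0.
Qed.

Lemma chain_radius_gt0 : 0 < chain_radius.
Proof.
rewrite sqrtr_gt0; have := variance_proxy_gt0; have := tail_ge0; lra.
Qed.

Lemma chain_slope_sqr : n%:R * chain_slope ^+ 2 = 320 * (2 * H + 6) * log_scale.
Proof.
have h0 := entropy_const_ge0; have L0 := log_scale_gt0.
rewrite sqr_sqrtr; first by rewrite mulrCA divff ?mulr1// lt0r_neq0.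
by rewrite divr_ge0// mulr_ge0 ?(ltW L0)//; lra.
Qed.

Lemma chain_slope_gt0 : 0 < chain_slope.
Proof.
have h0 := entropy_const_ge0; have L0 := log_scale_gt0.
by rewrite sqrtr_gt0 divr_gt0// mulr_gt0//; lra.
Qed.

(** The condition of [iid_deviation]; it holds since the squared radius exceeds 150 times the
    variance and n times the squared slope is at least 1. *)
Lemma chain_deviation_ge :
  4 * variance_proxy <= n%:R * (5 * (chain_radius * chain_slope)) ^+ 2.
Proof.
rewrite (_ : n%:R * _ = 25 * chain_radius ^+ 2 * (n%:R * chain_slope ^+ 2));
  last by ring.
rewrite chain_slope_sqr chain_radius_sqr.
have L2 : 2^-1 <= log_scale := le_trans ln2_ge log_scale_ge.
have h0 := entropy_const_ge0; have s0 := variance_proxy_gt0.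
have HL : 0 <= H * log_scale by rewrite mulr_ge0//; lra.
have : 1 <= 320 * (2 * H + 6) * log_scale by lra.
set a := 320 * _ * _ => a1; have := tail_ge0; set q := 16 * _ * _ * _ / _ => q0.
have : 25 * (150 * variance_proxy + q) * 1 <= 25 * (150 * variance_proxy + q) * a.
  by rewrite ler_wpM2l//; lra.
by lra.
Qed.

Lemma cover_size_le k :
  Num.max 1 (6 * (A + 1) * M / (chain_radius / 2 ^+ k)) `^ (nu + 2) <=
  expR (k.+1%:R * (H * log_scale)).
Proof.
have L0 := log_scale_gt0; have r0 := chain_radius_gt0.
have ln20 : 0 < ln 2 :> R by apply: lt_le_trans ln2_ge.
have nu2 : 0 <= nu + 2 by rewrite addr_ge0// ltW.
set B := 6 * (A + 1) * M; pose B1 := Num.max 1 B.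
pose beta := ln B1 / ln 2.
have B11 : 1 <= B1 by rewrite le_max lexx.
have beta0 : 0 <= beta := divr_ge0 (ln_ge0 B11) (ltW ln20).
have HE : k.+1%:R * (H * log_scale) =
    k.+1%:R * ((beta + 1 + e / 2) * log_scale) * (nu + 2).
  by rewrite /H /entropy_const -/B -/B1 -/beta; ring.
rewrite HE expRM; apply: ge0_ler_powR => //.
- by rewrite nnegrE le_max ler01.
- by rewrite nnegrE expR_ge0.
have be0 : 0 <= beta + 1 + e / 2 by rewrite addr_ge0 ?divr_ge0// addr_ge0.
have exp1 : 1 <= expR (k.+1%:R * ((beta + 1 + e / 2) * log_scale)).
  by rewrite -[leLHS]expR0 ler_expR mulr_ge0// mulr_ge0// ltW.
rewrite ge_max exp1/=.
have b1 : B1 <= expR (beta * log_scale).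
  rewrite -[leLHS](lnK (_ : B1 \is Num.pos)) ?posrE ?(lt_le_trans ltr01)//.
  rewrite ler_expR -[leLHS](divfK (lt0r_neq0 ln20)) ler_wpM2l//.
  exact: log_scale_ge.
have b2 : 2 ^+ k <= expR (k%:R * log_scale).
  have -> : 2 ^+ k = expR (k%:R * ln 2) :> R by rewrite expRM_natl lnK ?posrE.
  by rewrite ler_expR ler_wpM2l// log_scale_ge.
have b3 : chain_radius^-1 <= expR (e / 2 * log_scale).
  have lr : l `^ (e / 2) <= chain_radius.
    rewrite -[leLHS]ger0_norm ?powR_ge0// -sqrtr_sqr ler_wsqrtr//.
    rewrite -powR_mulrn ?powR_ge0// -powRrM mulrC mulrCA divff// mulr1.
    have : l `^ e <= variance_proxy.
      by rewrite /variance_proxy ler_peMl ?powR_ge0// le_max lexx orbT.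
    have := powR_ge0 l e; have := tail_ge0; lra.
  apply: (@le_trans _ _ (l `^ (e / 2))^-1).
    by rewrite lef_pV2 ?posrE// powR_gt0.
  rewrite -powRN /powR gt_eqF// ler_expR mulNr -mulrN -lnV ?posrE//.
  rewrite ler_wpM2l ?divr_ge0// /log_scale.
  apply: le_trans (_ : Num.max (ln l^-1) 0 <= _); first by rewrite le_max lexx.
  rewrite lerDl; apply: le_trans log_confidence_ge; exact: ltW.
rewrite invf_div (_ : B * _ = B * 2 ^+ k * chain_radius^-1); last by ring.
apply: (@le_trans _ _ (expR (beta * log_scale) * expR (k%:R * log_scale)
    * expR (e / 2 * log_scale))).
  apply: (@le_trans _ _ (B1 * 2 ^+ k * chain_radius^-1)).
    rewrite ler_wpM2r ?invr_ge0 ?(ltW r0)// ler_wpM2r ?exprn_ge0//.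
    by rewrite le_max lexx orbT.
  have B10 : 0 <= B1 by apply: le_trans B11.
  by rewrite !ler_pM ?mulr_ge0 ?exprn_ge0 ?invr_ge0 ?(ltW r0).
rewrite -!expRD ler_expR -!mulrDl mulrA ler_wpM2r ?(ltW L0)//.
rewrite -[k.+1%:R]natr1; have : 0 <= k%:R * (beta + e / 2).
  by rewrite mulr_ge0// addr_ge0// divr_ge0.
by lra.
Qed.

(** Radius times slope splits into a variance part of order sqrt(l^e L/n) and a Bernstein part of
    order L/n. Division by l^(d+m) produces the two denominators of the rate, and subadditivity of
    the square root separates the two summands of L. *)
Lemma deviation_rate (d m : nat) (dvol eps : R) : e = dvol - eps ->
  l ^- (d + m) * (10 * (chain_radius * chain_slope)) <=
  deviation_const A M nu e c * kde_rate d n m l dvol eps delta.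
Proof.
move=> eE; have h0 := entropy_const_ge0; have L0 := log_scale_gt0.
have lam0 : 0 <= ln (2 / delta).
  by apply: le_trans log_confidence_ge; apply: le_trans ln2_ge.
have ll0 : 0 <= Num.max (ln l^-1) 0 by rewrite le_max lexx orbT.
set v := n%:R * l `^ (2 * d%:R + 2 * m%:R - dvol + eps).
set b := n%:R * l ^+ (d + m).
have v0 : 0 < v by rewrite mulr_gt0 ?powR_gt0.
have b0 : 0 < b by rewrite mulr_gt0 ?exprn_gt0.
pose rate := log_scale / b + Num.sqrt (log_scale / v).
have rateE : rate <= kde_rate d n m l dvol eps delta.
  rewrite /kde_rate -/v -/b /rate /log_scale.
  move: lam0 ll0; move: (ln (2 / delta)) (Num.max _ _) => lam ll lam0 ll0.
  rewrite !mulrDl; have := @sqrtD_le (ll / v) (lam / v).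
  rewrite !divr_ge0 ?(ltW v0)// => /(_ isT isT); lra.
have c1 : 0 <= Num.max c 1 by rewrite le_max ler01 orbT.
have M1 : 0 <= Num.max M 1 by rewrite le_max ler01 orbT.
set D := 320 * (2 * H + 6); set D' := 16 * (4 * H + 4).
have D0 : 0 <= D by rewrite /D; lra.
have D'0 : 0 <= D' by rewrite /D'; lra.
have Ln0 : 0 <= log_scale / n%:R by rewrite divr_ge0// ltW.
have slopeE : chain_slope = Num.sqrt D * Num.sqrt (log_scale / n%:R).
  by rewrite /chain_slope -mulrA sqrtrM.
have radius_le : chain_radius <= Num.sqrt (150 * Num.max c 1) * Num.sqrt (l `^ e)
    + Num.sqrt D' * Num.max M 1 * Num.sqrt (log_scale / n%:R).
  apply: le_trans (sqrtD_le _ _) _ => //.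
    by rewrite mulr_ge0// ltW// variance_proxy_gt0.
  have p1 : 0 <= 150 * Num.max c 1 by rewrite mulr_ge0.
  have p2 : 0 <= D' * Num.max M 1 ^+ 2 by rewrite mulr_ge0 ?sqr_ge0.
  rewrite /variance_proxy [150 * _]mulrA sqrtrM// -/D' -[_ * _ / _]mulrA.
  by rewrite [X in _ + X <= _]sqrtrM// [Num.sqrt (D' * _)]sqrtrM// sqrtr_sqr ger0_norm.
have lp0 : 0 < l ^+ (d + m) by rewrite exprn_gt0.
have var_term : l ^- (d + m) * (Num.sqrt (l `^ e) * Num.sqrt (log_scale / n%:R)) =
    Num.sqrt (log_scale / v).
  rewrite -(ger0_norm (_ : 0 <= l ^- (d + m))) ?invr_ge0 ?(ltW lp0)//.
  rewrite -sqrtr_sqr -!sqrtrM ?sqr_ge0 ?powR_ge0//; congr Num.sqrt.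
  have lE : l `^ e = l ^+ (d + m) ^+ 2 / l `^ (2 * d%:R + 2 * m%:R - dvol + eps).
    rewrite -!powR_mulrn ?powR_ge0 ?(ltW l0)// -powRrM -powRB.
      by rewrite eE natrD; congr (_ `^ _); ring.
    by apply/implyP => _; rewrite gt_eqF.
  rewrite lE /v exprVn; field.
  by rewrite !lt0r_neq0 ?powR_gt0.
have bern_term : l ^- (d + m) * (Num.sqrt (log_scale / n%:R) ^+ 2) = log_scale / b.
  by rewrite sqr_sqrtr// /b; field; rewrite !lt0r_neq0.
apply: (@le_trans _ _ (10 * Num.sqrt D *
    (Num.sqrt (150 * Num.max c 1) * Num.sqrt (log_scale / v) +
     Num.sqrt D' * Num.max M 1 * (log_scale / b)))).
  rewrite -var_term -bern_term slopeE.
  set x := Num.sqrt (log_scale / n%:R) in radius_le *.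
  have x0 : 0 <= x by rewrite sqrtr_ge0.
  have w0 : 0 <= l ^- (d + m) * (10 * Num.sqrt D * x).
    by rewrite !mulr_ge0 ?sqrtr_ge0 ?invr_ge0 ?(ltW lp0).
  have := ler_wpM2l w0 radius_le; lra.
rewrite /deviation_const -/H -/D -/D' -[leRHS]mulrA.
apply: ler_wpM2l; first by rewrite mulr_ge0 ?sqrtr_ge0.
have Q0 : 0 <= Num.sqrt (150 * Num.max c 1) by rewrite sqrtr_ge0.
have Q1 : 0 <= Num.sqrt D' * Num.max M 1 by rewrite mulr_ge0 ?sqrtr_ge0.
have x1 : Num.sqrt (log_scale / v) <= kde_rate d n m l dvol eps delta.
  by apply: le_trans rateE; rewrite /rate lerDr divr_ge0// ltW.
have x2 : log_scale / b <= kde_rate d n m l dvol eps delta.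
  by apply: le_trans rateE; rewrite /rate lerDl sqrtr_ge0.
by rewrite [leRHS]mulrDl; apply: lerD; exact: ler_wpM2l.
Qed.

End constants.

(** * Derivatives of the estimator and of its mean *)

Section kernel_derivatives.
Context {R : realType} {d : nat}.
Local Notation T := 'rV[R]_d.

Lemma size_diff_seq (s : 'I_d -> nat) : size (diff_seq s) = multi_order s.
Proof.
rewrite /diff_seq /multi_order size_flatten sumnE /shape -map_comp big_map.
by rewrite big_enum/=; apply: eq_bigr => i _; rewrite /= size_nseq.
Qed.

Lemma measurable_foldr_partial (l : seq 'I_d) (f : T -> R) :
  measurable_fun setT f -> seq_derivable l f ->
  measurable_fun setT (foldr partial f l).
Proof.
move=> mf; elim: l => [//|i l IH /[dup] fil [fl _]].
apply: (@measurable_fun_cvg _ _ _ _ (fun n x => n.+1%:R *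
  (foldr partial f l (n.+1%:R^-1 *: delta_mx ord0 i + x) - foldr partial f l x))).
  move=> n; apply: measurable_funM => //; apply: measurable_funB; last exact: IH.
  apply: (measurableT_comp (IH fl)); apply: measurable_fun_rV => j.
  under eq_fun do rewrite !mxE; apply: measurable_funD => //.
  exact: measurable_coord_rV.
by move=> x _; exact: is_derive_cvg_harmonic (seq_derivable_partial fil x).
Qed.

Lemma mderiv_kde (s : 'I_d -> nat) (K : T -> R) n (xs : 'I_n -> T) h x :
  0 < h -> mderivable s K ->
  mderiv s (kde K xs h) x = (n%:R * h ^+ d)^-1 *
    \sum_(i < n) h^-1 ^+ multi_order s * mderiv s K (h^-1 *: (x - xs i)).
Proof.
move=> h0 sK.
have aff i := @foldr_partial_affine _ _ _ _ 1 _ (xs i) (lt0r_neq0 h0) sK.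
have [_] := foldr_partial_sum (n%:R * h ^+ d)^-1 (fun i => (aff i).1).
rewrite /mderiv (_ : (fun x => _) = kde K xs h); last first.
  by apply/funext => z; congr (_ * _); apply: eq_bigr => i _; rewrite mul1r.
move=> ->; congr (_ * _); apply: eq_bigr => i _.
by rewrite (aff i).2 mul1r size_diff_seq.
Qed.

(** All the summands have the same mean, so the mean of the estimator is an integral over a single
    observation y, under which [foldr_partial_integral] differentiates. *)
Lemma mderiv_mean_kde dO (Omega : measurableType dO) (Pr : probability Omega R)
    (P : probability T R) n (Y : 'I_n -> {RV Pr >-> T})
    (s : 'I_d -> nat) (K : T -> R) (M h : R) x : (0 < n)%N ->
  identically_distributed Y P -> 0 < h ->
  measurable_fun setT K -> mderivable s K ->
  (forall x, `|mderiv s K x| <= M) ->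
  (forall x, P.-integrable setT (EFin \o rescaled K x h)) ->
  mderivable s (mean_kde K Y h) ->
  (mderiv s (mean_kde K Y h) x)%:E = (\int[P]_y
    (h ^- d * h^-1 ^+ multi_order s * rescaled (mderiv s K) x h y)%:E)%E.
Proof.
move=> n0 distY h0 mK sK KM iK sF.
have nR0 : n%:R != 0 :> R by rewrite pnatr_eq0 -lt0n.
have hd0 : h ^+ d != 0 by rewrite expf_neq0// lt0r_neq0.
have aff y := @foldr_partial_affine _ _ _ _ (h ^- d) _ y (lt0r_neq0 h0) sK.
have mKx z : measurable_fun setT (rescaled K z h) by exact: measurable_rescaled.
rewrite /mderiv (@foldr_partial_integral _ _ _ _ P
  (fun y x => h ^- d * K (h^-1 *: (x - y))) _ _
  (`|h ^- d * h^-1 ^+ size (diff_seq s)| * M)) //.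
- apply: eq_integral => y _; rewrite (aff y).2 size_diff_seq//.
- by move=> y; exact: (aff y).1.
- by move=> y z; rewrite (aff y).2 normrM ler_wpM2l//; exact: KM.
- move=> z; under eq_fun do rewrite EFinM; apply: integrableZl => //; exact: iK.
move=> z; rewrite /mean_kde unlock.
have iY i := integral_identically_distributed distY i (mKx z) (iK z).
have -> : (\int[Pr]_w (kde K (Y ^~ w) h z)%:E =
    \int[P]_y (h ^- d * K (h^-1 *: (z - y)))%:E)%E.
  rewrite /kde; under eq_integral do rewrite EFinM -sumEFin.
  rewrite integralZl//; last first.
    by apply: integrable_sum => // i _; exact: (iY i).1.
  rewrite integral_sum//; last by move=> i; exact: (iY i).1.
  under eq_bigr do rewrite (iY _).2.
  under [RHS]eq_integral do rewrite EFinM.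
  rewrite [RHS]integralZl//; last exact: (iK z).
  rewrite -[X in (\sum_(_ < n) X)%E]fineK; last exact: integrable_fin_num (iK z).
  rewrite -[X in _ = (_ * X)%E]fineK; last exact: integrable_fin_num (iK z).
  rewrite sumEFin -!EFinM sumr_const card_ord -[_ *+ n]mulr_natr; congr EFin.
  by field; rewrite nR0 hd0.
rewrite fineK//; apply: (@integrable_fin_num _ _ _ P setT) => //.
by under eq_fun do rewrite EFinM; apply: integrableZl => //; exact: iK.
Qed.

End kernel_derivatives.

(** * Uniform deviation of the normalized class *)

Section deviation.
Context {R : realType} {d : nat}.
Local Notation T := 'rV[R]_d.
Context {dO : measure_display} {Omega : measurableType dO}.
Variables (Pr : probability Omega R) (P : probability T R) (n : nat).
Variable Y : 'I_n -> {RV Pr >-> T}.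
Hypotheses (indepY : independent Y) (distY : identically_distributed Y P).
Variables (X : set T) (D : T -> R) (M A nu l delta e c : R) (p : nat).
Hypotheses (n0 : (0 < n)%N) (mX : measurable X) (mD : measurable_fun setT D).
Hypotheses (DM : forall x, `|D x| <= M) (l0 : 0 < l) (A0 : 0 < A) (nu0 : 0 < nu).
Hypotheses (delta0 : 0 < delta) (delta1 : delta < 1) (e0 : 0 <= e).
Hypothesis ep : e <= (2 * p)%:R.
Hypothesis VC : uniform_VC (rescaled_class D X l) M A nu.
Hypothesis cP : second_moment_bound D X P e c.

(* A point of the parameter space is the pair (x, 1/h). *)
Let center (z : 'rV[R]_d.+1) : T := \row_i z ord0 (lift ord_max i).
(** In terms of 1/h the bandwidths h >= l become a bounded interval, and the scalar factor and the
    argument of [D] are polynomial in (z, y), which gives joint measurability. *)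
Let psi (z : 'rV[R]_d.+1) (y : T) : R :=
  (l * z ord0 ord_max) ^+ p * D (z ord0 ord_max *: (center z - y)).
Let Z : set 'rV[R]_d.+1 :=
  [set z | X (center z) /\ z ord0 ord_max \in `]0, l^-1]].

Let measurable_center : measurable_fun setT center.
Proof.
apply: measurable_fun_rV => i; under eq_fun do rewrite mxE.
exact: measurable_coord_rV.
Qed.

Let measurable_Z : measurable Z.
Proof.
rewrite (_ : Z = (center @^-1` X) `&`
    ((fun z : 'rV[R]_d.+1 => z ord0 ord_max) @^-1` [set` `]0, l^-1]])); last first.
  by apply/seteqP; split.
apply: measurableI; rewrite -[X in measurable X]setTI.
  exact: measurable_center.
exact: measurable_coord_rV.
Qed.

Let measurable_psi : measurable_fun setT (fun q : 'rV[R]_d.+1 * T => psi q.1 q.2).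
Proof.
have mz i : measurable_fun setT (fun q : 'rV[R]_d.+1 * T => q.1 ord0 i).
  exact: (measurableT_comp (measurable_coord_rV i) measurable_fst).
have my i : measurable_fun setT (fun q : 'rV[R]_d.+1 * T => q.2 ord0 i).
  exact: (measurableT_comp (measurable_coord_rV i) measurable_snd).
apply: measurable_funM; first by apply: measurable_funX; exact: measurable_funM.
apply: (measurableT_comp mD); apply: measurable_fun_rV => i.
under eq_fun do rewrite !mxE; apply: measurable_funM => //.
exact: measurable_funB.
Qed.

Let M0 : 0 <= M := le_trans (normr_ge0 _) (DM 0).

Let scale_le1 z : Z z -> 0 < l * z ord0 ord_max <= 1.
Proof.
move=> [_]; rewrite in_itv/= => /andP[g0 gl]; rewrite mulr_gt0//=.
by rewrite -(mulfV (lt0r_neq0 l0)) ler_pM2l.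
Qed.

Let psi_bound z y : Z z -> `|psi z y| <= M.
Proof.
move=> /scale_le1/andP[g0 g1].
have gp : 0 <= (l * z ord0 ord_max) ^+ p <= 1.
  by rewrite exprn_ge0 ?(ltW g0)//= exprn_ile1// ltW.
rewrite normrM ger0_norm; last by case/andP: gp.
by rewrite (le_trans (ler_piMl _ _) (DM _))//; case/andP: gp.
Qed.

(** With g = 1/h and lg <= 1, the hypothesis e <= 2p gives (lg)^(2p) <= (lg)^e, and the factor g^-e
    of the moment bound turns this into l^e. *)
Let psi_second_moment z : Z z ->
  (\int[P]_y (psi z y ^+ 2)%:E <= (variance_proxy e c l)%:E)%E.
Proof.
move=> Zz; have /andP[g0 g1] := scale_le1 Zz.
have [Xz] := Zz; rewrite in_itv/= => /andP[z0 zl].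
set g := z ord0 ord_max in g0 g1 z0 zl.
have gV0 : 0 < g^-1 by rewrite invr_gt0.
have := cP Xz gV0; rewrite unlock => bd.
have mr := measurable_rescaled (center z) g^-1 mD.
have -> : (\int[P]_y (psi z y ^+ 2)%:E = ((l * g) ^+ p ^+ 2)%:E *
    \int[P]_y (rescaled D (center z) g^-1 y ^+ 2)%:E)%E.
  rewrite -ge0_integralZl//.
  - by apply: eq_integral => y _; rewrite -EFinM /psi /rescaled invrK exprMn.
  - by apply/measurable_EFinP; exact: measurable_funX.
  - by move=> y _; rewrite lee_fin sqr_ge0.
  - by rewrite lee_fin sqr_ge0.
apply: (@le_trans _ _ (((l * g) ^+ p ^+ 2)%:E * (c * g^-1 `^ e)%:E)%E).
  by rewrite lee_wpmul2l// lee_fin sqr_ge0.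
rewrite -EFinM lee_fin /variance_proxy.
have lge : (l * g) ^+ p ^+ 2 <= (l * g) `^ e.
  rewrite -exprM mulnC -powR_mulrn ?(ltW g0)//.
  by apply: ger_powR => //; rewrite g0.
have lE : l `^ e = (l * g) `^ e * g^-1 `^ e.
  by rewrite -powRM ?mulr_ge0 ?(ltW l0) ?(ltW z0) ?(ltW gV0)// mulfK// lt0r_neq0.
have c1 : 0 <= Num.max c 1 by rewrite le_max ler01 orbT.
apply: (@le_trans _ _ ((l * g) ^+ p ^+ 2 * (Num.max c 1 * g^-1 `^ e))).
  by rewrite ler_wpM2l ?sqr_ge0// ler_wpM2r ?powR_ge0// le_max lexx.
by rewrite lE mulrCA ler_wpM2l// ler_wpM2r ?powR_ge0.
Qed.

Let H := entropy_const A M nu e.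
Let tau := chain_radius A M nu e c l delta n.
Let slope := chain_slope A M nu e l delta n.

Let swap_bound (y : 'I_n -> bool -> T) :
  weight [set e' | exists z, [/\ Z z,
      n%:R * (5 * (tau * slope)) < `|swap_diff e' (fun i b => psi z (y i b))| &
      \sum_i psi z (y i (~~ e' i)) ^+ 2 <=
        4 * n%:R * Num.sqrt (variance_proxy e c l) ^+ 2]]
  <= 2 ^+ n * (delta / 4).
Proof.
have v0 := variance_proxy_gt0 e c l0.
have tau0 : 0 < tau by exact: chain_radius_gt0.
have tauE := chain_radius_sqr A M c n nu0 e0 l0 delta0 delta1.
have H0 : 0 <= H := entropy_const_ge0 A M nu0 e0.
have L0 : 0 < log_scale l delta := log_scale_gt0 l delta0 delta1.
have b1 : 0 < Num.max M 1 by rewrite lt_max ltr01 orbT.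
have /(_ _)/cid N k := rescaled_cover p mD DM l0 A0 nu0 n0 VC y
  (divr_gt0 tau0 (exprn_gt0 k (ltr0n R 2))).
have /(_ _)/cid g k := projT2 (N k).
have gP k := projT2 (g k).
have N_le k : (projT1 (N k))%:R <= expR (k.+1%:R * (H * log_scale l delta)).
  have [+ _ _] := gP k; move/le_trans; apply; exact: cover_size_le.
have g_le k (j : 'I_(projT1 (N k))) i b : projT1 (g k) j i b ^+ 2 <= Num.max M 1 ^+ 2.
  have [_ + _] := gP k => /(_ j i b) gM.
  rewrite -(real_normK (num_real (projT1 (g k) j i b))).
  rewrite lerXn2r ?nnegrE ?(ltW b1)//.
  by rewrite (le_trans gM)// le_max lexx.
have g_cover k (z : {z | Z z}) : exists j : 'I_(projT1 (N k)),
    sqn (fun i b => psi (sval z) (y i b) - projT1 (g k) j i b) <=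
      2 * n%:R * (tau / 2 ^+ k) ^+ 2.
  have [_ _] := gP k; case: z => z Zz /=.
  have [Xz] := Zz; rewrite in_itv/= => /andP[z0 zl].
  have lz : l <= (z ord0 ord_max)^-1.
    by rewrite -[l]invrK lef_pV2 ?posrE// invr_gt0.
  by move=> /(_ _ _ Xz lz) [j]; rewrite /rescaled invrK => jP; exists j.
have tail0 : 0 <= 16 * (4 * H + 4) * Num.max M 1 ^+ 2 * log_scale l delta / n%:R.
  rewrite divr_ge0 ?ler0n// mulr_ge0 ?(ltW L0)// mulr_ge0 ?sqr_ge0//; lra.
have tau_var : 150 * Num.sqrt (variance_proxy e c l) ^+ 2 <= tau ^+ 2.
  by rewrite tauE sqr_sqrtr ?(ltW v0)// lerDl.
have tau_b : 16 * (4 * H + 4) * Num.max M 1 ^+ 2 * log_scale l delta / n%:R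
    <= tau ^+ 2.
  by rewrite tauE lerDr mulr_ge0// ltW.
have := weight_swap_sup n0 tau0 b1 H0 L0 delta0 delta1
  (expR_log_scale l delta0) N_le g_le g_cover tau_var tau_b.
apply: le_trans.
apply: weight_le => e' [z [Zz zd zs]]; exists (exist _ z Zz); split=> //.
by move: zd; rewrite mulrA [n%:R * 5]mulrC.
Qed.

Lemma uniform_deviation : exists E, [/\ measurable E, ((1 - delta)%:E <= Pr E)%E &
  forall w, E w -> forall x h, X x -> l <= h ->
    `|\sum_i (rescaled D x h (Y i w) - fine (\int[P]_y (rescaled D x h y)%:E))|
      <= (h / l) ^+ p * (2 * n%:R * (5 * (tau * slope)))].
Proof.
have v0 := variance_proxy_gt0 e c l0.
have sigma0 : 0 < Num.sqrt (variance_proxy e c l) by rewrite sqrtr_gt0.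
have u0 : 0 < 5 * (tau * slope).
  by rewrite mulr_gt0// mulr_gt0// ?chain_radius_gt0 ?chain_slope_gt0.
have [||E [mE PE EP]] := symmetrization indepY distY n0 measurable_Z
  measurable_psi psi_bound _ sigma0 u0 _ delta0 swap_bound.
- by move=> z Zz; rewrite sqr_sqrtr ?(ltW v0)//; exact: psi_second_moment.
- rewrite sqr_sqrtr ?(ltW v0)//; exact: chain_deviation_ge.
exists E; split=> // w Ew x h Xx lh.
have h0 : 0 < h := lt_le_trans l0 lh.
pose z := rcons_rV (x, h^-1).
have zmax : z ord0 ord_max = h^-1 by rewrite mxE unlift_none.
have zx : center z = x by apply/rowP => i; rewrite !mxE liftK.
have Zz : Z z.
  by rewrite /Z /= zmax zx in_itv/= invr_gt0 h0 lef_pV2.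
have := EP w Ew z Zz.
have psiE y : psi z y = (l / h) ^+ p * rescaled D x h y.
  by rewrite /psi zmax zx.
have lh0 : 0 < (l / h) ^+ p by rewrite exprn_gt0// divr_gt0.
have ir : P.-integrable setT (EFin \o rescaled D x h).
  apply: (bounded_integrable P (B := M)); first exact: measurable_rescaled.
  by move=> y; exact: DM.
have -> : fine (\int[P]_y (psi z y)%:E) =
    (l / h) ^+ p * fine (\int[P]_y (rescaled D x h y)%:E).
  under eq_integral do rewrite psiE EFinM.
  by rewrite integralZl// fineM//; exact: integrable_fin_num ir.
rewrite (_ : \sum_i _ = (l / h) ^+ p * \sum_i (rescaled D x h (Y i w) -
    fine (\int[P]_y (rescaled D x h y)%:E))); last first.
  by rewrite mulr_sumr; apply: eq_bigr => i _; rewrite psiE mulrBr.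
rewrite normrM (gtr0_norm lh0) -ler_pdivlMl// -exprVn invf_div.
by [].
Qed.

End deviation.

Theorem theorem20 (R : realType) :
  exists C : R -> R -> nat -> R -> R -> R -> R -> R,
  forall (d : nat) (X : set 'rV[R]_d) (P : probability 'rV[R]_d R) (dvol : R)
    (s : 'I_d -> nat) (K : 'rV[R]_d -> R) (M A nu : R)
    (n : nat) (l delta : R)
    (dO : measure_display) (Omega : measurableType dO)
    (Pr : probability Omega R) (Y : 'I_n -> {RV Pr >-> 'rV[R]_d}),
  (0 < d)%N -> (0 < n)%N ->
  measurable X ->
  volume_dim X P = dvol%:E -> dvol <= 2 * d%:R + 2 * (multi_order s)%:R ->
  independent Y -> identically_distributed Y P ->
  0 < l -> 0 < delta < 1 ->
  measurable_fun [set: 'rV[R]_d] K ->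
  mderivable s K ->
  sup_norm (mderiv s K) = M%:E ->
  (\int[@lebesgue_measure R]_(t in `]0%R, +oo[)
     ((t `^ (dvol - 1))%:E *
      tail_sup (fun x => (mderiv s K x ^+ 2)%R) t)
   < +oo)%E ->
  (L2norm (@lebesgue_rV R d) (mderiv s K) < +oo)%E ->
  0 < A -> 0 < nu ->
  uniform_VC (rescaled_class (mderiv s K) X l) M A nu ->
  (forall x h, l <= h -> P.-integrable setT (EFin \o rescaled K x h)) ->
  (forall h, l <= h -> mderivable s (mean_kde K Y h)) ->
  forall eps : R,
  0 < eps < dvol \/
    (eps = 0 /\ (dvol = 0 \/ (vol_limsup X P dvol < +oo)%E)) ->
  (exists c, second_moment_bound (mderiv s K) X P (dvol - eps) c) /\
  forall c, second_moment_bound (mderiv s K) X P (dvol - eps) c ->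
    prob_ge Pr
      [set w | (kde_deviation s K X l Y w <=
        (C A M d nu dvol c eps *
         kde_rate d n (multi_order s) l dvol eps delta)%:E)%E]
      (1 - delta).
Proof.
exists (fun A M _ nu dvol c eps => deviation_const A M nu (dvol - eps) c).
move=> d X P dvol s K M A nu n l delta dO Omega Pr Y d0 n0 mX dv dvp indepY distY
  l0 /andP[delta0 delta1] mK sK supK tail _ A0 nu0 VC iK sF eps epsP.
have KM x : `|mderiv s K x| <= M.
  by rewrite -lee_fin -supK; apply: ereal_sup_ubound; exists x.
have mD : measurable_fun setT (mderiv s K) by exact: measurable_foldr_partial.
split; first exact: (second_moment_bound_exists d0 mD KM dv tail epsP).
move=> c cP; set m := multi_order s in dvp *.
have [e0 _] := volume_dim_ball_measure_le dv epsP.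
have eps0 : 0 <= eps by case: epsP => [/andP[/ltW]|[->]].
have ep : dvol - eps <= (2 * (d + m))%:R.
  by rewrite natrM natrD; move: dvp; lra.
have [E [mE PE EP]] := uniform_deviation indepY distY n0 mX mD KM l0 A0 nu0
  delta0 delta1 e0 ep VC cP.
exists E; split=> // w Ew /=.
apply: ge_ereal_sup => _ [h lh [x Xx <-]]; rewrite lee_fin.
have h0 : 0 < h := lt_le_trans l0 lh.
apply: le_trans (deviation_rate A M c nu0 e0 l0 delta0 delta1 n0 d m erefl).
have nR0 : 0 < n%:R :> R by rewrite ltr0n.
have mr := measurable_rescaled x h mD.
have ir : P.-integrable setT (EFin \o rescaled (mderiv s K) x h).
  by apply: (bounded_integrable P (B := M) mr) => y; exact: KM.
have meanE : mderiv s (mean_kde K Y h) x = h ^- d * h^-1 ^+ m *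
    fine (\int[P]_y (rescaled (mderiv s K) x h y)%:E).
  apply: EFin_inj; rewrite (mderiv_mean_kde x n0 distY h0 mK sK KM _ (sF h lh)).
    under eq_integral do rewrite EFinM.
    by rewrite integralZl// [RHS]EFinM fineK//; exact: integrable_fin_num ir.
  by move=> z; exact: iK.
rewrite mderiv_kde// meanE.
set I := fine _.
have -> : (n%:R * h ^+ d)^-1 * \sum_(i < n) h^-1 ^+ m *
      mderiv s K (h^-1 *: (x - Y i w)) - h ^- d * h^-1 ^+ m * I =
    h ^- (d + m) * n%:R^-1 * \sum_i (rescaled (mderiv s K) x h (Y i w) - I).
  rewrite sumrB sumr_const card_ord -mulr_sumr exprD invfM exprVn.
  rewrite -[I *+ n]mulr_natr /rescaled; field.
  by rewrite !expf_neq0 ?lt0r_neq0.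
have hp0 : 0 < h ^- (d + m) by rewrite invr_gt0 exprn_gt0.
rewrite normrM ger0_norm; last by rewrite mulr_ge0 ?(ltW hp0)// invr_ge0 ltW.
(* The factor (h/l)^(d+m) left by the normalization meets h^-(d+m): the bound no longer depends on
   h. *)
apply: (@le_trans _ _ (h ^- (d + m) * n%:R^-1 * ((h / l) ^+ (d + m) *
    (2 * n%:R * (5 * (chain_radius A M nu (dvol - eps) c l delta n *
      chain_slope A M nu (dvol - eps) l delta n)))))).
  apply: ler_wpM2l; first by rewrite mulr_ge0 ?(ltW hp0)// invr_ge0 ltW.
  exact: EP.
rewrite le_eqVlt; apply/orP; left; apply/eqP.
rewrite expr_div_n; field.
by rewrite !expf_neq0 ?lt0r_neq0.
Qed.
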